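(* Let $\mu>0$, $T>0$, and let $u\in C([0,T];\dot Z_{2,2})$ be a real valued solution of the initial value problem $$u_t+uu_x+\mathcal{H}u_{xx}+\mu(\mathcal{H}u_x+\mathcal{H}u_{xxx})=0,\quad t>0,\ x\in\mathbb{R},\qquad u(0)=\phi.$$ If there exist three different times $t_1,t_2,t_3\in[0,T]$ such that $$u(\cdot,t_j)\in Z_{5/2,5/2},\qquad j=1,2,3,$$ then there exists $t^*>t_1$ such that $u(x,t)\equiv0$ for all $t\ge t^*$.
   Context: $\mathcal{H}$ is the Hilbert transform, $\widehat{\mathcal{H}f}(\xi)=i\,\mathrm{sgn}(\xi)\widehat f(\xi)$. The weighted Sobolev spaces are $Z_{s,r}=H^s(\mathbb{R})\cap L^2(|x|^{2r}\,dx)$, with norm $\|f\|_{Z_{s,r}}^2=\|f\|_s^2+\|(1+|x|^2)^{r/2}f\|_{L^2}^2$, where $\|f\|_s=\|(1+|\xi|^2)^{s/2}\widehat f(\xi)\|_{L^2}$, and $\dot Z_{s,r}=\{f\in Z_{s,r}:\widehat f(0)=0\}$. Solutions are understood through the integral equation $u(t)=S(t)\phi-\int_0^tS(t-\tau)[u(\tau)u_x(\tau)]\,d\tau$, where $\widehat{S(t)\phi}(\xi)=e^{(i\xi|\xi|+\mu(|\xi|-|\xi|^3))t}\,\widehat\phi(\xi)$ for $t\ge0$. *)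

(* Defs.v *)
(* MathComp-Analysis, with mathcomp-real-closed for the complex numbers R[i]. *)
From HB Require Import structures.
From mathcomp Require Import all_boot all_order all_algebra.
From mathcomp Require Import complex.
From mathcomp Require Import all_classical all_reals all_analysis.

Set Implicit Arguments.
Unset Strict Implicit.
Unset Printing Implicit Defensive.

Import Order.TTheory GRing.Theory Num.Theory.
Import numFieldNormedType.Exports.

Local Open Scope classical_set_scope.
Local Open Scope complex_scope.
Local Open Scope ring_scope.

Definition cexp (R : realType) (z : R[i]) : R[i] :=
  (expR (complex.Re z) * cos (complex.Im z)) +i*
  (expR (complex.Re z) * sin (complex.Im z)).

Definition cintegral (R : realType) (D : set R) (g : R -> R[i]) : R[i] :=
  (\int[@lebesgue_measure R]_(x in D) complex.Re (g x)) +i*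
  (\int[@lebesgue_measure R]_(x in D) complex.Im (g x)).

(* The Fourier transform is the unitary one, defined by its integral, with the
   sign for which d/dx has symbol i xi, as the symbol of S(t) below requires.
   It is only meaningful on integrable functions.  This suffices here: it is
   applied to elements of Z_{s,r} with r > 1/2, which are integrable by the
   Cauchy-Schwarz inequality, and to products of two L^2 functions. *)
Definition fourier (R : realType) (g : R -> R[i]) (xi : R) : R[i] :=
  (Num.sqrt (2 * pi))^-1%:C *
  cintegral setT (fun x => cexp (0 +i* - (x * xi)) * g x).

Definition inv_fourier (R : realType) (g : R -> R[i]) (x : R) : R[i] :=
  (Num.sqrt (2 * pi))^-1%:C *
  cintegral setT (fun xi => cexp (0 +i* (x * xi)) * g xi).

Definition toC (R : realType) (f : R -> R) (x : R) : R[i] := (f x)%:C.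

(* ||f||_s, with value in [0, +oo] *)
Definition Hnorm (R : realType) (s : R) (f : R -> R) : \bar R :=
  Lnorm (@lebesgue_measure R) 2%:E (fun xi =>
    ((1 + xi ^+ 2) `^ (s / 2) * ComplexField.Normc.normc (fourier (toC f) xi))%:E).

(* Elements of L^2 and of the spaces below are represented by measurable
   functions; two representatives that are equal a.e. are identified. *)
Definition Hs (R : realType) (s : R) : set (R -> R) :=
  [set f : R -> R | f \in Lfun (@lebesgue_measure R) 2%:E /\ (Hnorm s f < +oo)%E].

Definition L2weight (R : realType) (r : R) : set (R -> R) :=
  [set f : R -> R | measurable_fun setT f /\
    (\int[@lebesgue_measure R]_x ((`|x| `^ (2 * r)) * f x ^+ 2)%:E < +oo)%E].

Definition Z (R : realType) (s r : R) : set (R -> R) := Hs s `&` L2weight r.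

Definition Znorm (R : realType) (s r : R) (f : R -> R) : \bar R :=
  ((Hnorm s f ^+ 2 +
    Lnorm (@lebesgue_measure R) 2%:E (fun x =>
       ((1 + x ^+ 2) `^ (r / 2) * f x)%:E) ^+ 2) `^ 2^-1)%E.

Definition Zdot (R : realType) (s r : R) : set (R -> R) :=
  [set f : R -> R | Z s r f /\ fourier (toC f) 0 = 0].

(* u \in C([0,T]; Zdot_{s,r}); the values of u outside [0,T] are irrelevant. *)
Definition continuous_in_Zdot (R : realType) (T s r : R) (u : R -> R -> R) :=
  (forall t, t \in `[0, T] -> Zdot s r (u t)) /\
  (forall t0, t0 \in `[0, T] ->
     Znorm s r (u t \- u t0) @[t --> within `[0, T] (nbhs t0)] --> 0%E).

Definition symbol (R : realType) (mu xi : R) : R[i] :=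
  (mu * (`|xi| - `|xi| ^+ 3)) +i* (xi * `|xi|).

Definition Sgroup (R : realType) (mu t : R) (g : R -> R[i]) : R -> R[i] :=
  inv_fourier (fun xi => cexp (symbol mu xi * t%:C) * fourier g xi).

(* The derivative f_x as a Fourier multiplier.  For f in Z_{2,2} the inverse
   transform converges absolutely and gives the classical derivative of the
   C^1 representative of f. *)
Definition Dx (R : realType) (g : R -> R[i]) : R -> R[i] :=
  inv_fourier (fun xi => (0 +i* xi) * fourier g xi).

(* Solution of the initial value problem on [0,T] in the sense of the integral
   equation  u(t) = S(t) phi - int_0^t S(t - tau) [u(tau) u_x(tau)] dtau.  For
   u in C([0,T]; Zdot_{2,2}) the integrand is, for each x, continuous in tau,
   and the integral in tau can be taken pointwise in x. *)
Definition is_solution (R : realType) (mu T : R) (phi : R -> R)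
    (u : R -> R -> R) :=
  {ae @lebesgue_measure R, forall x, u 0 x = phi x} /\
  (forall t, t \in `[0, T] ->
     {ae @lebesgue_measure R, forall x,
        (u t x)%:C = Sgroup mu t (toC phi) x -
          cintegral `[0, t] (fun tau =>
            Sgroup mu (t - tau) (fun y => toC (u tau) y * Dx (toC (u tau)) y) x)}).

(* Main.v *)
Require Import Defs.
From mathcomp Require Import all_boot all_order all_algebra.
From mathcomp Require Import complex.
From mathcomp Require Import all_classical all_reals all_analysis.
From mathcomp Require Import measurable_realfun.
From mathcomp Require Import ring lra.

(** The obstruction to decay is the damping rate
    [nu (`|xi|^3 - `|xi|)], which is not smooth at the frequency 0; here [nu] is
    the coefficient of the equation, [mu] being kept for Lebesgue measure. Write
    [uhat t xi] for the transform of the solution, [M t] for its first moment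
    and [A t] for the integral of its square. On the Fourier side the integral
    equation between two times [s <= t] reads ([uhat_duhamel])

      uhat t xi = F (t - s) xi * uhat s xi
                  - (i xi / 2) * int_s^t F (t - tau) xi * J tau xi dtau,

    where [F] is the multiplier of the linear evolution and [J tau] the
    transform of the square of the solution. As [uhat t 0 = 0], the transform
    behaves like [- i M t xi / sqrt (2 pi)] near the origin.

    The coefficient of [xi] in this equation gives [moment_law]: the derivative
    of [M] is [A / 2], so [M] is nondecreasing. In the next order the term
    [nu `|xi|] of the damping rate produces [xi `|xi|] with a coefficient
    proportional to

      (t - s) M s + (1/2) int_s^t (t - tau) A tau dtau.

    If the solution at the times [s] and [t] is square integrable against
    [`|x|^5], then its sine transforms have no term of this kind. They need not
    be twice differentiable at the origin, but the second difference between
    [2 xi] and [xi] is [o(xi^2)] ([sin_transform_second_difference]), which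
    already forces the coefficient to vanish ([moment_identity]).

    Given three such times, the two identities between neighbours and the
    monotonicity of [M] leave only [A = 0] at the middle one
    ([energy_middle_time]). From then on the solution is equal to its own Duhamel
    term. Parabolic smoothing bounds that term in L^2 by the maximum of [A]
    ([duhamel_le]), so [A t] is at most [C] times the square of the
    maximum of [A] up to [t]; by continuous induction [A] stays 0
    ([energy_stays_zero]).

    Two preparations take most of the space. The equation is given pointwise
    almost everywhere in physical space, and its passage to the transforms needs
    an inversion theorem for integrable functions ([fourier_inversion], by Abel
    summation and Poisson kernels) and the product rule
    [fourier_mul_inv_fourier]. Continuity in the norm of [Z_{2,2}] has to be
    turned into continuity in time of [J] at a fixed frequency
    ([L2path_convolution_continuous]). *)

Set Implicit Arguments.
Unset Strict Implicit.
Unset Printing Implicit Defensive.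

Import Order.TTheory GRing.Theory Num.Theory.
Import numFieldNormedType.Exports.
Local Open Scope classical_set_scope.
Local Open Scope complex_scope.
Local Open Scope ring_scope.
Local Notation normc := ComplexField.Normc.normc.
Local Notation cRe := complex.Re.
Local Notation cIm := complex.Im.

(** * Real integrals *)

Section RealIntegrals.
Context d (T : measurableType d) (R : realType).
Variable m : {measure set T -> \bar R}.
Implicit Types (D : set T) (f g h : T -> R).

Lemma integrableR_le D f h : measurable D -> measurable_fun D f ->
  (forall x, D x -> `|f x| <= h x) ->
  m.-integrable D (EFin \o h) -> m.-integrable D (EFin \o f).
Proof.
move=> mD mf fh; apply: le_integrable => //; first exact/measurable_EFinP.
by move=> x Dx /=; rewrite lee_fin (le_trans (fh _ Dx))// ler_norm.
Qed.

Lemma integrableR_measurable D f : m.-integrable D (EFin \o f) -> measurable_fun D f.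
Proof. by move=> /measurable_int/measurable_EFinP. Qed.

Lemma integrableRD D f g : measurable D -> m.-integrable D (EFin \o f) ->
  m.-integrable D (EFin \o g) -> m.-integrable D (EFin \o (fun x => f x + g x)).
Proof. by move=> mD If Ig; apply: (integrableD mD If Ig). Qed.

Lemma integrableRB D f g : measurable D -> m.-integrable D (EFin \o f) ->
  m.-integrable D (EFin \o g) -> m.-integrable D (EFin \o (fun x => f x - g x)).
Proof. by move=> mD If Ig; apply: (integrableB mD If Ig). Qed.

Lemma integrableRZ D f (c : R) : measurable D -> m.-integrable D (EFin \o f) ->
  m.-integrable D (EFin \o (fun x => c * f x)).
Proof. by move=> mD If; apply: (integrableZl mD c If). Qed.

Lemma integrableR_norm D f : measurable D -> m.-integrable D (EFin \o f) ->
  m.-integrable D (EFin \o (fun x => `|f x|)).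
Proof. by move=> mD If; exact: integrable_norm If. Qed.

Lemma integrableR_ltoo D f : measurable D -> measurable_fun D f ->
  (forall x, D x -> 0 <= f x) -> (\int[m]_(x in D) (f x)%:E < +oo)%E ->
  m.-integrable D (EFin \o f).
Proof.
move=> mD mf f0 foo; apply/integrableP; split; first exact/measurable_EFinP.
rewrite (eq_integral (fun x => (f x)%:E))// => x /set_mem Dx /=.
by rewrite ger0_norm// f0.
Qed.

Lemma EFin_Rintegral D f : measurable D -> m.-integrable D (EFin \o f) ->
  (\int[m]_(x in D) f x)%:E = (\int[m]_(x in D) (f x)%:E)%E.
Proof. by move=> mD If; rewrite /Rintegral fineK//; exact: integrable_fin_num. Qed.

Lemma norm_Rintegral_le D f h : measurable D -> measurable_fun D f ->
  (forall x, D x -> `|f x| <= h x) -> m.-integrable D (EFin \o h) ->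
  `|\int[m]_(x in D) f x| <= \int[m]_(x in D) h x.
Proof.
move=> mD mf fh Ih; have If := integrableR_le mD mf fh Ih.
apply: le_trans (le_normr_Rintegral mD If) _.
by apply: le_Rintegral => //; exact: integrableR_norm.
Qed.

Lemma RintegralN D f : measurable D -> m.-integrable D (EFin \o f) ->
  \int[m]_(x in D) (- f x) = - \int[m]_(x in D) f x.
Proof.
move=> mD If; rewrite -mulN1r -RintegralZl//.
by apply: eq_Rintegral => x _; rewrite mulN1r.
Qed.

Lemma ae_eq_Rintegral D f g : measurable D ->
  measurable_fun D f -> measurable_fun D g ->
  {ae m, forall x, D x -> f x = g x} ->
  \int[m]_(x in D) f x = \int[m]_(x in D) g x.
Proof.
move=> mD mf mg fg; rewrite /Rintegral; congr fine.
apply: ae_eq_integral => //; [exact/measurable_EFinP|exact/measurable_EFinP|].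
by apply: filterS fg => x /[apply] ->.
Qed.

Lemma Rintegral_dominated D (F : nat -> T -> R) f h : measurable D ->
  (forall n, measurable_fun D (F n)) ->
  (forall x, D x -> F n x @[n --> \oo] --> f x) ->
  m.-integrable D (EFin \o h) ->
  (forall n x, D x -> `|F n x| <= h x) ->
  \int[m]_(x in D) F n x @[n --> \oo] --> \int[m]_(x in D) f x.
Proof.
move=> mD mF Ff Ih Fh.
have mf : measurable_fun D f by apply: measurable_fun_cvg mF Ff.
have fh x : D x -> `|f x| <= h x.
  move=> Dx; have Fx : `|F n x| @[n --> \oo] --> `|f x| by apply: cvg_norm; exact: Ff.
  by rewrite -(cvg_lim _ Fx)//; apply: limr_le;
    [apply/cvg_ex; eexists; exact: Fx|apply: nearW => n; exact: Fh].
have If := integrableR_le mD mf fh Ih.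
apply: fine_cvg; rewrite fineK; last exact: integrable_fin_num.
apply: (@dominated_cvg _ _ _ _ _ mD (fun n x => (F n x)%:E) _ (EFin \o h)) => //.
- by move=> n; exact/measurable_EFinP.
- by move=> x Dx; apply: cvg_EFin; [exact: nearW|exact: Ff].
Qed.

End RealIntegrals.

Section RealFubini.
Context (d1 d2 : measure_display) (T1 : measurableType d1) (T2 : measurableType d2)
  (R : realType).
Variables (m1 : {sigma_finite_measure set T1 -> \bar R})
  (m2 : {sigma_finite_measure set T2 -> \bar R}).

Lemma Rintegral_inner_integrable (F : T1 * T2 -> R) :
  (m1 \x m2)%E.-integrable setT (EFin \o F) ->
  m1.-integrable setT (EFin \o (fun x => \int[m2]_y F (x, y))).
Proof.
move=> IF; have := integrable_fubini_F IF => IG.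
apply: le_integrable IG => //.
  apply/measurable_EFinP; apply: measurableT_comp; first exact: fine_measurable.
  exact: (measurable_fubini_F IF).
move=> x _ /=; rewrite /Rintegral /fubini_F /=.
by case: (\int[m2]_y (F (x, y))%:E)%E => //= *; rewrite ?normr0 ?lexx ?leey.
Qed.

Lemma Rintegral_Fubini1 (F : T1 * T2 -> R) :
  (m1 \x m2)%E.-integrable setT (EFin \o F) ->
  \int[m1]_x \int[m2]_y F (x, y) = fine (\int[(m1 \x m2)%E]_z (F z)%:E)%E.
Proof.
move=> IF; rewrite -[RHS](_ : fine (\int[m1]_x (fubini_F m2 (EFin \o F)) x)%E = _); last first.
  by rewrite integral12_prod_meas1.
rewrite /Rintegral; congr fine; apply: ae_eq_integral => //.
- exact: measurable_int (Rintegral_inner_integrable IF).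
- exact: (measurable_fubini_F IF).
- have := ae_integrable1 IF; apply: filterS => x Ix _.
  by rewrite /fubini_F /Rintegral fineK//; exact: integrable_fin_num.
Qed.

End RealFubini.

Section RealFubini2.
Context (d1 d2 : measure_display) (T1 : measurableType d1) (T2 : measurableType d2)
  (R : realType).
Variables (m1 : {sigma_finite_measure set T1 -> \bar R})
  (m2 : {sigma_finite_measure set T2 -> \bar R}).

Lemma Rintegral_Fubini2 (F : T1 * T2 -> R) :
  (m1 \x m2)%E.-integrable setT (EFin \o F) ->
  \int[m2]_y \int[m1]_x F (x, y) = fine (\int[(m1 \x m2)%E]_z (F z)%:E)%E.
Proof.
move=> IF; rewrite -[RHS](_ : fine (\int[m2]_x (fubini_G m1 (EFin \o F)) x)%E = _); last first.
  by rewrite integral21_prod_meas1.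
rewrite /Rintegral; congr fine; apply: ae_eq_integral => //.
- apply/measurable_EFinP; apply: measurableT_comp; first exact: fine_measurable.
  exact: (measurable_fubini_G IF).
- exact: (measurable_fubini_G IF).
- have := ae_integrable2 IF; apply: filterS => x Ix _.
  by rewrite /fubini_G /Rintegral fineK//; exact: integrable_fin_num.
Qed.

Lemma Rintegral_Fubini (F : T1 * T2 -> R) :
  (m1 \x m2)%E.-integrable setT (EFin \o F) ->
  \int[m1]_x \int[m2]_y F (x, y) = \int[m2]_y \int[m1]_x F (x, y).
Proof. by move=> IF; rewrite Rintegral_Fubini1// Rintegral_Fubini2. Qed.

Lemma integrable_prod_bound (F : T1 * T2 -> R) (f : T1 -> R) (g : T2 -> R) :
  measurable_fun setT F ->
  (forall x y, `|F (x, y)| <= f x * g y) ->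
  m1.-integrable setT (EFin \o f) -> m2.-integrable setT (EFin \o g) ->
  (m1 \x m2)%E.-integrable setT (EFin \o F).
Proof.
move=> mF Fb If Ig.
have mg := integrableR_measurable Ig; have mf := integrableR_measurable If.
apply/integrable12ltyP; first exact/measurable_EFinP.
apply: (@le_lt_trans _ _ (\int[m1]_x (`|f x| * fine (\int[m2]_y `|g y|%:E)%E)%:E)%E).
  apply: ge0_le_integral => //.
  - by move=> x _; apply: integral_ge0.
  - apply: (measurable_fun_fubini_tonelli_F (fun z => `|(F z)%:E|%E)) => //.
    by apply: measurableT_comp => //; exact/measurable_EFinP.
  - apply/measurable_EFinP; apply: measurable_funM => //.
    exact: measurableT_comp.
  - move=> x _; rewrite EFinM fineK; last first.
      exact: (integrable_fin_num measurableT (integrableR_norm measurableT Ig)).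
    rewrite -ge0_integralZl//; last first.
      by apply/measurable_EFinP; exact: measurableT_comp.
    apply: ge0_le_integral => //.
    + apply: measurableT_comp => //; apply/measurable_EFinP.
      by apply: measurableT_comp => //.
    + by apply: measurable_funeM; apply/measurable_EFinP; exact: measurableT_comp.
    + move=> y _ /=; rewrite lee_fin (le_trans (Fb _ _))// -normrM; exact: ler_norm.
under eq_integral do rewrite EFinM.
rewrite ge0_integralZr//; last 2 first.
- by apply/measurable_EFinP; exact: measurableT_comp.
- by rewrite lee_fin fine_ge0// integral_ge0.
have := integrable_fin_num measurableT (integrableR_norm measurableT If).
move=> /fineK /= <-; rewrite -EFinM; exact: ltry.
Qed.

End RealFubini2.

(** * Kernels on the line *)

Section Line.
Context (R : realType).
Local Notation mu := (@lebesgue_measure R).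
Implicit Types (f g h : R -> R) (x y z c e : R).

Lemma continuous_line_measurable f : continuous f -> measurable_fun setT f.
Proof. exact: continuous_measurable_fun. Qed.

Let reflect c : measurableTypeR R -> measurableTypeR R := fun x => c - x.

Let measurable_reflect c : measurable_fun setT (reflect c).
Proof. by apply: measurable_funB. Qed.

Let lebesgue_measure_reflect c (A : set R) : measurable A ->
  pushforward mu (reflect c) A = mu A.
Proof.
move=> mA; apply/esym/lebesgue_measure_unique => //= _ [[a b]] _ <-.
rewrite /pushforward/= (_ : _ @^-1` _ = `[c - b, c - a[%classic); last first.
  by apply/seteqP; split => x /=; rewrite /reflect !in_itv/= => /andP[? ?]; apply/andP; split; lra.
rewrite !lebesgue_measure_itv/= !lte_fin ltrD2l ltrN2.
by case: ifP => // _; congr EFin; ring.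
Qed.

Lemma continuous_cosM z : continuous (fun x => cos (x * z)).
Proof.
move=> x; apply: (@continuous_comp _ _ _ (fun x => x * z) cos); last exact: continuous_cos.
by apply: cvgM => //; exact: cvg_cst.
Qed.

Lemma continuous_sinM z : continuous (fun x => sin (x * z)).
Proof.
move=> x; apply: (@continuous_comp _ _ _ (fun x => x * z) sin); last exact: continuous_sin.
by apply: cvgM => //; exact: cvg_cst.
Qed.

Lemma integrable_reflect f c : mu.-integrable setT (EFin \o f) ->
  mu.-integrable setT (EFin \o (fun x => f (c - x))).
Proof.
move=> If; have mf := integrableR_measurable If; have mr := @measurable_reflect c.
apply/integrableP; split.
  by apply/measurable_EFinP; apply: (measurableT_comp mf mr).
case/integrableP : If => _; apply: le_lt_trans.
rewrite -(@ge0_integral_pushforward _ _ _ _ _ _ mr mu setT (fun x => `|(f x)%:E|%E))//.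
- rewrite (@eq_measure_integral _ _ _ _ mu)// => A mA _.
  exact: lebesgue_measure_reflect.
- by apply: measurableT_comp => //; exact/measurable_EFinP.
Qed.

Lemma Rintegral_reflect f c : mu.-integrable setT (EFin \o f) ->
  \int[mu]_x f (c - x) = \int[mu]_x f x.
Proof.
move=> If; rewrite /Rintegral; congr fine; have mr := @measurable_reflect c.
rewrite -(@integral_pushforward _ _ _ _ _ _ mr mu setT (EFin \o f))//.
- by apply: eq_measure_integral => A mA _; exact: lebesgue_measure_reflect.
- exact: measurable_int If.
- exact: integrable_reflect.
Qed.

Lemma Rintegral_odd f : mu.-integrable setT (EFin \o f) ->
  (forall x, f (- x) = - f x) -> \int[mu]_x f x = 0.
Proof.
move=> If fN; have := Rintegral_reflect 0 If.
rewrite (eq_Rintegral mu (g := fun x => - f x)); last by move=> x _; rewrite sub0r fN.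
by rewrite RintegralN// => /eqP; rewrite -subr_eq0 -opprD oppr_eq0 -mulr2n mulrn_eq0/= => /eqP.
Qed.

(** The substitution [(x - y) / e] turns the Poisson kernel into the derivative
    of the arctangent. *)
Lemma integral_poisson e y : 0 < e ->
  (\int[mu]_x (e / (e ^+ 2 + (x - y) ^+ 2))%:E = pi%:E)%E.
Proof.
move=> e0; have := @increasing_ge0_integration_by_substitutionT R
  (fun x => (x - y) / e) (fun x => (oneDsqr x)^-1).
have dF : forall x, is_derive x 1 (fun x => (x - y) / e) e^-1.
  move=> x; apply: is_derive_eq; by rewrite /= subr0 !scaler1 ?mulr1 ?scaler0 ?add0r ?addr0.
have FE : (fun x => (x - y) / e)^`()%classic = cst e^-1.
  by apply/funext => x; rewrite derive1E; exact: derive_val.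
rewrite !FE => H; transitivity (\int[mu]_x ((oneDsqr x)^-1)%:E)%E; last first.
  rewrite (@ge0_symfun_integralT R (fun x => (oneDsqr x)^-1)).
  - by rewrite -set_itvcy integral0y_oneDsqr -EFinM mulrC divfK.
  - by move=> x; rewrite invr_ge0 (le_trans ler01)// oneDsqr_ge1.
  - exact: continuous_oneDsqrV.
  - by move=> x /=; rewrite /oneDsqr sqrrN.
rewrite H.
- apply: eq_integral => x _ /=; congr EFin; rewrite /oneDsqr fctE.
  have ? : e ^+ 2 + (x - y) ^+ 2 != 0 by rewrite gt_eqF// ltr_wpDr ?sqr_ge0// exprn_gt0.
  have ? : 1 + ((x - y) / e) ^+ 2 != 0 by rewrite gt_eqF// ltr_wpDr ?sqr_ge0.
  by rewrite /= /cst; field; rewrite gt_eqF//.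
- by move=> a b ab; rewrite ltr_pM2r ?invr_gt0// ltrD2r.
- exact: cst_continuous.
- exact: is_cvg_cst.
- exact: is_cvg_cst.
- by move=> x; exact: ex_derive.
- apply/cvgrNyPle => A; near=> x; rewrite ler_pdivrMr// lerBlDr.
  by near: x; apply: nbhs_ninfty_le; exact: num_real.
- apply/cvgryPge => A; near=> x; rewrite ler_pdivlMr// lerBrDr.
  by near: x; apply: nbhs_pinfty_ge; exact: num_real.
- exact: continuous_oneDsqrV.
- by move=> x; rewrite invr_ge0 (le_trans ler01)// oneDsqr_ge1.
Unshelve. all: by end_near. Qed.

Lemma integrable_poisson e y : 0 < e ->
  mu.-integrable setT (EFin \o (fun x => e / (e ^+ 2 + (x - y) ^+ 2))).
Proof.
move=> e0; have ge0 x : 0 <= e / (e ^+ 2 + (x - y) ^+ 2).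
  by apply: divr_ge0; [exact: ltW|rewrite addr_ge0 ?sqr_ge0].
apply: integrableR_ltoo => //; last by rewrite integral_poisson// ltry.
apply: continuous_line_measurable => x; apply: cvgM; first exact: cvg_cst.
apply: cvgV; first by rewrite gt_eqF// ltr_wpDr ?sqr_ge0// exprn_gt0.
apply: cvgD; first exact: cvg_cst.
by rewrite expr2; apply: cvgM; apply: cvgB => //; exact: cvg_cst.
Qed.

Lemma Rintegral_poisson e y : 0 < e ->
  \int[mu]_x (e / (e ^+ 2 + (x - y) ^+ 2)) = pi.
Proof. by move=> e0; rewrite /Rintegral integral_poisson. Qed.

Lemma integrable_inv1sqr : mu.-integrable setT (EFin \o (fun x : R => (1 + x ^+ 2)^-1)).
Proof.
have := @integrable_poisson 1 0 ltr01; apply: eq_integrable => // x _ /=.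
by rewrite subr0 expr1n mul1r.
Qed.

Lemma integrable_inv1sqr_dilate c : 0 < c ->
  mu.-integrable setT (EFin \o (fun x => (1 + (x * c) ^+ 2)^-1)).
Proof.
move=> c0; have ci : 0 < c^-1 by rewrite invr_gt0.
have := @integrableRZ _ _ _ _ _ _ (c^-1) measurableT (@integrable_poisson c^-1 0 ci).
apply: eq_integrable => // x _ /=; congr EFin; rewrite subr0.
have -> : 1 + (x * c) ^+ 2 = c ^+ 2 * (c^-1 ^+ 2 + x ^+ 2) by field; rewrite gt_eqF.
by rewrite invfM mulrA exprVn -exprVn.
Qed.

Lemma Rintegral_inv1sqr_dilate c : 0 < c ->
  \int[mu]_x ((1 + (x * c) ^+ 2)^-1) = pi / c.
Proof.
move=> c0; have ci : 0 < c^-1 by rewrite invr_gt0.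
rewrite mulrC -(Rintegral_poisson 0 ci) -RintegralZl//; last exact: integrable_poisson.
apply: eq_Rintegral => x _ /=; rewrite subr0.
have -> : 1 + (x * c) ^+ 2 = c ^+ 2 * (c^-1 ^+ 2 + x ^+ 2) by field; rewrite gt_eqF.
by rewrite invfM mulrA exprVn -exprVn.
Qed.

(** Abel weights: the Fourier transform of [exp (- e `|x|)] is a Poisson
    kernel. The cosine integral is read off the nonnegative even function
    [exp (- e `|x|) * (1 + cos (x * z))], which has an explicit primitive. *)
Lemma integral_abel_1Dcos e z : 0 < e ->
  (\int[mu]_x (expR (- (e * `|x|)) * (1 + cos (x * z)))%:E =
   (2 / e + 2 * (e / (e ^+ 2 + z ^+ 2)))%:E)%E.
Proof.
move=> e0; have cE : continuous (fun x : R => expR (- (e * `|x|))).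
  move=> x; apply: continuous_comp; last exact: continuous_expR.
  by apply: cvgN; apply: cvgM; [exact: cvg_cst|apply: cvg_norm].
have cC : continuous (fun x : R => 1 + cos (x * z)).
  move=> x; apply: cvgD; first exact: cvg_cst.
  exact: continuous_cosM.
have ge0 x : 0 <= expR (- (e * `|x|)) * (1 + cos (x * z)).
  by rewrite mulr_ge0 ?expR_ge0// -lerBlDl sub0r cos_geN1.
have cf : continuous (fun x : R => expR (- (e * `|x|)) * (1 + cos (x * z))).
  by move=> x; apply: cvgM; [exact: cE|exact: cC].
rewrite ge0_symfun_integralT//; last first.
  by move=> x /=; rewrite normrN mulNr cosN.
have D0 : e ^+ 2 + z ^+ 2 != 0 by rewrite gt_eqF// ltr_wpDr ?sqr_ge0// exprn_gt0.
pose F x : R := expR (- (e * x)) * (- e^-1 + (z * sin (x * z) - e * cos (x * z)) / (e ^+ 2 + z ^+ 2)).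
have dF x : is_derive x 1 F (expR (- (e * x)) * (1 + cos (x * z))).
  rewrite /F; apply: is_derive_eq.
  rewrite /GRing.scale/=.
  by field; rewrite D0 gt_eqF.
rewrite -set_itvcy (@ge0_continuous_FTC2y R _ F 0 0) => //.
- rewrite /F mulr0 oppr0 expR0 mul0r sin0 cos0 -EFinN -EFinD -EFinM; congr EFin.
  by field; rewrite D0 gt_eqF.
- exact: continuous_subspaceT.
- apply/norm_cvg0P.
  have Fb x : `|F x| <= expR (- (e * x)) * (e^-1 + (`|z| + e) / (e ^+ 2 + z ^+ 2)).
    rewrite /F normrM ger0_norm ?expR_ge0// ler_wpM2l ?expR_ge0//.
    rewrite (le_trans (ler_normD _ _))// normrN normfV gtr0_norm// lerD2l.
    rewrite normrM normfV (gtr0_norm (x := e ^+ 2 + _)); last by rewrite ltr_wpDr ?sqr_ge0// exprn_gt0.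
    rewrite ler_wpM2r ?invr_ge0 ?addr_ge0 ?sqr_ge0//.
    rewrite (le_trans (ler_normB _ _))// !normrM (gtr0_norm e0).
    by rewrite lerD// ?ler_piMr// ?sin_max ?cos_max// ltW.
  have : \forall x \near +oo, 0 <= `|F x| <= expR (- (e * x)) * (e^-1 + (`|z| + e) / (e ^+ 2 + z ^+ 2)).
    by apply: nearW => x; rewrite normr_ge0 Fb.
  move/squeeze_cvgr; apply; first exact: cvg_cst.
  + rewrite -[X in _ --> X](mul0r (e^-1 + (`|z| + e) / (e ^+ 2 + z ^+ 2))).
    apply: cvgM; last exact: cvg_cst.
    apply: (cvg_comp (fun x => e * x) (fun x => expR (- x))); last exact: cvgr_expR.
    exact: gt0_cvgMry.
- apply: cvg_at_right_filter; apply: differentiable_continuous.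
  by apply/derivable1_diffP; exact: ex_derive.
- move=> x; rewrite in_itv/= andbT => x0.
  by rewrite derive1E derive_val gtr0_norm.
Qed.

Lemma continuous_abel e : continuous (fun x : R => expR (- (e * `|x|))).
Proof.
move=> x; apply: (@continuous_comp _ _ _ (fun x => - (e * `|x|)) expR);
  last exact: continuous_expR.
by apply: cvgN; apply: cvgM; [exact: cvg_cst|apply: cvg_norm].
Qed.

Lemma integrable_abel e : 0 < e ->
  mu.-integrable setT (EFin \o (fun x => expR (- (e * `|x|)))).
Proof.
move=> e0; apply: integrableR_ltoo => //.
- by apply: continuous_line_measurable; exact: continuous_abel.
- apply: (@le_lt_trans _ _ (\int[mu]_x (expR (- (e * `|x|)) * (1 + cos (x * 0)))%:E)%E).
    apply: ge0_le_integral => //.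
    + by apply/measurable_EFinP; apply: continuous_line_measurable; exact: continuous_abel.
    + apply/measurable_EFinP/measurable_funM.
        by apply: continuous_line_measurable; exact: continuous_abel.
      apply: measurable_funD => //.
      by apply: continuous_line_measurable; exact: continuous_cosM.
    + by move=> x _; rewrite lee_fin mulr0 cos0 ler_peMr ?expR_ge0// lerDl.
  by rewrite integral_abel_1Dcos// ltry.
Qed.

Lemma integrable_abel_cos e z : 0 < e ->
  mu.-integrable setT (EFin \o (fun x => expR (- (e * `|x|)) * cos (x * z))).
Proof.
move=> e0; apply: (integrableR_le measurableT _ _ (integrable_abel e0)).
  apply: measurable_funM; first by apply: continuous_line_measurable; exact: continuous_abel.
  by apply: continuous_line_measurable; exact: continuous_cosM.
by move=> x _; rewrite normrM ger0_norm ?expR_ge0// ler_piMr ?expR_ge0// cos_max.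
Qed.

Lemma integrable_abel_sin e z : 0 < e ->
  mu.-integrable setT (EFin \o (fun x => expR (- (e * `|x|)) * sin (x * z))).
Proof.
move=> e0; apply: (integrableR_le measurableT _ _ (integrable_abel e0)).
  apply: measurable_funM; first by apply: continuous_line_measurable; exact: continuous_abel.
  by apply: continuous_line_measurable; exact: continuous_sinM.
by move=> x _; rewrite normrM ger0_norm ?expR_ge0// ler_piMr ?expR_ge0// sin_max.
Qed.

Lemma Rintegral_abel_cos e z : 0 < e ->
  \int[mu]_x (expR (- (e * `|x|)) * cos (x * z)) = 2 * (e / (e ^+ 2 + z ^+ 2)).
Proof.
move=> e0.
have E w : \int[mu]_x (expR (- (e * `|x|)) * (1 + cos (x * w))) =
    2 / e + 2 * (e / (e ^+ 2 + w ^+ 2)) by rewrite /Rintegral integral_abel_1Dcos.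
have S w : \int[mu]_x (expR (- (e * `|x|)) * (1 + cos (x * w))) =
    \int[mu]_x expR (- (e * `|x|)) + \int[mu]_x (expR (- (e * `|x|)) * cos (x * w)).
  rewrite -RintegralD//; [|exact: integrable_abel|exact: integrable_abel_cos].
  by apply: eq_Rintegral => x _; rewrite mulrDr mulr1.
have S0 : \int[mu]_x (expR (- (e * `|x|)) * cos (x * 0)) = \int[mu]_x expR (- (e * `|x|)).
  by apply: eq_Rintegral => x _; rewrite mulr0 cos0 mulr1.
have : \int[mu]_x expR (- (e * `|x|)) = 2 / e.
  have := S 0; rewrite E S0 -mulr2n -mulr_natr expr0n/= addr0.
  have -> : e / e ^+ 2 = e^-1 by field; rewrite gt_eqF.
  lra.
by move=> I0; have := S z; rewrite E I0 => /addrI ->.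
Qed.

Lemma Rintegral_abel_sin e z : 0 < e ->
  \int[mu]_x (expR (- (e * `|x|)) * sin (x * z)) = 0.
Proof.
move=> e0; apply: Rintegral_odd; first exact: integrable_abel_sin.
by move=> x; rewrite normrN mulNr sinN mulrN.
Qed.

(** The Poisson kernels concentrate at their centre: off a neighbourhood of
    [y] the kernel is [O(e)] times an integrable weight. *)
Lemma poisson_approximation g y (e_ : nat -> R) :
  mu.-integrable setT (EFin \o g) -> {for y, continuous g} ->
  (forall n, 0 < e_ n) -> e_ n @[n --> \oo] --> 0 ->
  \int[mu]_x (g x * (e_ n / (e_ n ^+ 2 + (x - y) ^+ 2))) @[n --> \oo] --> pi * g y.
Proof.
move=> Ig cg e0 ecv; have mg := integrableR_measurable Ig.
pose P n x := e_ n / (e_ n ^+ 2 + (x - y) ^+ 2).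
have P0 n x : 0 <= P n x.
  by rewrite /P; apply: divr_ge0; [exact: ltW|rewrite addr_ge0 ?sqr_ge0].
have IP n : mu.-integrable setT (EFin \o P n) by exact: integrable_poisson.
have mP n : measurable_fun setT (P n) := integrableR_measurable (IP n).
have Pb n x : P n x <= (e_ n)^-1.
  rewrite /P ler_pdivrMr ?ltr_wpDr ?sqr_ge0 ?exprn_gt0//.
  rewrite expr2 mulrDr mulrA mulVf ?gt_eqF// mul1r lerDl.
  by rewrite mulr_ge0 ?sqr_ge0 ?invr_ge0// ltW.
have IgP n : mu.-integrable setT (EFin \o (fun x => g x * P n x)).
  have Ih := integrableRZ (e_ n)^-1 measurableT (integrableR_norm measurableT Ig).
  apply: (integrableR_le measurableT _ _ Ih).
    by apply: measurable_funM; [exact: mg|exact: mP].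
  by move=> x _; rewrite normrM (ger0_norm (P0 n x)) mulrC ler_wpM2r.
have dif n : \int[mu]_x (g x * P n x) - pi * g y = \int[mu]_x ((g x - g y) * P n x).
  rewrite -(Rintegral_poisson y (e0 n)) mulrC -RintegralZl; [|by []|exact: IP].
  rewrite -RintegralB; [|by []|exact: IgP|exact: (integrableRZ (g y) measurableT (IP n))].
  by apply: eq_Rintegral => x _; rewrite mulrBl.
apply/cvgrPdist_le => d d0.
have d2 : 0 < d / (2 * pi) by rewrite divr_gt0// mulr_gt0// pi_gt0.
move/cvgrPdist_le : cg => /(_ _ d2) /nbhs_ballP[r /= r0 gr].
(* off the ball of radius r the kernel is at most e (1 + r^-2) / (1 + (x-y)^2) *)
pose C := 1 + r ^- 2; pose q x := (1 + (x - y) ^+ 2)^-1.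
have C0 : 0 <= C by rewrite addr_ge0// invr_ge0 exprn_ge0// ltW.
have Iq : mu.-integrable setT (EFin \o q).
  have := @integrable_poisson 1 y ltr01; apply: eq_integrable => // x _ /=.
  by rewrite expr1n mul1r.
have q01 x : 0 <= q x <= 1.
  rewrite /q invr_ge0 addr_ge0 ?sqr_ge0//= invf_le1 ?lerDl ?sqr_ge0//.
  by rewrite ltr_wpDr ?sqr_ge0.
have q0 x : 0 <= q x by case/andP: (q01 x).
have w0 x : 0 <= `|g x| + `|g y| * q x by rewrite addr_ge0// mulr_ge0.
have eC0 n : 0 <= e_ n * C by rewrite mulr_ge0// ltW.
pose B := \int[mu]_x (`|g x| + `|g y| * q x).
have IB : mu.-integrable setT (EFin \o (fun x => `|g x| + `|g y| * q x)).
  by apply: integrableRD => //; [exact: integrableR_norm|exact: integrableRZ].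
have B0 : 0 <= B.
  exact: Rintegral_ge0.
have ecv' : (e_ n * C) * B @[n --> \oo] --> 0.
  have -> : (0 : R) = 0 * C * B by rewrite !mul0r.
  by apply: cvgM; [apply: cvgM => //|]; exact: cvg_cst.
have d3 : 0 < d / 2 by rewrite divr_gt0.
move/cvgrPdist_le : ecv' => /(_ _ d3); apply: filterS => n.
rewrite sub0r normrN ger0_norm; last by rewrite mulr_ge0.
move=> nB; rewrite distrC dif.
apply: (@le_trans _ _ (\int[mu]_x (d / (2 * pi) * P n x + e_ n * C * (`|g x| + `|g y| * q x)))).
  apply: norm_Rintegral_le => //.
  - apply: measurable_funM; last exact: mP.
    by apply: measurable_funB => //; exact: measurable_cst.
  - move=> x _; rewrite normrM (ger0_norm (P0 n x)).
    have [xr|xr] := ltP `|y - x| r.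
      rewrite -[leLHS]addr0 lerD//.
        by rewrite ler_wpM2r// distrC; apply: gr.
      by rewrite mulr_ge0.
    rewrite -[leLHS]add0r lerD//; first by rewrite mulr_ge0// ltW.
    have Pq : P n x <= e_ n * C * q x.
      have e0' := ltW (e0 n); rewrite /P /q /C -!mulrA ler_wpM2l//.
      have s0 : 0 < (x - y) ^+ 2.
        rewrite -real_normK ?num_real// exprn_gt0// distrC; exact: lt_le_trans xr.
      rewrite ler_pdivlMr ?ltr_wpDr ?sqr_ge0// mulrC ler_pdivrMr; last first.
        by rewrite ltr_wpDl// sqr_ge0.
      have sr : r ^+ 2 <= (x - y) ^+ 2.
        rewrite -[(x - y) ^+ 2]real_normK ?num_real// distrC.
        by rewrite lerXn2r// ?nnegrE// ltW.
      have h1 : 1 <= r ^- 2 * (x - y) ^+ 2.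
        by rewrite mulrC ler_pdivlMr ?mul1r// exprn_gt0.
      have h2 : 0 <= (1 + r ^- 2) * e_ n ^+ 2 by rewrite mulr_ge0// sqr_ge0.
      rewrite mulrDr; nra.
    apply: (le_trans (ler_wpM2l _ Pq)) => //.
    rewrite mulrCA ler_wpM2l//.
    case/andP: (q01 x) => qx0 qx1.
    apply: (@le_trans _ _ ((`|g x| + `|g y|) * q x)); first by rewrite ler_wpM2r// ler_normB.
    by rewrite mulrDl lerD2r ler_piMr.
  - by apply: integrableRD => //; exact: integrableRZ.
rewrite RintegralD//; [|exact: integrableRZ|exact: integrableRZ].
rewrite (@RintegralZl _ _ _ mu setT (P n) _ measurableT (IP n)).
rewrite (RintegralZl _ measurableT IB).
rewrite (_ : \int[mu]_x P n x = pi); last exact: Rintegral_poisson.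
have cancel_pi (p : R) : p != 0 -> d / (2 * p) * p = d / 2 by move=> ?; field.
rewrite cancel_pi ?gt_eqF ?pi_gt0//.
by rewrite [leRHS]splitr lerD2l.
Qed.

End Line.

(** * Measurability of functions of Caratheodory type *)

(** Rounding the first variable down to a multiple of [1 / n.+1] gives measurable
    functions, which converge to [F] by continuity in that variable. *)
Lemma caratheodory_measurable d (R : realType) (T : measurableType d) (F : R -> T -> R) :
  (forall y, continuous (F ^~ y)) -> (forall x, measurable_fun setT (F x)) ->
  measurable_fun setT (fun z : R * T => F z.1 z.2).
Proof.
move=> cF mF.
pose r n (x : R) : R := (Num.floor (x * n.+1%:R))%:~R / n.+1%:R.
have rx x : r n x @[n --> \oo] --> x.
  apply/cvgrPdist_le => e e0.
  have [N N1] : exists N : nat, e^-1 <= N%:R.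
    by exists (Num.truncn e^-1).+1; rewrite ltW// truncnS_gt.
  exists N => // n /= Nn; rewrite /r.
  have n0 : 0 < n.+1%:R :> R by rewrite ltr0n.
  have -> : x - (Num.floor (x * n.+1%:R))%:~R / n.+1%:R =
      (x * n.+1%:R - (Num.floor (x * n.+1%:R))%:~R) / n.+1%:R.
    by field; rewrite nat1r gt_eqF.
  have := floor_le_tmp (x * n.+1%:R); have := floorD1_gt (x * n.+1%:R) => h1 h2.
  rewrite ger0_norm; last by rewrite divr_ge0 ?subr_ge0// ltW.
  rewrite ler_pdivrMr// (@le_trans _ _ 1)//.
    by rewrite lerBlDr ltW// addrC; move: h1; rewrite intrD.
  rewrite mulrC -ler_pdivrMr// mul1r (le_trans N1)// ler_nat.
  exact: leq_trans Nn _.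
apply: (@measurable_fun_cvg _ _ _ _ (fun n (z : R * T) => F (r n z.1) z.2)); last first.
  move=> [x y] _ /=; exact: (cvg_comp (r ^~ x) (F ^~ y) (rx x) (cF y x)).
move=> n _ B mB; rewrite setTI.
have -> : (fun z : R * T => F (r n z.1) z.2) @^-1` B =
  \bigcup_(k : int) ([set x : R | Num.floor (x * n.+1%:R) = k] `*`
     (F (k%:~R / n.+1%:R) @^-1` B)).
  apply/seteqP; split => [[x y] /= Bx|[x y] [k _ [/= <-]]//].
  by exists (Num.floor (x * n.+1%:R)).
apply: countable_bigcupT_measurable => [|k]; first exact: countableP.
apply: measurableX; last first.
  by rewrite -[X in measurable X]setTI; exact: mF.
rewrite (_ : [set x | _] = `[k%:~R / n.+1%:R, (k + 1)%:~R / n.+1%:R[%classic)//.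
apply/seteqP; split => x /=; rewrite in_itv/= ler_pdivrMr ?ltr0n// ltr_pdivlMr ?ltr0n//.
- by move=> <-; rewrite floor_le_tmp floorD1_gt.
- by move=> h; apply: floor_def.
Qed.

(** * Complex numbers and complex-valued integrals *)

Section ComplexNumbers.
Context (R : realType).
Implicit Types z w : R[i].

Lemma complex_ext z w : cRe z = cRe w -> cIm z = cIm w -> z = w.
Proof. by case: z w => a b [c d] /= -> ->. Qed.

Lemma cReD z w : cRe (z + w) = cRe z + cRe w. Proof. by case: z w => a b []. Qed.
Lemma cImD z w : cIm (z + w) = cIm z + cIm w. Proof. by case: z w => a b []. Qed.
Lemma cReN z : cRe (- z) = - cRe z. Proof. by case: z. Qed.
Lemma cImN z : cIm (- z) = - cIm z. Proof. by case: z. Qed.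
Lemma cReB z w : cRe (z - w) = cRe z - cRe w. Proof. by rewrite cReD cReN. Qed.
Lemma cImB z w : cIm (z - w) = cIm z - cIm w. Proof. by rewrite cImD cImN. Qed.
Lemma cReM z w : cRe (z * w) = cRe z * cRe w - cIm z * cIm w.
Proof. by case: z w => a b []. Qed.
Lemma cImM z w : cIm (z * w) = cRe z * cIm w + cIm z * cRe w.
Proof. by case: z w => a b []. Qed.

Lemma normc_sqr z : normc z ^+ 2 = cRe z ^+ 2 + cIm z ^+ 2.
Proof. by case: z => a b /=; rewrite sqr_sqrtr// addr_ge0 ?sqr_ge0. Qed.

Lemma normc_ge0 z : 0 <= normc z.
Proof. by case: z => a b; exact: sqrtr_ge0. Qed.

Lemma normc_geRe z : `|cRe z| <= normc z.
Proof.
by case: z => a b /=; rewrite -sqrtr_sqr ler_wsqrtr// lerDl sqr_ge0.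
Qed.

Lemma normc_geIm z : `|cIm z| <= normc z.
Proof.
by case: z => a b /=; rewrite -sqrtr_sqr ler_wsqrtr// lerDr sqr_ge0.
Qed.

Lemma normc_le_ReIm z : normc z <= `|cRe z| + `|cIm z|.
Proof.
rewrite -(@ler_pXn2r _ 2) ?nnegrE ?normc_ge0 ?addr_ge0// normc_sqr sqrrD.
by rewrite !real_normK ?num_real// addrAC lerDl mulrn_wge0// mulr_ge0.
Qed.

Lemma normc_le2 z (h : R) : `|cRe z| <= h -> `|cIm z| <= h -> normc z <= 2 * h.
Proof. by move=> a b; apply: (le_trans (normc_le_ReIm z)); lra. Qed.

Lemma normcD z w : normc (z + w) <= normc z + normc w.
Proof. by have := ler_normD z w; rewrite lecE/= => /andP[]. Qed.

Lemma normcN z : normc (- z) = normc z.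
Proof. by case: z => a b /=; rewrite !sqrrN. Qed.

Lemma normcB z w : normc (z - w) <= normc z + normc w.
Proof. by rewrite (le_trans (normcD _ _))// normcN. Qed.

Lemma normcM z w : normc (z * w) = normc z * normc w.
Proof. exact: ComplexField.Normc.normcM. Qed.

Lemma normc_real (a : R) : normc a%:C = `|a|.
Proof. by rewrite /= expr0n/= addr0 sqrtr_sqr. Qed.

Lemma normc_imag (a : R) : normc (0 +i* a) = `|a|.
Proof. by rewrite /= expr0n/= add0r sqrtr_sqr. Qed.

Lemma normc_cexp z : normc (cexp z) = expR (cRe z).
Proof.
case: z => a b; rewrite /cexp /= !exprMn -mulrDr cos2Dsin2 mulr1 sqrtr_sqr.
by rewrite ger0_norm// expR_ge0.
Qed.

Lemma cexpD z w : cexp (z + w) = cexp z * cexp w.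
Proof.
case: z w => a b [c d]; apply: complex_ext; rewrite ?cReM ?cImM /= expRD.
  by rewrite cosD; ring.
by rewrite sinD; ring.
Qed.

Definition expi (t : R) : R[i] := cexp (0 +i* t).

Lemma expiD (s t : R) : expi (s + t) = expi s * expi t.
Proof. by rewrite /expi -cexpD; congr cexp; apply: complex_ext; rewrite /= ?addr0. Qed.

Lemma normc_expi (t : R) : normc (expi t) = 1.
Proof. by rewrite normc_cexp expR0. Qed.

End ComplexNumbers.

Section ComplexMeasurable.
Context d (T : measurableType d) (R : realType).
Implicit Types (D : set T) (f g : T -> R[i]).

Definition cmeasurable D g :=
  measurable_fun D (fun x => cRe (g x)) /\ measurable_fun D (fun x => cIm (g x)).

Lemma cmeasurableM D f g : cmeasurable D f -> cmeasurable D g ->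
  cmeasurable D (fun x => f x * g x).
Proof.
move=> [f1 f2] [g1 g2]; split.
  under eq_fun do rewrite cReM.
  by apply: measurable_funB; apply: measurable_funM.
under eq_fun do rewrite cImM.
by apply: measurable_funD; apply: measurable_funM.
Qed.

Lemma cmeasurableB D f g : cmeasurable D f -> cmeasurable D g ->
  cmeasurable D (fun x => f x - g x).
Proof.
move=> [f1 f2] [g1 g2]; split.
  by under eq_fun do rewrite cReB; apply: measurable_funB.
by under eq_fun do rewrite cImB; apply: measurable_funB.
Qed.

Lemma cmeasurable_cst D (c : R[i]) : cmeasurable D (fun=> c).
Proof. by split; exact: measurable_cst. Qed.

Lemma cmeasurable_mk D (f g : T -> R) : measurable_fun D f -> measurable_fun D g ->
  cmeasurable D (fun x => f x +i* g x).
Proof. by []. Qed.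

Lemma cmeasurable_cexp D f : cmeasurable D f -> cmeasurable D (fun x => cexp (f x)).
Proof.
move=> [f1 f2]; split; apply: measurable_funM => /=.
- exact: measurableT_comp (@measurable_expR R) f1.
- exact: measurableT_comp (continuous_measurable_fun (@continuous_cos R)) f2.
- exact: measurableT_comp (@measurable_expR R) f1.
- exact: measurableT_comp (continuous_measurable_fun (@continuous_sin R)) f2.
Qed.

Lemma cmeasurable_expi D (f : T -> R) : measurable_fun D f ->
  cmeasurable D (fun x => expi (f x)).
Proof. by move=> mf; apply: cmeasurable_cexp; apply: cmeasurable_mk. Qed.

Lemma measurable_normc D f : cmeasurable D f -> measurable_fun D (fun x => normc (f x)).
Proof.
move=> [f1 f2].
have -> : (fun x => normc (f x)) = (fun x => (cRe (f x) ^+ 2 + cIm (f x) ^+ 2) `^ 2^-1).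
  by apply/funext => x; case: (f x) => a b /=; rewrite powR12_sqrt// addr_ge0 ?sqr_ge0.
apply: (@measurableT_comp _ _ _ _ _ _ (fun x => x `^ 2^-1)%R); first exact: measurable_powR.
by apply: measurable_funD; apply: measurable_funX.
Qed.

End ComplexMeasurable.

Section ComplexIntegrable.
Context d (T : measurableType d) (R : realType) (m : {measure set T -> \bar R}).
Implicit Types (D : set T) (f g : T -> R[i]).

Definition cintegrable D g := m.-integrable D (EFin \o (fun x => cRe (g x))) /\
  m.-integrable D (EFin \o (fun x => cIm (g x))).

Lemma cintegrable_le D g (h : T -> R) : measurable D -> cmeasurable D g ->
  (forall x, D x -> normc (g x) <= h x) -> m.-integrable D (EFin \o h) ->
  cintegrable D g.
Proof.
move=> mD [g1 g2] gh Ih; split; apply: integrableR_le Ih => // x Dx.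
- exact: le_trans (normc_geRe _) (gh _ Dx).
- exact: le_trans (normc_geIm _) (gh _ Dx).
Qed.

Lemma cintegrable_measurable D g : cintegrable D g -> cmeasurable D g.
Proof. by move=> [/integrableR_measurable ? /integrableR_measurable]. Qed.

Lemma cintegrable_norm D g : measurable D -> cintegrable D g ->
  m.-integrable D (EFin \o (fun x => normc (g x))).
Proof.
move=> mD Ig; have mg := cintegrable_measurable Ig; case: Ig => Ig1 Ig2.
apply: (@integrableR_le _ _ _ _ _ _ (fun x => `|cRe (g x)| + `|cIm (g x)|)) => //.
- exact: measurable_normc.
- by move=> x _; rewrite ger0_norm ?normc_ge0// normc_le_ReIm.
- by apply: integrableRD => //; exact: integrableR_norm.
Qed.

Lemma cintegrableB D f g : measurable D -> cintegrable D f -> cintegrable D g ->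
  cintegrable D (fun x => f x - g x).
Proof.
move=> mD [f1 f2] [g1 g2]; split.
  by under eq_fun do rewrite cReB; apply: integrableRB.
by under eq_fun do rewrite cImB; apply: integrableRB.
Qed.

Lemma cintegrableM_bounded D f g (C : R) : measurable D -> cmeasurable D f ->
  (forall x, D x -> normc (f x) <= C) -> cintegrable D g ->
  cintegrable D (fun x => f x * g x).
Proof.
move=> mD mf fC Ig; have mg := cintegrable_measurable Ig.
apply: (@cintegrable_le _ _ (fun x => C * normc (g x))) => //.
- exact: cmeasurableM.
- by move=> x Dx; rewrite normcM ler_wpM2r ?normc_ge0// fC.
- by apply: integrableRZ => //; exact: cintegrable_norm.
Qed.

End ComplexIntegrable.

Lemma ae_imp d (T : measurableType d) (R : realType) (m : {measure set T -> \bar R})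
    (P Q : T -> Prop) :
  (forall x, P x -> Q x) -> {ae m, forall x, P x} -> {ae m, forall x, Q x}.
Proof. by move=> PQ; apply: filterS. Qed.

Section ComplexIntegral.
Context (R : realType).
Local Notation mu := (@lebesgue_measure R).
Implicit Types (D : set R) (f g : R -> R[i]).

Lemma eq_cintegral D f g : {in D, f =1 g} -> cintegral D f = cintegral D g.
Proof.
move=> fg; rewrite /cintegral; congr (_ +i* _).
  by apply: eq_Rintegral => x /fg ->.
by apply: eq_Rintegral => x /fg ->.
Qed.

Lemma cintegral0 D : cintegral D (fun=> 0) = 0 :> R[i].
Proof.
by apply: complex_ext; rewrite /= /Rintegral integral0_eq.
Qed.

Lemma cintegralD D f g : measurable D -> cintegrable mu D f -> cintegrable mu D g ->
  cintegral D (fun x => f x + g x) = cintegral D f + cintegral D g.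
Proof.
move=> mD [f1 f2] [g1 g2]; apply: complex_ext; rewrite ?cReD ?cImD /=.
  by rewrite -RintegralD//; apply: eq_Rintegral => x _; rewrite cReD.
by rewrite -RintegralD//; apply: eq_Rintegral => x _; rewrite cImD.
Qed.

Lemma cintegralB D f g : measurable D -> cintegrable mu D f -> cintegrable mu D g ->
  cintegral D (fun x => f x - g x) = cintegral D f - cintegral D g.
Proof.
move=> mD [f1 f2] [g1 g2]; apply: complex_ext; rewrite ?cReB ?cImB /=.
  by rewrite -RintegralB//; apply: eq_Rintegral => x _; rewrite cReB.
by rewrite -RintegralB//; apply: eq_Rintegral => x _; rewrite cImB.
Qed.

Lemma cintegralZ D (c : R[i]) g : measurable D -> cintegrable mu D g ->
  cintegral D (fun x => c * g x) = c * cintegral D g.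
Proof.
move=> mD [g1 g2]; apply: complex_ext; rewrite ?cReM ?cImM /=.
  rewrite -!RintegralZl// -RintegralB//; [|exact: integrableRZ|exact: integrableRZ].
  by apply: eq_Rintegral => x _; rewrite cReM.
rewrite -!RintegralZl// -RintegralD//; [|exact: integrableRZ|exact: integrableRZ].
by apply: eq_Rintegral => x _; rewrite cImM.
Qed.

Lemma normc_cintegral_le D g (h : R -> R) : measurable D -> cmeasurable D g ->
  (forall x, D x -> normc (g x) <= h x) -> mu.-integrable D (EFin \o h) ->
  normc (cintegral D g) <= 2 * \int[mu]_(x in D) h x.
Proof.
move=> mD [g1 g2] gh Ih; apply: normc_le2 => /=; apply: norm_Rintegral_le => // x Dx.
- exact: le_trans (normc_geRe _) (gh _ Dx).
- exact: le_trans (normc_geIm _) (gh _ Dx).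
Qed.

Lemma ae_eq_cintegral D f g : measurable D -> cmeasurable D f -> cmeasurable D g ->
  {ae mu, forall x, D x -> f x = g x} -> cintegral D f = cintegral D g.
Proof.
move=> mD [f1 f2] [g1 g2] fg; apply: complex_ext => /=; apply: ae_eq_Rintegral => //.
  by apply: ae_imp fg => x h /h ->.
by apply: ae_imp fg => x h /h ->.
Qed.

Lemma cintegral_Fubini (G : R * R -> R[i]) :
  cintegrable (mu \x mu)%E setT G ->
  cintegral setT (fun x => cintegral setT (fun y => G (x, y))) =
  cintegral setT (fun y => cintegral setT (fun x => G (x, y))).
Proof.
move=> [G1 G2]; apply: complex_ext => /=.
  exact: (@Rintegral_Fubini _ _ _ _ R mu mu (fun z => cRe (G z)) G1).
exact: (@Rintegral_Fubini _ _ _ _ R mu mu (fun z => cIm (G z)) G2).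
Qed.

Lemma cintegrable_inner1 (G : R * R -> R[i]) :
  cintegrable (mu \x mu)%E setT G ->
  cintegrable mu setT (fun x => cintegral setT (fun y => G (x, y))).
Proof.
move=> [G1 G2]; split.
  exact: (@Rintegral_inner_integrable _ _ _ _ R mu mu (fun z => cRe (G z)) G1).
exact: (@Rintegral_inner_integrable _ _ _ _ R mu mu (fun z => cIm (G z)) G2).
Qed.

Lemma cintegrable_prod_bound (G : R * R -> R[i]) (f g : R -> R) :
  cmeasurable setT G -> (forall x y, normc (G (x, y)) <= f x * g y) ->
  mu.-integrable setT (EFin \o f) -> mu.-integrable setT (EFin \o g) ->
  cintegrable (mu \x mu)%E setT G.
Proof.
move=> [G1 G2] Gb If Ig; split; apply: (integrable_prod_bound _ _ If Ig) => // x y.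
  exact: le_trans (normc_geRe _) (Gb _ _).
exact: le_trans (normc_geIm _) (Gb _ _).
Qed.

Lemma cintegral_mkcond D g :
  cintegral D g = cintegral setT (fun x => if x \in D then g x else 0).
Proof.
rewrite /cintegral; congr (_ +i* _); rewrite Rintegral_mkcond;
  by apply: eq_Rintegral => x _; rewrite patchE; case: ifP.
Qed.

Lemma cintegrable_mkcond D g : measurable D ->
  cintegrable mu D g <-> cintegrable mu setT (fun x => if x \in D then g x else 0).
Proof.
move=> mD; rewrite /cintegrable; split => -[g1 g2]; split.
- have := (@integrable_mkcond _ _ _ mu _ _ mD).1 g1; apply: eq_integrable => // x _ /=.
  by rewrite patchE; case: ifP.
- have := (@integrable_mkcond _ _ _ mu _ _ mD).1 g2; apply: eq_integrable => // x _ /=.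
  by rewrite patchE; case: ifP.
- apply/(@integrable_mkcond _ _ _ mu _ _ mD); move: g1; apply: eq_integrable => // x _ /=.
  by rewrite patchE; case: ifP.
- apply/(@integrable_mkcond _ _ _ mu _ _ mD); move: g2; apply: eq_integrable => // x _ /=.
  by rewrite patchE; case: ifP.
Qed.

Lemma cintegrable_reflect g c : cintegrable mu setT g ->
  cintegrable mu setT (fun x => g (c - x)).
Proof. by move=> [g1 g2]; split; [exact: integrable_reflect g1|exact: integrable_reflect g2]. Qed.

Lemma cintegral_reflect g c : cintegrable mu setT g ->
  cintegral setT (fun x => g (c - x)) = cintegral setT g.
Proof.
move=> [g1 g2]; rewrite /cintegral; congr (_ +i* _).
  exact: (Rintegral_reflect c g1).
exact: (Rintegral_reflect c g2).
Qed.

Lemma cintegral_dominated D (G : nat -> R -> R[i]) g (h : R -> R) : measurable D ->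
  (forall n, cmeasurable D (G n)) ->
  (forall x, D x -> cRe (G n x) @[n --> \oo] --> cRe (g x)) ->
  (forall x, D x -> cIm (G n x) @[n --> \oo] --> cIm (g x)) ->
  mu.-integrable D (EFin \o h) ->
  (forall n x, D x -> normc (G n x) <= h x) ->
  cRe (cintegral D (G n)) @[n --> \oo] --> cRe (cintegral D g) /\
  cIm (cintegral D (G n)) @[n --> \oo] --> cIm (cintegral D g).
Proof.
move=> mD mG G1 G2 Ih Gh; rewrite /cintegral; split => /=.
- apply: (@Rintegral_dominated _ _ _ mu D (fun n x => cRe (G n x)) (fun x => cRe (g x)) h) => //.
    by move=> n; case: (mG n).
  by move=> n x Dx; exact: le_trans (normc_geRe _) (Gh _ _ Dx).
- apply: (@Rintegral_dominated _ _ _ mu D (fun n x => cIm (G n x)) (fun x => cIm (g x)) h) => //.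
    by move=> n; case: (mG n).
  by move=> n x Dx; exact: le_trans (normc_geIm _) (Gh _ _ Dx).
Qed.

End ComplexIntegral.

(** * Integrals depending on a parameter *)

Section ParameterIntegrals.
Context (R : realType).
Local Notation mu := (@lebesgue_measure R).

Lemma continuous_seqP (f : R -> R) (a : R) :
  (forall u : nat -> R, u n @[n --> \oo] --> a -> f (u n) @[n --> \oo] --> f a) ->
  {for a, continuous f}.
Proof. by move=> H; apply/(@cvg_nbhsP _ R^o) => u /H. Qed.

Lemma Rintegral_continuous (D : set R) (F : R -> R -> R) (h : R -> R) :
  measurable D -> (forall a, measurable_fun D (F a)) ->
  (forall x, D x -> continuous (F ^~ x)) ->
  mu.-integrable D (EFin \o h) ->
  (forall a x, D x -> `|F a x| <= h x) ->
  continuous (fun a => \int[mu]_(x in D) F a x).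
Proof.
move=> mD mF cF Ih Fh a; apply: continuous_seqP => u ua.
apply: (@Rintegral_dominated _ _ _ mu D (fun n => F (u n)) (F a) h) => //.
- by move=> n; exact: mF.
- by move=> x Dx; exact: (cvg_comp u (F ^~ x) ua (cF x Dx a)).
- by move=> n x; exact: Fh.
Qed.

Definition ccontinuous (g : R -> R[i]) :=
  continuous (fun x => cRe (g x)) /\ continuous (fun x => cIm (g x)).

Lemma cintegral_continuous (D : set R) (F : R -> R -> R[i]) (h : R -> R) :
  measurable D -> (forall a, cmeasurable D (F a)) ->
  (forall x, D x -> ccontinuous (F ^~ x)) ->
  mu.-integrable D (EFin \o h) ->
  (forall a x, D x -> normc (F a x) <= h x) ->
  ccontinuous (fun a => cintegral D (F a)).
Proof.
move=> mD mF cF Ih Fh; split => /=.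
- apply: (@Rintegral_continuous D (fun a x => cRe (F a x)) h) => //.
  + by move=> a; case: (mF a).
  + by move=> x Dx; case: (cF x Dx).
  + by move=> a x Dx; exact: le_trans (normc_geRe _) (Fh _ _ Dx).
- apply: (@Rintegral_continuous D (fun a x => cIm (F a x)) h) => //.
  + by move=> a; case: (mF a).
  + by move=> x Dx; case: (cF x Dx).
  + by move=> a x Dx; exact: le_trans (normc_geIm _) (Fh _ _ Dx).
Qed.

Lemma continuousMR (f g : R -> R) : continuous f -> continuous g ->
  continuous (fun x => f x * g x).
Proof. by move=> cf cg x; apply: cvgM; [exact: cf|exact: cg]. Qed.

Lemma continuousDR (f g : R -> R) : continuous f -> continuous g ->
  continuous (fun x => f x + g x).
Proof. by move=> cf cg x; apply: cvgD; [exact: cf|exact: cg]. Qed.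

Lemma continuousNR (f : R -> R) : continuous f -> continuous (fun x => - f x).
Proof. by move=> cf x; apply: cvgN; exact: cf. Qed.

Lemma continuousBR (f g : R -> R) : continuous f -> continuous g ->
  continuous (fun x => f x - g x).
Proof. by move=> cf cg x; apply: cvgB; [exact: cf|exact: cg]. Qed.

Lemma continuous_compR (f g : R -> R) : continuous f -> continuous g ->
  continuous (fun x => g (f x)).
Proof. by move=> cf cg x; apply: (cvg_comp f g (cf x)); exact: cg. Qed.

Lemma continuous_idR : continuous (fun x : R => x). Proof. by move=> x; exact: cvg_id. Qed.

Lemma continuous_cstR (c : R) : continuous (fun x : R => c).
Proof. by move=> x; exact: cvg_cst. Qed.

Lemma ccontinuousM (f g : R -> R[i]) : ccontinuous f -> ccontinuous g ->
  ccontinuous (fun x => f x * g x).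
Proof.
move=> [f1 f2] [g1 g2]; split.
  by under eq_fun do rewrite cReM; apply: continuousBR; apply: continuousMR.
by under eq_fun do rewrite cImM; apply: continuousDR; apply: continuousMR.
Qed.

Lemma ccontinuousB (f g : R -> R[i]) : ccontinuous f -> ccontinuous g ->
  ccontinuous (fun x => f x - g x).
Proof.
move=> [f1 f2] [g1 g2]; split.
  by under eq_fun do rewrite cReB; apply: continuousBR.
by under eq_fun do rewrite cImB; apply: continuousBR.
Qed.

Lemma ccontinuous_cst (c : R[i]) : ccontinuous (fun=> c).
Proof. by split; exact: continuous_cstR. Qed.

Lemma ccontinuous_cexp (g : R -> R[i]) : ccontinuous g -> ccontinuous (fun x => cexp (g x)).
Proof.
move=> [g1 g2]; split => /=; apply: continuousMR.
- by apply: (continuous_compR g1); exact: continuous_expR.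
- by apply: (continuous_compR g2); exact: continuous_cos.
- by apply: (continuous_compR g1); exact: continuous_expR.
- by apply: (continuous_compR g2); exact: continuous_sin.
Qed.

Lemma ccontinuous_expi (f : R -> R) : continuous f -> ccontinuous (fun x => expi (f x)).
Proof. by move=> cf; apply: ccontinuous_cexp; split => //=; exact: continuous_cstR. Qed.

Lemma ccontinuous_measurable (g : R -> R[i]) : ccontinuous g -> cmeasurable setT g.
Proof. by move=> [g1 g2]; split; exact: continuous_measurable_fun. Qed.

End ParameterIntegrals.

(** * The Fourier transform of integrable functions *)

Section Fourier.
Context (R : realType).
Local Notation mu := (@lebesgue_measure R).
Local Notation kap := ((Num.sqrt (2 * pi))^-1 : R).
Implicit Types (f g h u : R -> R[i]).

Let cvg_weight (w : nat -> R) (c : R) :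
  w n @[n --> \oo] --> (1 : R) -> w n * c @[n --> \oo] --> c.
Proof.
by move=> w1; rewrite -[X in _ --> X]mul1r; apply: cvgM => //; exact: cvg_cst.
Qed.

Lemma kap_gt0 : 0 < kap.
Proof. by rewrite invr_gt0 sqrtr_gt0 mulr_gt0// pi_gt0. Qed.

Lemma kapM : kap * kap = (2 * pi)^-1.
Proof. by rewrite -invfM -expr2 sqr_sqrtr// mulr_ge0// pi_ge0. Qed.

Lemma measurable_phase (c : R) : measurable_fun setT (fun x : R => x * c).
Proof. exact: measurable_funM. Qed.

Lemma cintegrable_expi (th : R -> R) g : measurable_fun setT th ->
  cintegrable mu setT g -> cintegrable mu setT (fun x => expi (th x) * g x).
Proof.
move=> mth Ig; apply: (@cintegrableM_bounded _ _ _ _ _ _ _ 1) => //.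
  exact: cmeasurable_expi.
by move=> x _; rewrite normc_expi.
Qed.

Lemma fourierE g xi :
  fourier g xi = kap%:C * cintegral setT (fun x => expi (- (x * xi)) * g x).
Proof. by []. Qed.

Lemma inv_fourierE g x :
  inv_fourier g x = kap%:C * cintegral setT (fun xi => expi (x * xi) * g xi).
Proof. by []. Qed.

Lemma fourier_integrand g xi : cintegrable mu setT g ->
  cintegrable mu setT (fun x => expi (- (x * xi)) * g x).
Proof. by apply: cintegrable_expi; apply: measurableT_comp => //; exact: measurable_phase. Qed.

Lemma inv_fourier_integrand g x : cintegrable mu setT g ->
  cintegrable mu setT (fun xi => expi (x * xi) * g xi).
Proof. by apply: cintegrable_expi; exact: measurable_funM. Qed.

Lemma normc_fourier_le g xi : cintegrable mu setT g ->
  normc (fourier g xi) <= kap * (2 * \int[mu]_x normc (g x)).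
Proof.
move=> Ig; rewrite fourierE normcM normc_real ger0_norm; last exact: ltW kap_gt0.
apply: ler_wpM2l; first exact: ltW kap_gt0.
apply: normc_cintegral_le => //.
- exact: cintegrable_measurable (fourier_integrand _ Ig).
- by move=> x _; rewrite normcM normc_expi mul1r.
- exact: cintegrable_norm.
Qed.

Lemma fourier_continuous g : cintegrable mu setT g -> ccontinuous (fourier g).
Proof.
move=> Ig; apply: ccontinuousM; first exact: ccontinuous_cst.
apply: (@cintegral_continuous R setT _ (fun x => normc (g x))) => //.
- by move=> a; exact: cintegrable_measurable (fourier_integrand _ Ig).
- move=> x _; apply: ccontinuousM; last exact: ccontinuous_cst.
  apply: ccontinuous_expi; apply: continuousNR; apply: continuousMR.
    exact: continuous_cstR.
  exact: continuous_idR.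
- exact: cintegrable_norm.
- by move=> a x _; rewrite normcM normc_expi mul1r.
Qed.

Lemma inv_fourier_continuous g : cintegrable mu setT g -> ccontinuous (inv_fourier g).
Proof.
move=> Ig; apply: ccontinuousM; first exact: ccontinuous_cst.
apply: (@cintegral_continuous R setT _ (fun x => normc (g x))) => //.
- by move=> a; exact: cintegrable_measurable (inv_fourier_integrand _ Ig).
- move=> x _; apply: ccontinuousM; last exact: ccontinuous_cst.
  by apply: ccontinuous_expi; apply: continuousMR; [exact: continuous_idR|exact: continuous_cstR].
- exact: cintegrable_norm.
- by move=> a x _; rewrite normcM normc_expi mul1r.
Qed.

Lemma normc_inv_fourier_le g x : cintegrable mu setT g ->
  normc (inv_fourier g x) <= kap * (2 * \int[mu]_x normc (g x)).
Proof.
move=> Ig; rewrite inv_fourierE normcM normc_real ger0_norm; last exact: ltW kap_gt0.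
apply: ler_wpM2l; first exact: ltW kap_gt0.
apply: normc_cintegral_le => //.
- exact: cintegrable_measurable (inv_fourier_integrand _ Ig).
- by move=> y _; rewrite normcM normc_expi mul1r.
- exact: cintegrable_norm.
Qed.

Lemma fourierB f g xi : cintegrable mu setT f -> cintegrable mu setT g ->
  fourier (fun x => f x - g x) xi = fourier f xi - fourier g xi.
Proof.
move=> If Ig; rewrite !fourierE -mulrBr -cintegralB//; last 2 first.
- exact: fourier_integrand.
- exact: fourier_integrand.
by congr (_ * _); apply: eq_cintegral => x _; rewrite mulrBr.
Qed.

Lemma cmeasurable_prod1 g : cmeasurable setT g ->
  cmeasurable setT (fun z : R * R => g z.1).
Proof.
move=> [g1 g2]; split; first exact: (measurableT_comp g1 measurable_fst).
exact: (measurableT_comp g2 measurable_fst).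
Qed.

Lemma cmeasurable_prod2 g : cmeasurable setT g ->
  cmeasurable setT (fun z : R * R => g z.2).
Proof.
move=> [g1 g2]; split; first exact: (measurableT_comp g1 measurable_snd).
exact: (measurableT_comp g2 measurable_snd).
Qed.

(** The product rule for the Fourier transform, by exchanging the two
    integrals; [h] integrable makes [inv_fourier h] bounded. *)
Lemma fourier_mul_inv_fourier f h xi :
  cintegrable mu setT f -> cintegrable mu setT h ->
  fourier (fun y => f y * inv_fourier h y) xi =
  kap%:C * cintegral setT (fun eta => h eta * fourier f (xi - eta)).
Proof.
move=> If Ih; rewrite fourierE; congr (_ * _).
pose G (z : R * R) := kap%:C * (expi (- (z.1 * (xi - z.2))) * (f z.1 * h z.2)).
have mf := cintegrable_measurable If; have mh := cintegrable_measurable Ih.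
have mG : cmeasurable setT G.
  apply: cmeasurableM; first exact: cmeasurable_cst.
  apply: cmeasurableM; last first.
    by apply: cmeasurableM; [exact: cmeasurable_prod1|exact: cmeasurable_prod2].
  apply: cmeasurable_expi; apply: measurableT_comp => //.
  by apply: measurable_funM => //; apply: measurable_funB.
have IG : cintegrable (mu \x mu)%E setT G.
  apply: (cintegrable_prod_bound mG (f := fun x => kap * normc (f x)) (g := fun y => normc (h y))).
  - move=> x y; rewrite /G /= !normcM normc_expi normc_real mul1r mulrA.
    by rewrite ger0_norm// ltW// kap_gt0.
  - by apply: integrableRZ => //; exact: cintegrable_norm.
  - exact: cintegrable_norm.
transitivity (cintegral setT (fun x => cintegral setT (fun y => G (x, y)))).
  apply: eq_cintegral => y _; rewrite inv_fourierE.
  rewrite [X in _ * X]mulrA mulrA -cintegralZ//; last exact: inv_fourier_integrand.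
  apply: eq_cintegral => eta _; rewrite /G /=.
  have -> : - (y * (xi - eta)) = - (y * xi) + y * eta by ring.
  by rewrite expiD; ring.
rewrite cintegral_Fubini//; apply: eq_cintegral => eta _.
rewrite fourierE mulrA -cintegralZ//; last exact: fourier_integrand.
by apply: eq_cintegral => x _; rewrite /G /=; ring.
Qed.

(** Abel summation: integrating [u] against [exp (- e `|x|)] amounts to averaging
    [g] against a Poisson kernel of width [e]. *)
Theorem fourier_inversion u g : cintegrable mu setT u -> cintegrable mu setT g ->
  ccontinuous g -> {ae mu, forall x, u x = inv_fourier g x} ->
  forall xi, fourier u xi = g xi.
Proof.
move=> Iu Ig cg uE eta.
have mu_ := cintegrable_measurable Iu; have mg := cintegrable_measurable Ig.
pose e n : R := n.+1%:R^-1.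
have e0 n : 0 < e n by rewrite invr_gt0 ltr0n.
have ecv : e n @[n --> \oo] --> 0 by exact: cvg_harmonic.
pose w n (x : R) := expR (- (e n * `|x|)).
have w0 n x : 0 <= w n x by exact: expR_ge0.
have w1 n x : w n x <= 1.
  by rewrite /w -expR0 ler_expR oppr_le0 mulr_ge0// ltW.
have mw n : measurable_fun setT (w n).
  by apply: continuous_measurable_fun; exact: continuous_abel.
have mwC n : cmeasurable setT (fun x => (w n x)%:C).
  by split => //=; exact: measurable_cst.
have Iw n : mu.-integrable setT (EFin \o w n) by exact: integrable_abel.
have wcv x : w n x @[n --> \oo] --> (1 : R).
  rewrite /w -expR0; apply: continuous_cvg; first exact: continuous_expR.
  rewrite -oppr0; apply: cvgN; rewrite -(mul0r `|x|).
  by apply: cvgM => //; exact: cvg_cst.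
pose I n := kap%:C * cintegral setT (fun x => (w n x)%:C * (expi (- (x * eta)) * u x)).
(* Abel means of the transform converge to the transform *)
have [IRe IIm] : cRe (I n) @[n --> \oo] --> cRe (fourier u eta) /\
    cIm (I n) @[n --> \oo] --> cIm (fourier u eta).
  have Ieu := fourier_integrand eta Iu.
  have [c1 c2] : cRe (cintegral setT (fun x => (w n x)%:C * (expi (- (x * eta)) * u x)))
      @[n --> \oo] --> cRe (cintegral setT (fun x => expi (- (x * eta)) * u x)) /\
    cIm (cintegral setT (fun x => (w n x)%:C * (expi (- (x * eta)) * u x)))
      @[n --> \oo] --> cIm (cintegral setT (fun x => expi (- (x * eta)) * u x)).
    apply: (@cintegral_dominated _ _ _ _ (fun x => normc (u x))) => //.
    - move=> n; apply: cmeasurableM => //; exact: cintegrable_measurable Ieu.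
    - move=> x _; under eq_fun do rewrite cReM /= mul0r subr0.
      exact: cvg_weight.
    - move=> x _; under eq_fun do rewrite cImM /= mul0r addr0.
      exact: cvg_weight.
    - exact: cintegrable_norm.
    - move=> n x _; rewrite !normcM normc_expi normc_real mul1r ger0_norm//.
      by rewrite ler_piMl// normc_ge0.
  split; rewrite /I fourierE.
    under eq_fun do rewrite cReM /= mul0r subr0.
    by rewrite cReM /= mul0r subr0; apply: cvgM c1; exact: cvg_cst.
  under eq_fun do rewrite cImM /= mul0r addr0.
  by rewrite cImM /= mul0r addr0; apply: cvgM c2; exact: cvg_cst.
(* the same means are Poisson averages of g *)
have IE n : I n = pi^-1%:C * cintegral setT
    (fun xi => (e n / (e n ^+ 2 + (xi - eta) ^+ 2))%:C * g xi).
  pose G (z : R * R) := kap%:C * ((w n z.1)%:C * (expi (z.1 * (z.2 - eta)) * g z.2)).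
  have mG : cmeasurable setT G.
    apply: cmeasurableM; first exact: cmeasurable_cst.
    apply: cmeasurableM; first exact: (cmeasurable_prod1 (mwC n)).
    apply: cmeasurableM; last exact: cmeasurable_prod2.
    by apply: cmeasurable_expi; apply: measurable_funM => //; apply: measurable_funB.
  have IG : cintegrable (mu \x mu)%E setT G.
    apply: (cintegrable_prod_bound mG (f := fun x => kap * w n x) (g := fun y => normc (g y))).
    - move=> x y; rewrite /G normcM normcM normcM normc_expi !normc_real mul1r mulrA.
      by rewrite (ger0_norm (w0 n x)) ger0_norm// ltW// kap_gt0.
    - exact: integrableRZ.
    - exact: cintegrable_norm.
  transitivity (kap%:C * cintegral setT (fun x => cintegral setT (fun y => G (x, y)))).
    congr (_ * _); apply: ae_eq_cintegral => //.
    - apply: cmeasurableM => //; exact: cintegrable_measurable (fourier_integrand _ Iu).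
    - exact: cintegrable_measurable (cintegrable_inner1 IG).
    - apply: ae_imp uE => x -> _; rewrite inv_fourierE !mulrA -cintegralZ//; last first.
        exact: inv_fourier_integrand.
      apply: eq_cintegral => xi _; rewrite /G /=.
      have -> : x * (xi - eta) = - (x * eta) + x * xi by ring.
      by rewrite expiD; ring.
  rewrite cintegral_Fubini//.
  have inner xi : cintegral setT (fun x => G (x, xi)) =
      (kap * (2 * (e n / (e n ^+ 2 + (xi - eta) ^+ 2))))%:C * g xi.
    transitivity (cintegral setT (fun x => (kap%:C * g xi) * ((w n x)%:C * expi (x * (xi - eta))))).
      by apply: eq_cintegral => x _; rewrite /G /=; ring.
    have Iwe : cintegrable mu setT (fun x => (w n x)%:C * expi (x * (xi - eta))).
      apply: (cintegrable_le measurableT _ _ (Iw n)).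
      - apply: cmeasurableM; first exact: (mwC n).
        by apply: cmeasurable_expi; exact: measurable_phase.
      - by move=> x _; rewrite normcM normc_expi normc_real mulr1 ger0_norm.
    rewrite cintegralZ//.
    have -> : cintegral setT (fun x => (w n x)%:C * expi (x * (xi - eta))) =
        (2 * (e n / (e n ^+ 2 + (xi - eta) ^+ 2)))%:C.
      apply: complex_ext => /=.
        rewrite -(Rintegral_abel_cos _ (e0 n)); apply: eq_Rintegral => x _.
        by rewrite expR0 mul1r mul0r subr0.
      rewrite -[RHS](Rintegral_abel_sin (xi - eta) (e0 n)); apply: eq_Rintegral => x _.
      by rewrite expR0 mul1r mul0r addr0.
    by rewrite [RHS]mulrC rmorphM /=; ring.
  rewrite (eq_cintegral (g := fun xi => (kap * 2)%:C *
     ((e n / (e n ^+ 2 + (xi - eta) ^+ 2))%:C * g xi))); last first.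
    by move=> xi _; rewrite inner !rmorphM /= ; ring.
  rewrite cintegralZ//; last first.
    apply: (@cintegrableM_bounded _ _ _ _ _ _ _ (e n)^-1) => //.
      split => /=; last exact: measurable_cst.
      exact: integrableR_measurable (integrable_poisson eta (e0 n)).
    move=> xi _; rewrite normc_real ger0_norm; last first.
      by apply: divr_ge0; [exact: ltW|rewrite addr_ge0 ?sqr_ge0].
    rewrite ler_pdivrMr ?ltr_wpDr ?sqr_ge0 ?exprn_gt0//.
    rewrite expr2 mulrDr mulrA mulVf ?gt_eqF// mul1r lerDl.
    by rewrite mulr_ge0 ?sqr_ge0 ?invr_ge0// ltW.
  rewrite mulrA -rmorphM /= mulrA kapM.
  by rewrite invfM mulrAC mulVf ?mul1r// pnatr_eq0.
have Icv (p : R[i] -> R) : (p = (@cRe R) \/ p = (@cIm R)) ->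
    p (I n) @[n --> \oo] --> p (g eta).
  case=> ->.
  - have -> : (fun n => cRe (I n)) = (fun n =>
      pi^-1 * \int[mu]_x (cRe (g x) * (e n / (e n ^+ 2 + (x - eta) ^+ 2)))).
    apply/funext => n; rewrite IE cReM /= mul0r subr0; congr (_ * _).
    by apply: eq_Rintegral => x _; rewrite cReM /= mul0r subr0 mulrC.
  rewrite -[cRe (g eta)](mulKf (lt0r_neq0 (pi_gt0 R))).
  by apply: cvgM; [exact: cvg_cst|exact: poisson_approximation Ig.1 (cg.1 eta) e0 ecv].
- have -> : (fun n => cIm (I n)) = (fun n =>
      pi^-1 * \int[mu]_x (cIm (g x) * (e n / (e n ^+ 2 + (x - eta) ^+ 2)))).
    apply/funext => n; rewrite IE cImM /= mul0r addr0; congr (_ * _).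
    by apply: eq_Rintegral => x _; rewrite cImM /= mul0r addr0 mulrC.
  rewrite -[cIm (g eta)](mulKf (lt0r_neq0 (pi_gt0 R))).
  by apply: cvgM; [exact: cvg_cst|exact: poisson_approximation Ig.2 (cg.2 eta) e0 ecv].
apply: complex_ext.
  by rewrite -(cvg_lim _ IRe)//; apply/cvg_lim => //; apply: Icv; left.
by rewrite -(cvg_lim _ IIm)//; apply/cvg_lim => //; apply: Icv; right.
Qed.

End Fourier.

(** * Weighted spaces *)

Section Weighted.
Context (R : realType).
Local Notation mu := (@lebesgue_measure R).
Local Notation kap := ((Num.sqrt (2 * pi))^-1 : R).
Implicit Types (f g h : R -> R).

(** What membership in [Z_{2,2}] says, in the same form, of a function and of
    its Fourier transform. By the Cauchy-Schwarz inequality it yields the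
    integrability of [h] and of [x h]. *)
Definition weighted h := measurable_fun setT h /\
  mu.-integrable setT (EFin \o (fun x => ((1 + x ^+ 2) * h x) ^+ 2)).

Lemma weighted_moment h : weighted h ->
  mu.-integrable setT (EFin \o (fun x => (1 + `|x|) * `|h x|)).
Proof.
move=> [mh Ih].
apply: (integrableR_le measurableT _ _ (integrableRD measurableT (@integrable_inv1sqr R) Ih)).
  by apply: measurable_funM; [apply: measurable_funD => //|]; exact: measurableT_comp.
move=> x _; rewrite ger0_norm; last by rewrite mulr_ge0 ?addr_ge0.
set q := 1 + x ^+ 2; have q0 : 0 < q by rewrite ltr_wpDr ?sqr_ge0.
have xx : `|x| ^+ 2 = x ^+ 2 by rewrite real_normK ?num_real.
have key : (1 + `|x|) ^+ 2 / 2 <= q.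
  by rewrite ler_pdivrMr// /q -xx; have := sqr_ge0 (1 - `|x|); nra.
pose a := (1 + `|x|) / q; pose b := q * `|h x|.
have -> : (1 + `|x|) * `|h x| = a * b by rewrite /a /b; field; rewrite gt_eqF.
have -> : (q * h x) ^+ 2 = b ^+ 2 by rewrite /b !exprMn real_normK ?num_real.
have ha : a ^+ 2 / 2 <= q^-1.
  rewrite /a expr_div_n -[leRHS]mul1r ler_pdivlMr//.
  have -> : (1 + `|x|) ^+ 2 / q ^+ 2 / 2 * q = (1 + `|x|) ^+ 2 / 2 / q by field; rewrite gt_eqF.
  by rewrite ler_pdivrMr// mul1r.
have := sqr_ge0 (a - b); rewrite sqrrB; have := sqr_ge0 b; nra.
Qed.

Lemma weighted_integrable h : weighted h -> mu.-integrable setT (EFin \o h).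
Proof.
move=> wh; have := weighted_moment wh; apply: integrableR_le => //; first by case: wh.
move=> x _.
by rewrite ler_peMl// lerDl.
Qed.

Lemma weighted_xintegrable h : weighted h ->
  mu.-integrable setT (EFin \o (fun x => x * h x)).
Proof.
move=> wh; apply: (integrableR_le measurableT _ _ (weighted_moment wh)).
  by apply: measurable_funM => //; case: wh.
by move=> x _; rewrite normrM ler_wpM2r// lerDr.
Qed.

Lemma weight_ge1 (x : R) : 1 <= (1 + x ^+ 2) ^+ 2.
Proof. by rewrite exprn_ege1// lerDl sqr_ge0. Qed.

Lemma weighted_sqr h : weighted h -> mu.-integrable setT (EFin \o (fun x => h x ^+ 2)).
Proof.
move=> [mh Ih]; apply: (integrableR_le measurableT _ _ Ih); first exact: measurable_funX.
by move=> x _; rewrite ger0_norm ?sqr_ge0// exprMn ler_peMl ?sqr_ge0// weight_ge1.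
Qed.

Lemma weighted_xsqr h : weighted h ->
  mu.-integrable setT (EFin \o (fun x => x ^+ 2 * h x ^+ 2)).
Proof.
move=> [mh Ih]; apply: (integrableR_le measurableT _ _ Ih).
  by apply: measurable_funM; apply: measurable_funX.
move=> x _; have := sqr_ge0 (h x); have := sqr_ge0 x => x0 h0.
rewrite ger0_norm; last exact: mulr_ge0.
by rewrite exprMn; apply: ler_wpM2r => //; nra.
Qed.

Lemma poweR_sqr (x : \bar R) : (0 <= x)%E -> (x `^ 2 = x ^+ 2)%E.
Proof.
case: x => [r r0||] //=; first by rewrite powR_mulrn// -EFin_expe.
by rewrite pnatr_eq0 /= mulyy.
Qed.

Lemma Lnorm2_sqrE g : measurable_fun setT g ->
  (Lnorm mu 2%:E (fun x => (g x)%:E) ^+ 2 = \int[mu]_x (g x ^+ 2)%:E)%E.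
Proof.
move=> mg; have := @poweR_Lnorm _ _ R mu (fun x => (g x)%:E) 2.
rewrite poweR_sqr ?Lnorm_ge0// => ->//.
apply: eq_integral => x _; rewrite -[`|_|%E]/(`|g x|%:E) poweR_EFin powR_mulrn//.
by rewrite real_normK ?num_real.
Qed.

Lemma Lnorm2_ltoo g : measurable_fun setT g ->
  (Lnorm mu 2%:E (fun x => (g x)%:E) < +oo)%E ->
  mu.-integrable setT (EFin \o (fun x => g x ^+ 2)).
Proof.
move=> mg goo; apply: integrableR_ltoo => //.
- exact: measurable_funX.
- by move=> x _; exact: sqr_ge0.
- by rewrite -Lnorm2_sqrE// -poweR_sqr ?Lnorm_ge0// poweR_lty.
Qed.

Lemma toC_integrable f : mu.-integrable setT (EFin \o f) -> cintegrable mu setT (toC f).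
Proof. by move=> If; split => //; exact: integrable0. Qed.

Lemma Z22_weighted f : Z 2 2 f -> weighted f.
Proof.
move=> [[Lf _] [mf foo]]; split => //.
have If2 := Lfun2_integrable_sqr Lf.
have If4 : mu.-integrable setT (EFin \o (fun x => `|x| `^ (2 * 2) * f x ^+ 2)).
  apply: integrableR_ltoo => //.
  - apply: measurable_funM; last exact: measurable_funX.
    by apply: (@measurableT_comp _ _ _ _ _ _ (fun x => x `^ (2 * 2))%R) => //; exact: measurable_powR.
  - by move=> x _; rewrite mulr_ge0 ?powR_ge0 ?sqr_ge0.
have := integrableRZ 2 measurableT (integrableRD measurableT If2 If4).
apply: integrableR_le => //.
  apply: measurable_funX; apply: measurable_funM => //.
  by apply: measurable_funD => //; exact: measurable_funX.
move=> x _; rewrite ger0_norm ?sqr_ge0// -natrM powR_mulrn// exprMn.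
rewrite -[in leRHS](mul1r (f x ^+ 2)) mulrA -mulrDl mulrA ler_wpM2r ?sqr_ge0//.
have -> : `|x| ^+ (2 * 2) = (x ^+ 2) ^+ 2 by rewrite exprM real_normK ?num_real.
by have := sqr_ge0 (x ^+ 2 - 1); rewrite sqrrB; nra.
Qed.

Lemma Hnorm2E f : (Hnorm 2 f = Lnorm mu 2%:E (fun xi =>
  ((1 + xi ^+ 2) * normc (fourier (toC f) xi))%:E))%E.
Proof.
by rewrite /Hnorm; apply: eq_Lnorm => x; rewrite divff// powRr1// addr_ge0// sqr_ge0.
Qed.

Lemma measurable_normc_fourier f : mu.-integrable setT (EFin \o f) ->
  measurable_fun setT (fun xi => normc (fourier (toC f) xi)).
Proof.
move=> If; apply: measurable_normc; apply: ccontinuous_measurable.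
by apply: fourier_continuous; exact: toC_integrable.
Qed.

Lemma measurable_weight (h : R -> R) : measurable_fun setT h ->
  measurable_fun setT (fun x : R => (1 + x ^+ 2) * h x).
Proof.
by move=> mh; apply: measurable_funM => //; apply: measurable_funD => //; exact: measurable_funX.
Qed.

Lemma Z22_weighted_fourier f : Z 2 2 f ->
  weighted (fun xi => normc (fourier (toC f) xi)).
Proof.
move=> Zf; have If := weighted_integrable (Z22_weighted Zf).
case: Zf => -[_ Hf] _; rewrite Hnorm2E in Hf.
have mF := measurable_normc_fourier If; split => //.
by apply: Lnorm2_ltoo => //; exact: measurable_weight.
Qed.

Lemma Znorm22_lt f (d : R) : weighted f -> 0 < d -> (Znorm 2 2 f < d%:E)%E ->
  (\int[mu]_x ((((1 + x ^+ 2) * f x) ^+ 2)%:E) <= (d ^+ 2)%:E)%E /\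
  (\int[mu]_x ((((1 + x ^+ 2) * normc (fourier (toC f) x)) ^+ 2)%:E) <= (d ^+ 2)%:E)%E.
Proof.
move=> wf d0; rewrite /Znorm Hnorm2E.
rewrite (@eq_Lnorm _ _ R mu 2%:E (fun x => ((1 + x ^+ 2) `^ (2 / 2) * f x)%:E)
  (fun x => ((1 + x ^+ 2) * f x)%:E)); last first.
  by move=> x; rewrite divff// powRr1// addr_ge0// sqr_ge0.
have If := weighted_integrable wf.
rewrite !Lnorm2_sqrE; last 2 first.
- by apply: measurable_weight; case: wf.
- by apply: measurable_weight; exact: measurable_normc_fourier.
set S1 := (X in (X + _)%E); set S2 := (X in (_ + X)%E).
have S10 : (0 <= S1)%E by apply: integral_ge0 => x _; rewrite lee_fin sqr_ge0.
have S20 : (0 <= S2)%E by apply: integral_ge0 => x _; rewrite lee_fin sqr_ge0.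
move=> Sd; have SS : (S1 + S2 <= (d ^+ 2)%:E)%E.
  rewrite [leLHS](_ : _ = ((S1 + S2) `^ 2^-1) ^+ 2)%E; last first.
    by rewrite -poweR_sqr ?poweR_ge0// -poweRrM mulVf// poweRe1// adde_ge0.
  by rewrite EFin_expe !expe2 lee_pmul ?poweR_ge0// ltW.
by split; apply: le_trans SS; [rewrite leeDr|rewrite leeDl].
Qed.

End Weighted.

(** * Continuity in time *)

Section MeanSquare.
Context (R : realType).
Local Notation mu := (@lebesgue_measure R).

Let cancel (e k m : R) : k != 0 -> m != 0 -> k * (m * (e / (2 * k * m))) = e / 2.
Proof. by move=> k0 m0; field; rewrite m0 k0. Qed.

(** One first fixes [d], small against [B], and then makes [E] small. The free
    parameter [d] stands for the square root in the Cauchy-Schwarz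
    inequality. *)
Lemma continuous_of_tradeoff (f E : R -> R) (t0 B K : R) : 0 <= B -> 0 <= K ->
  (forall d, 0 < d -> \forall t \near t0, E t <= d) ->
  (forall t d, 0 < d -> `|f t - f t0| <= K * ((1 + d^-1) * E t + d * B)) ->
  {for t0, continuous f}.
Proof.
move=> B0 K0 E0 fE; apply/cvgrPdist_le => e e0.
have K1 : 0 < K + 1 by rewrite ltr_wpDl. have B1 : 0 < B + 1 by rewrite ltr_wpDl.
pose d := e / (2 * (K + 1) * (B + 1)).
have d0 : 0 < d by rewrite divr_gt0// !mulr_gt0.
have d1 : 0 < 1 + d^-1 by rewrite addr_gt0// invr_gt0.
pose c := e / (2 * (K + 1) * (1 + d^-1)).
have c0 : 0 < c by rewrite divr_gt0// !mulr_gt0.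
near=> t; rewrite distrC; apply: (le_trans (fE t d d0)).
have Ec : E t <= c by near: t; exact: E0.
have h1 : (K + 1) * ((1 + d^-1) * c) = e / 2.
  by rewrite /c; apply: cancel; rewrite gt_eqF.
have h2 : (K + 1) * (d * (B + 1)) = e / 2.
  by rewrite /d [_ / _ * _]mulrC; apply: cancel; rewrite gt_eqF.
have h3 : (1 + d^-1) * E t <= (1 + d^-1) * c by rewrite ler_pM2l.
have h4 : d * B <= d * (B + 1) by rewrite ler_pM2l// lerDl.
rewrite [leRHS]splitr -{1}h1 -h2 -mulrDr.
have h5 : 0 <= (1 + d^-1) * c + d * (B + 1).
  by rewrite addr_ge0// mulr_ge0// ltW.
apply: (@le_trans _ _ (K * ((1 + d^-1) * c + d * (B + 1)))).
  by rewrite ler_wpM2l// lerD.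
by rewrite ler_wpM2r// lerDl.
Unshelve. all: by end_near. Qed.

Record L2path (a : R -> R -> R[i]) : Prop := {
  L2path_measurable : forall t, cmeasurable setT (a t) ;
  L2path_sqr : forall t, mu.-integrable setT (EFin \o (fun x => normc (a t x) ^+ 2)) ;
  L2path_cvg : forall t0 d, 0 < d ->
    \forall t \near t0, \int[mu]_x (normc (a t x - a t0 x) ^+ 2) <= d }.

Variable a : R -> R -> R[i].
Hypothesis La : L2path a.

Lemma L2path_diff t s : mu.-integrable setT (EFin \o (fun x => normc (a t x - a s x) ^+ 2)).
Proof.
have := integrableRZ 2 measurableT
  (integrableRD measurableT (L2path_sqr La t) (L2path_sqr La s)).
apply: integrableR_le => //.
  apply: measurable_funX; apply: measurable_normc.
  by apply: cmeasurableB; exact: L2path_measurable.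
move=> x _; rewrite ger0_norm ?sqr_ge0//.
have := normcB (a t x) (a s x); have := normc_ge0 (a t x - a s x).
by have := sqr_ge0 (normc (a t x) - normc (a s x)); nra.
Qed.

Lemma young (p q d : R) : 0 < d -> 2 * (p * q) <= d^-1 * p ^+ 2 + d * q ^+ 2.
Proof.
move=> d0; have d1 : 0 < d^-1 by rewrite invr_gt0.
have : 0 <= d^-1 * (p - d * q) ^+ 2 by rewrite mulr_ge0 ?sqr_ge0// ltW.
have -> : d^-1 * (p - d * q) ^+ 2 = d^-1 * p ^+ 2 + d * q ^+ 2 - 2 * (p * q).
  by field; rewrite gt_eqF.
by rewrite subr_ge0.
Qed.

Lemma L2path_norm_continuous : continuous (fun t => \int[mu]_x (normc (a t x) ^+ 2)).
Proof.
move=> t0; have Isq := L2path_sqr La; have Id := L2path_diff.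
have B0 : 0 <= \int[mu]_x (normc (a t0 x) ^+ 2).
  by apply: Rintegral_ge0 => x _; exact: sqr_ge0.
apply: (continuous_of_tradeoff B0 ler01 (L2path_cvg La t0)).
move=> t d d0; rewrite mul1r -RintegralB//.
rewrite -RintegralZl; [|by []|exact: Id]; rewrite -RintegralZl; [|by []|exact: Isq].
rewrite -RintegralD//; [|exact: integrableRZ (Id t t0)|exact: integrableRZ (Isq t0)].
apply: norm_Rintegral_le => //.
- by apply: measurable_funB; apply: measurable_funX; apply: measurable_normc;
    exact: L2path_measurable.
- move=> x _; set z := a t x; set w := a t0 x.
  have h1 : normc z <= normc (z - w) + normc w by rewrite -{1}(subrK w z) normcD.
  have h2 : normc w <= normc (z - w) + normc z.
    by rewrite -{1}(subrK z w) (le_trans (normcD _ _))// -opprB normcN.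
  have := young (normc (z - w)) (normc w) d0.
  rewrite mulrDl mul1r => yg.
  have := normc_ge0 z; have := normc_ge0 w; have := normc_ge0 (z - w).
  by move=> ? ? ?; rewrite ler_norml; apply/andP; split; nra.
- by apply: integrableRD => //; apply: integrableRZ => //; exact: Id.
Qed.

(** The increment of the product splits into terms that are linear or quadratic
    in the increment of [a]; [young] bounds their integrals by the trade-off of
    [continuous_of_tradeoff]. *)
Lemma L2path_convolution_continuous y :
  ccontinuous (fun t => cintegral setT (fun x => a t x * a t (y - x))).
Proof.
have Isq := L2path_sqr La; have Id := L2path_diff; have ma := L2path_measurable La.
have rm t : cmeasurable setT (fun x : R => a t (y - x)).
  have [m1 m2] := ma t.
  have mr : measurable_fun setT (fun x : R => y - x) by apply: measurable_funB.
  by split; [exact: (measurableT_comp m1 mr)|exact: (measurableT_comp m2 mr)].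
have IP t : cintegrable mu setT (fun x => a t x * a t (y - x)).
  have Is := integrableRD measurableT (Isq t) (integrable_reflect y (Isq t)).
  apply: (cintegrable_le measurableT _ _ Is).
  - by apply: cmeasurableM; [exact: ma|exact: rm].
  - move=> x _; rewrite normcM; have := sqr_ge0 (normc (a t x) - normc (a t (y - x))).
    by have := normc_ge0 (a t x); have := normc_ge0 (a t (y - x)); nra.
pose E t0 t := \int[mu]_x (normc (a t x - a t0 x) ^+ 2).
pose B t := \int[mu]_x (normc (a t x) ^+ 2).
have main t0 t d : 0 < d ->
    normc (cintegral setT (fun x => a t x * a t (y - x)) -
           cintegral setT (fun x => a t0 x * a t0 (y - x))) <=
    2 * ((1 + d^-1) * E t0 t + d * B t0).
  move=> d0; rewrite -cintegralB//.
  pose D x := normc (a t x - a t0 x) ^+ 2; pose b x := normc (a t0 x) ^+ 2.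
  have rD := integrable_reflect y (Id t t0); have rb := integrable_reflect y (Isq t0).
  have eD : \int[mu]_x D (y - x) = E t0 t := Rintegral_reflect y (Id t t0).
  have eb : \int[mu]_x b (y - x) = B t0 := Rintegral_reflect y (Isq t0).
  pose h x := (1 + d^-1) / 2 * (D x + D (y - x)) + d / 2 * (b x + b (y - x)).
  have I1 : mu.-integrable setT (EFin \o (fun x => D x + D (y - x))).
    by apply: integrableRD => //; exact: Id.
  have I2 : mu.-integrable setT (EFin \o (fun x => b x + b (y - x))).
    by apply: integrableRD => //; exact: Isq.
  have Ih : mu.-integrable setT (EFin \o h).
    by apply: integrableRD => //; exact: integrableRZ.
  have -> : (1 + d^-1) * E t0 t + d * B t0 = \int[mu]_x h x.
    rewrite RintegralD//; [|exact: integrableRZ I1|exact: integrableRZ I2].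
    rewrite (RintegralZl _ measurableT I1) (RintegralZl _ measurableT I2).
    rewrite RintegralD//; [|exact: Id].
    rewrite RintegralD//; [|exact: Isq].
    by rewrite eD eb -/(E t0 t) -/(B t0); field; rewrite gt_eqF.
  apply: normc_cintegral_le => //.
  - by apply: cmeasurableB; apply: cmeasurableM; [exact: ma|exact: rm|exact: ma|exact: rm].
  - move=> x _; rewrite /h /D /b.
    set z := a t x; set w := a t0 x; set z' := a t (y - x); set w' := a t0 (y - x).
    have -> : z * z' - w * w' = (z - w) * (z' - w') + (z - w) * w' + w * (z' - w') by ring.
    apply: (le_trans (normcD _ _)); apply: (le_trans (lerD (normcD _ _) (lexx _))).
    rewrite !normcM.
    have y1 := young (normc (z - w)) (normc w') d0.
    have y2 := young (normc (z' - w')) (normc w) d0.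
    have := sqr_ge0 (normc (z - w) - normc (z' - w')).
    move: (normc (z - w)) (normc (z' - w')) (normc w) (normc w') y1 y2 => p p' q q' y1 y2.
    by rewrite sqrrB; move: (d^-1) y1 y2 => di y1 y2 h0; nra.
have B0 t : 0 <= B t by apply: Rintegral_ge0 => x _; exact: sqr_ge0.
split => t0.
- apply: (continuous_of_tradeoff (B0 t0) (ler0n _ 2) (L2path_cvg La t0)) => t d d0.
  by rewrite -cReB; exact: le_trans (normc_geRe _) (main t0 t d d0).
- apply: (continuous_of_tradeoff (B0 t0) (ler0n _ 2) (L2path_cvg La t0)) => t d d0.
  by rewrite -cImB; exact: le_trans (normc_geIm _) (main t0 t d d0).
Qed.

End MeanSquare.

(** * Paths in the space of the solution *)

Section Path.
Context (R : realType).
Local Notation mu := (@lebesgue_measure R).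
Local Notation kap := ((Num.sqrt (2 * pi))^-1 : R).

Let half (F : numFieldType) (x : F) : 2^-1 * (x + x) = x.
Proof. by rewrite -mulr2n -[x *+ 2]mulr_natl mulKf// pnatr_eq0. Qed.

(** Composing with the retraction of the line onto the time interval makes the
    solution a path over the whole line, and continuity in time two-sided. *)
Definition clamp (T t : R) : R := Num.max 0 (Num.min t T).

Lemma clamp_in T t : 0 <= T -> clamp T t \in `[0, T].
Proof.
move=> T0; rewrite in_itv/= /clamp le_max lexx /= ge_max T0 /=.
by rewrite ge_min lexx orbT.
Qed.

Lemma clamp_id T t : t \in `[0, T] -> clamp T t = t.
Proof. by rewrite in_itv/= /clamp => /andP[t0 tT]; rewrite min_l// max_r. Qed.

Lemma continuous_clamp T : continuous (clamp T).
Proof.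
move=> t; have h : {for t, continuous ((cst 0 : R -> R^o) \max ((id : R -> R^o) \min cst T))}.
  apply: continuous_max; first exact: cvg_cst.
  by apply: continuous_min; [exact: cvg_id|exact: cvg_cst].
exact: h.
Qed.

Variables (T : R) (u : R -> R -> R).
Hypotheses (T0 : 0 <= T) (cu : continuous_in_Zdot T 2 2 u).

Definition upath (t : R) : R -> R := u (clamp T t).
Definition uhat (t : R) : R -> R[i] := fourier (toC (upath t)).

Lemma upath_id t : t \in `[0, T] -> upath t = u t.
Proof. by rewrite /upath => /clamp_id ->. Qed.

Lemma upath_Z t : Z 2 2 (upath t).
Proof. by case: (cu.1 _ (clamp_in t T0)). Qed.

Lemma uhat0 t : uhat t 0 = 0.
Proof. by case: (cu.1 _ (clamp_in t T0)). Qed.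

Lemma upath_weighted t : weighted (upath t).
Proof. exact/Z22_weighted/upath_Z. Qed.

Lemma upath_integrable t : mu.-integrable setT (EFin \o upath t).
Proof. exact/weighted_integrable/upath_weighted. Qed.

Lemma toC_upath_integrable t : cintegrable mu setT (toC (upath t)).
Proof. exact/toC_integrable/upath_integrable. Qed.

Lemma uhat_continuous t : ccontinuous (uhat t).
Proof. exact/fourier_continuous/toC_upath_integrable. Qed.

Lemma uhat_measurable t : cmeasurable setT (uhat t).
Proof. exact/ccontinuous_measurable/uhat_continuous. Qed.

Lemma uhat_weighted t : weighted (fun xi => normc (uhat t xi)).
Proof. exact/Z22_weighted_fourier/upath_Z. Qed.

Lemma uhat_integrable t : cintegrable mu setT (uhat t).
Proof.
have := weighted_integrable (uhat_weighted t).
by apply: cintegrable_le => //; exact: uhat_measurable.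
Qed.

Lemma xuhat_integrable t : cintegrable mu setT (fun xi => (0 +i* xi) * uhat t xi).
Proof.
have := integrableR_norm measurableT (weighted_xintegrable (uhat_weighted t)).
apply: cintegrable_le => //.
- by apply: cmeasurableM; [apply: cmeasurable_mk|exact: uhat_measurable].
- by move=> x _; rewrite normcM normc_imag normrM (ger0_norm (normc_ge0 _)).
Qed.

Lemma path_cvg (t0 d : R) : 0 < d ->
  \forall t \near t0, (Znorm 2 2 (upath t \- upath t0)%R < d%:E)%E.
Proof.
move=> d0; have ct0 := clamp_in t0 T0.
have /fine_cvgP[fin cv] := cu.2 _ ct0.
have {cv} : \forall s \near within `[0, T] (nbhs (clamp T t0)),
    (Znorm 2 2 (u s \- u (clamp T t0))%R < d%:E)%E.
  move/cvgrPdist_lt : cv => /(_ _ d0); apply: filterS2 fin => s fs.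
  rewrite /= sub0r normrN => h; rewrite -(fineK fs) lte_fin.
  exact: le_lt_trans (ler_norm _) h.
rewrite near_withinE => /(@continuous_clamp T t0) H.
apply: (@filterS _ _ _ (fun t => `[0, T]%classic (clamp T t) ->
  (Znorm 2 2 (u (clamp T t) \- u (clamp T t0))%R < d%:E)%E)); last exact: H.
by move=> t; apply; exact: clamp_in.
Qed.

Lemma path_diff_weighted t s : weighted (upath t \- upath s).
Proof.
have [m1 I1] := upath_weighted t; have [m2 I2] := upath_weighted s.
split; first exact: measurable_funB.
have := integrableRZ 2 measurableT (integrableRD measurableT I1 I2).
apply: integrableR_le => //.
  by apply: measurable_funX; apply: measurable_weight; exact: measurable_funB.
move=> x _; rewrite ger0_norm ?sqr_ge0//= mulrBr.
set p := _ * upath t x; set q := _ * upath s x.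
by have := sqr_ge0 (p + q); nra.
Qed.

Lemma path_diff_Z t s (d : R) : 0 < d -> (Znorm 2 2 (upath t \- upath s)%R < d%:E)%E ->
  \int[mu]_x (((1 + x ^+ 2) * (upath t x - upath s x)) ^+ 2) <= d ^+ 2 /\
  \int[mu]_x (((1 + x ^+ 2) * normc (uhat t x - uhat s x)) ^+ 2) <= d ^+ 2.
Proof.
move=> d0 /(Znorm22_lt (path_diff_weighted t s) d0)[h1 h2].
split.
  rewrite -lee_fin /Rintegral fineK//; last exact: integrable_fin_num (path_diff_weighted t s).2.
have E : (fun x => (((1 + x ^+ 2) * normc (fourier (toC (upath t \- upath s)) x)) ^+ 2)%:E) =
         (fun x => (((1 + x ^+ 2) * normc (uhat t x - uhat s x)) ^+ 2)%:E).
  apply/funext => x; rewrite /uhat -fourierB; [|exact: toC_upath_integrable..].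
  congr ((_ * normc (fourier _ x)) ^+ 2)%:E; apply/funext => y.
  by rewrite /toC rmorphB.
rewrite E in h2; rewrite -lee_fin /Rintegral fineK//.
rewrite ge0_fin_numE; first exact: le_lt_trans h2 (ltry _).
by apply: integral_ge0 => x _; rewrite lee_fin sqr_ge0.
Qed.

Let sqr_near (d : R) : 0 < d -> exists2 c : R, 0 < c & c ^+ 2 <= d.
Proof.
by move=> d0; exists (Num.sqrt d); rewrite ?sqrtr_gt0// sqr_sqrtr// ltW.
Qed.

Lemma uhat_L2path : L2path uhat.
Proof.
split.
- exact: uhat_measurable.
- by move=> t; exact: weighted_sqr (uhat_weighted t).
- move=> t0 d /sqr_near[c c0 cd]; apply: filterS (path_cvg t0 c0) => t.
  move=> /(path_diff_Z c0)[_ h]; apply: le_trans (le_trans h cd).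
  have mn : measurable_fun setT (fun x => normc (uhat t x - uhat t0 x)).
    by apply: measurable_normc; apply: cmeasurableB; exact: uhat_measurable.
  have wn : weighted (fun x => normc (uhat t x - uhat t0 x)).
    split => //; have [_ I1] := uhat_weighted t; have [_ I2] := uhat_weighted t0.
    have := integrableRZ 2 measurableT (integrableRD measurableT I1 I2).
    apply: integrableR_le => //; first by apply: measurable_funX; exact: measurable_weight.
    move=> x _; rewrite ger0_norm ?sqr_ge0// !exprMn -mulrDr [leRHS]mulrCA.
    apply: ler_wpM2l; first exact: sqr_ge0.
    have := normcB (uhat t x) (uhat t0 x); have := normc_ge0 (uhat t x - uhat t0 x).
    by have := sqr_ge0 (normc (uhat t x) - normc (uhat t0 x)); nra.
  apply: le_Rintegral => //; [exact: weighted_sqr wn|exact: wn.2|].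
  by move=> x _; rewrite exprMn ler_peMl ?sqr_ge0// weight_ge1.
Qed.

Lemma weight_L2path : L2path (fun t x => ((1 + x ^+ 2) * upath t x)%:C).
Proof.
have mw t : cmeasurable setT (fun x : R => ((1 + x ^+ 2) * upath t x)%:C).
  by apply: cmeasurable_mk => //; apply: measurable_weight; case: (upath_weighted t).
split => //.
- move=> t; rewrite (_ : (fun x => _) = (fun x => ((1 + x ^+ 2) * upath t x) ^+ 2)).
    exact: (upath_weighted t).2.
  by apply/funext => x; rewrite normc_real real_normK ?num_real.
- move=> t0 d /sqr_near[c c0 cd]; apply: filterS (path_cvg t0 c0) => t.
  move=> /(path_diff_Z c0)[h _]; apply: le_trans (le_trans h cd).
  rewrite le_eqVlt; apply/orP; left; apply/eqP; apply: eq_Rintegral => x _.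
  by rewrite -rmorphB normc_real real_normK ?num_real// -mulrBr.
Qed.

Lemma path_bounded (f : R -> R) : continuous f -> (forall t, f (clamp T t) = f t) ->
  exists2 K, 0 <= K & forall t, f t <= K.
Proof.
move=> cf fc; have [c _ cmax] := EVT_max T0 (continuous_subspaceT cf).
exists `|f c| => // t; rewrite -fc; apply: le_trans (cmax _ (clamp_in t T0)) (ler_norm _).
Qed.

Lemma clamp_idem t : clamp T (clamp T t) = clamp T t.
Proof. exact/clamp_id/clamp_in. Qed.

Lemma upath_clamp t : upath (clamp T t) = upath t.
Proof. by rewrite /upath clamp_idem. Qed.

Lemma weight_bounded : exists2 K, 0 <= K &
  forall t, \int[mu]_x (((1 + x ^+ 2) * upath t x) ^+ 2) <= K.
Proof.
have cw := L2path_norm_continuous weight_L2path.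
have E t : \int[mu]_x (normc ((1 + x ^+ 2) * upath t x)%:C ^+ 2) =
    \int[mu]_x (((1 + x ^+ 2) * upath t x) ^+ 2).
  by apply: eq_Rintegral => x _; rewrite normc_real real_normK ?num_real.
have [|K K0 KP] := path_bounded cw; first by move=> t; rewrite upath_clamp.
by exists K => // t; rewrite -E.
Qed.

Lemma uhat_bounded : exists2 K, 0 <= K & forall t, \int[mu]_x (normc (uhat t x) ^+ 2) <= K.
Proof.
apply: (path_bounded (L2path_norm_continuous uhat_L2path)) => t.
by rewrite /uhat upath_clamp.
Qed.

(** The self-convolution of the transform; it will turn out to be the
    transform of the square of the solution. *)
Definition selfconv (t xi : R) : R[i] :=
  kap%:C * cintegral setT (fun eta => uhat t eta * uhat t (xi - eta)).

Lemma selfconv_clamp t : selfconv (clamp T t) = selfconv t.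
Proof. by rewrite /selfconv /uhat upath_clamp. Qed.

Lemma uhat_bounded_pt t : exists2 K, 0 <= K & forall xi, normc (uhat t xi) <= K.
Proof.
exists (kap * (2 * \int[mu]_x normc (toC (upath t) x))); last first.
  by move=> xi; exact/normc_fourier_le/toC_upath_integrable.
rewrite mulr_ge0 ?(ltW (kap_gt0 R))// mulr_ge0// Rintegral_ge0// => x _.
exact: normc_ge0.
Qed.

Lemma uhat_reflect_measurable t xi : cmeasurable setT (fun eta : R => uhat t (xi - eta)).
Proof.
exact: cintegrable_measurable (cintegrable_reflect xi (uhat_integrable t)).
Qed.

Lemma selfconv_integrable t xi :
  cintegrable mu setT (fun eta => uhat t eta * uhat t (xi - eta)).
Proof.
have [K K0 KP] := uhat_bounded_pt t.
apply: (@cintegrableM_bounded _ _ _ _ _ _ _ K) => //.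
- exact: uhat_measurable.
- exact: cintegrable_reflect (uhat_integrable t).
Qed.

Lemma selfconv_time_continuous xi : ccontinuous (selfconv ^~ xi).
Proof.
apply: ccontinuousM; first exact: ccontinuous_cst.
exact: (L2path_convolution_continuous uhat_L2path xi).
Qed.

Lemma selfconvE t xi :
  fourier (fun y => toC (upath t) y * inv_fourier (uhat t) y) xi = selfconv t xi.
Proof.
rewrite fourier_mul_inv_fourier//; first exact: toC_upath_integrable.
exact: uhat_integrable.
Qed.

Lemma selfconv_continuous t : ccontinuous (selfconv t).
Proof.
have -> : selfconv t = fourier (fun y => toC (upath t) y * inv_fourier (uhat t) y).
  by apply/funext => xi; rewrite selfconvE.
apply: fourier_continuous.
have Iu := uhat_integrable t.
rewrite (_ : (fun y => _) = (fun y => inv_fourier (uhat t) y * toC (upath t) y)); last first.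
  by apply/funext => y; rewrite mulrC.
apply: (@cintegrableM_bounded _ _ _ _ _ _ _ (kap * (2 * \int[mu]_x normc (uhat t x)))) => //.
- by apply: ccontinuous_measurable; exact: inv_fourier_continuous.
- by move=> y _; exact: normc_inv_fourier_le.
- exact: toC_upath_integrable.
Qed.

Lemma normc_selfconv_le t xi :
  normc (selfconv t xi) <= kap * (2 * \int[mu]_x (normc (uhat t x) ^+ 2)).
Proof.
rewrite normcM normc_real ger0_norm; last exact: ltW (kap_gt0 R).
apply: ler_wpM2l; first exact: ltW (kap_gt0 R).
have Isq := weighted_sqr (uhat_weighted t).
have Ir := integrable_reflect xi Isq.
have -> : \int[mu]_x (normc (uhat t x) ^+ 2) =
    \int[mu]_x (2^-1 * (normc (uhat t x) ^+ 2 + normc (uhat t (xi - x)) ^+ 2)).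
  rewrite (RintegralZl _ measurableT (integrableRD measurableT Isq Ir)).
  rewrite RintegralD// (Rintegral_reflect xi Isq).
  by rewrite half.
apply: normc_cintegral_le => //.
- exact: cintegrable_measurable (selfconv_integrable t xi).
- move=> x _; rewrite normcM.
  by have := sqr_ge0 (normc (uhat t x) - normc (uhat t (xi - x))); rewrite sqrrB; nra.
- exact: (integrableRZ 2^-1 measurableT (integrableRD measurableT Isq Ir)).
Qed.

Lemma selfconv_bounded : exists2 K, 0 <= K & forall t xi, normc (selfconv t xi) <= K.
Proof.
have [K K0 KP] := uhat_bounded; exists (kap * (2 * K)).
  by rewrite !mulr_ge0// ltW// kap_gt0.
move=> t xi; apply: le_trans (normc_selfconv_le t xi) _.
by rewrite ler_wpM2l ?(ltW (kap_gt0 R))// ler_wpM2l.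
Qed.

(** [u u_x = (u^2)_x / 2] on the Fourier side: symmetrizing the convolution of
    [i eta uhat] and [uhat] replaces [eta] by [xi / 2]. *)
Lemma fourier_upath_Dx t xi :
  fourier (fun y => toC (upath t) y * Dx (toC (upath t)) y) xi =
  (0 +i* (xi / 2)) * selfconv t xi.
Proof.
rewrite fourier_mul_inv_fourier; [|exact: toC_upath_integrable|exact: xuhat_integrable].
rewrite /selfconv [RHS]mulrCA; congr (_ * _).
set X := LHS.
pose g eta := (0 +i* eta) * uhat t eta * uhat t (xi - eta).
have Ig : cintegrable mu setT g.
  have [K K0 KP] := uhat_bounded_pt t.
  rewrite (_ : g = (fun eta => uhat t (xi - eta) * ((0 +i* eta) * uhat t eta))); last first.
    by apply/funext => eta; rewrite /g mulrC.
  apply: (@cintegrableM_bounded _ _ _ _ _ _ _ K) => //.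
  - exact: uhat_reflect_measurable.
  - exact: xuhat_integrable.
have XE : X = cintegral setT g by [].
have X2 : X + X = (0 +i* xi) * cintegral setT (fun eta => uhat t eta * uhat t (xi - eta)).
  rewrite {1}XE XE -{1}(cintegral_reflect xi Ig) -cintegralD//; last exact: cintegrable_reflect.
  rewrite -cintegralZ//; last exact: selfconv_integrable.
  apply: eq_cintegral => eta _; rewrite /g.
  have -> : xi - (xi - eta) = eta by ring.
  have -> : (0 +i* xi : R[i]) = (0 +i* (xi - eta)) + (0 +i* eta).
    by apply: complex_ext; rewrite /= ?addr0// subrK.
  ring.
have -> : (0 +i* (xi / 2) : R[i]) = 2^-1 * (0 +i* xi).
  have -> : (2^-1 : R[i]) = (2^-1)%:C by rewrite fmorphV rmorph_nat.
  by apply: complex_ext; rewrite ?cReM ?cImM /=; ring.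
by rewrite -mulrA -X2 half.
Qed.

End Path.

(** * The linear evolution *)

Section Multiplier.
Context (R : realType) (nu : R).
Local Notation mu := (@lebesgue_measure R).

Definition multiplier (h xi : R) : R[i] := cexp (symbol nu xi * h%:C).

Definition damping (xi : R) : R := nu * (`|xi| ^+ 3 - `|xi|).

Lemma multiplierE h xi : multiplier h xi =
  cexp ((- (damping xi * h)) +i* (xi * `|xi| * h)).
Proof.
congr cexp; apply: complex_ext; rewrite ?cReM ?cImM /= mulr0.
  by rewrite subr0 /damping; ring.
by rewrite add0r.
Qed.

Lemma normc_multiplier h xi : normc (multiplier h xi) = expR (- (damping xi * h)).
Proof. by rewrite multiplierE normc_cexp. Qed.

Lemma multiplierD s t xi : multiplier (s + t) xi = multiplier s xi * multiplier t xi.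
Proof. by rewrite /multiplier -cexpD -mulrDr -rmorphD. Qed.

Lemma Sgroup_multiplier t g x :
  Sgroup nu t g x = inv_fourier (fun xi => multiplier t xi * fourier g xi) x.
Proof. by []. Qed.

Lemma ccontinuous_multiplier_space h : ccontinuous (multiplier h).
Proof.
have -> : multiplier h = (fun xi => cexp ((- (damping xi * h)) +i* (xi * `|xi| * h))).
  by apply/funext => xi; exact: multiplierE.
have cn : continuous (fun xi : R => `|xi|) by move=> x; exact: norm_continuous.
apply: ccontinuous_cexp; split => /=.
- apply: continuousNR; apply: continuousMR; last exact: continuous_cstR.
  apply: continuousMR; first exact: continuous_cstR.
  apply: continuousBR => //.
  by apply: (continuous_compR (g := fun y => y ^+ 3) cn) => y; exact: exprn_continuous.
- apply: continuousMR; last exact: continuous_cstR.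
  by apply: continuousMR => //; exact: continuous_idR.
Qed.

Lemma ccontinuous_multiplier_time t xi : ccontinuous (fun tau => multiplier (t - tau) xi).
Proof.
have -> : (fun tau => multiplier (t - tau) xi) =
    (fun tau => cexp ((- (damping xi * (t - tau))) +i* (xi * `|xi| * (t - tau)))).
  by apply/funext => tau; exact: multiplierE.
have ct : continuous (fun tau : R => t - tau).
  by apply: continuousBR; [exact: continuous_cstR|exact: continuous_idR].
apply: ccontinuous_cexp; split => /=.
- by apply: continuousNR; apply: continuousMR => //; exact: continuous_cstR.
- by apply: continuousMR => //; exact: continuous_cstR.
Qed.

Hypothesis nu0 : 0 < nu.

Lemma damping_ge xi : - nu <= damping xi.
Proof.
rewrite /damping -{1}(mulrN1 nu) ler_pM2l//.
have := normr_ge0 xi; move: `|xi| => x x0.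
by have := mulr_ge0 x0 (sqr_ge0 (x - 1)); have := sqr_ge0 (x - 1); have := sqr_ge0 x; nra.
Qed.

Lemma normc_multiplier_le T h xi : 0 <= h <= T -> normc (multiplier h xi) <= expR (nu * T).
Proof.
move=> /andP[h0 hT]; rewrite normc_multiplier ler_expR.
have h1 : nu * h <= nu * T by rewrite ler_pM2l.
have h2 : 0 <= (damping xi + nu) * h.
  by rewrite mulr_ge0// -lerBlDr sub0r damping_ge.
lra.
Qed.

Lemma integral_exp_decay (p s t : R) : s <= t ->
  (\int[mu]_(tau in `[s, t]) (p * expR (- (p * (t - tau))))%:E)%E =
  (1 - expR (- (p * (t - s))))%:E.
Proof.
rewrite le_eqVlt => /predU1P[->|st].
  by rewrite set_itv1 integral_set1 subrr mulr0 oppr0 expR0 subrr.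
pose F tau : R := expR (- (p * (t - tau))).
have dF (x : R) : is_derive x 1 F (p * expR (- (p * (t - x)))).
  by rewrite /F; apply: is_derive_eq; rewrite /GRing.scale/=; ring.
have cF : continuous F.
  by move=> x; apply: differentiable_continuous; apply/derivable1_diffP; exact: ex_derive.
rewrite (@continuous_FTC2 R _ F)//.
- by rewrite /F subrr mulr0 oppr0 expR0.
- apply: continuous_subspaceT; apply: continuousMR => //; exact: continuous_cstR.
- split; first by move=> x _; exact: ex_derive.
    by apply: cvg_at_right_filter; exact: cF.
  by apply: cvg_at_left_filter; exact: cF.
- by move=> x _; rewrite derive1E derive_val.
Qed.

(** Both terms come from [smoothing_bound]: [2 / nu] from the exact integral of
    the damping, the other one from the constant 3 in its pointwise bound and the
    growth of the multiplier at low frequencies. *)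
Definition smoothing_constant (T : R) : R := 3 * T * expR (nu * T) + 2 / nu.

Lemma smoothing_constant_ge0 T : 0 <= T -> 0 <= smoothing_constant T.
Proof.
by move=> T0; rewrite addr_ge0 ?divr_ge0 ?mulr_ge0 ?expR_ge0 // ltW.
Qed.

Lemma continuous_measurable_itv (f : R -> R) (s t : R) : continuous f ->
  measurable_fun `[s, t] f.
Proof. by move=> cf; apply: measurable_funTS; exact: continuous_measurable_fun. Qed.

Lemma integrable_cst_itv (s t c : R) : mu.-integrable `[s, t] (EFin \o (fun=> c)).
Proof.
apply: (@continuous_compact_integrable _ (fun=> c)); first exact: segment_compact.
by apply: continuous_subspaceT; exact: continuous_cstR.
Qed.

Lemma Rintegral_cst_itv (s t c : R) : s <= t ->
  \int[mu]_(x in `[s, t]) c = c * (t - s).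
Proof.
move=> st; rewrite Rintegral_cst//= lebesgue_measure_itv/= lte_fin.
by move: st; rewrite le_eqVlt => /predU1P[->|->//]; rewrite ltxx subrr.
Qed.

Lemma continuous_integrable_itv (f : R -> R) (s t : R) : continuous f ->
  mu.-integrable `[s, t] (EFin \o f).
Proof.
move=> cf; apply: continuous_compact_integrable; first exact: segment_compact.
exact: continuous_subspaceT.
Qed.

(** Parabolic smoothing: the dissipation of order three regains three powers
    of the frequency after integration in time, since
    [(1 + xi^2) `|xi|] is at most [3 + 2 (`|xi|^3 - `|xi|)]. *)
Lemma smoothing_bound T s t xi : 0 <= s <= t -> t <= T ->
  (\int[mu]_(tau in `[s, t]) (`|xi| * normc (multiplier (t - tau) xi))%:E <=
   (smoothing_constant T / (1 + xi ^+ 2))%:E)%E.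
Proof.
move=> /andP[s0 st] tT; have T0 : 0 <= T by apply: le_trans tT; exact: le_trans st.
have q0 : 0 < 1 + xi ^+ 2 by rewrite ltr_wpDr ?sqr_ge0.
set p := damping xi.
pose h tau : R := 3 * expR (nu * T) + 2 / nu * (p * expR (- (p * (t - tau)))).
have xx : `|xi| ^+ 2 = xi ^+ 2 by rewrite real_normK ?num_real.
have hb tau : tau \in `[s, t] ->
    (1 + xi ^+ 2) * (`|xi| * normc (multiplier (t - tau) xi)) <= h tau.
  move=> tst; have /andP[stau taut] : s <= tau <= t by move: tst; rewrite in_itv.
  have e1 : expR (- (p * (t - tau))) <= expR (nu * T).
    rewrite -normc_multiplier; apply: normc_multiplier_le.
    by rewrite subr_ge0 taut /= lerBlDr (le_trans tT)// lerDl (le_trans s0).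
  rewrite normc_multiplier -/p /h.
  have e0 := expR_ge0 (- (p * (t - tau))).
  move: (expR _) (expR _) e0 e1 => e2 e1 ? ?.
  have -> : 2 / nu * (p * e1) = 2 * (`|xi| ^+ 3 - `|xi|) * e1.
    by rewrite /p /damping; field; rewrite gt_eqF.
  have key : (1 + xi ^+ 2) * `|xi| <= 3 + 2 * (`|xi| ^+ 3 - `|xi|).
    rewrite -xx; have := normr_ge0 xi; move: `|xi| => x x0.
    by have := mulr_ge0 (addr_ge0 x0 (ler0n _ 2)) (sqr_ge0 (x - 1)); rewrite sqrrB; nra.
  rewrite mulrA; apply: (@le_trans _ _ ((3 + 2 * (`|xi| ^+ 3 - `|xi|)) * e1)).
    exact: ler_wpM2r.
  by rewrite mulrDl lerD2r ler_pM2l.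
have ct : continuous (fun tau : R => expR (- (p * (t - tau)))).
  move=> x; apply: continuous_comp; last exact: continuous_expR.
  apply: cvgN; apply: cvgM; first exact: cvg_cst.
  by apply: cvgB; [exact: cvg_cst|exact: cvg_id].
rewrite mulrC EFinM -lee_pdivrMl ?invr_gt0// invrK.
rewrite -ge0_integralZl//; last 3 first.
- apply/measurable_EFinP; apply: measurable_funM => //.
  apply: measurable_normc; case: (ccontinuous_multiplier_time t xi) => c1 c2.
  by split; exact: continuous_measurable_itv.
- by move=> x _; rewrite lee_fin mulr_ge0// normc_ge0.
- by rewrite lee_fin ltW.
have Ip : mu.-integrable `[s, t] (EFin \o (fun tau => p * expR (- (p * (t - tau))))).
  by apply: continuous_integrable_itv; apply: continuousMR => //; exact: continuous_cstR.
have Ih : mu.-integrable `[s, t] (EFin \o h).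
  apply: integrableRD => //; first exact: integrable_cst_itv.
  exact: integrableRZ.
apply: (@le_trans _ _ (\int[mu]_(tau in `[s, t]) (h tau)%:E)%E).
  apply: ge0_le_integral => //.
  - by move=> x _; rewrite -EFinM lee_fin !mulr_ge0// ?normc_ge0// ltW.
  - apply/measurable_EFinP; apply: measurable_funM => //; apply: measurable_funM => //.
    apply: measurable_normc; case: (ccontinuous_multiplier_time t xi) => c1 c2.
    by split; exact: continuous_measurable_itv.
  - exact: measurable_int Ih.
rewrite -EFin_Rintegral// lee_fin RintegralD//; [|exact: integrable_cst_itv|exact: integrableRZ].
rewrite Rintegral_cst_itv// (RintegralZl _ _ Ip)//.
rewrite (_ : \int[mu]_(tau in `[s, t]) _ = 1 - expR (- (p * (t - s)))); last first.
  by rewrite /Rintegral integral_exp_decay.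
rewrite /smoothing_constant lerD//.
  rewrite [leRHS]mulrAC ler_wpM2l ?mulr_ge0 ?expR_ge0//.
  by rewrite lerBlDr (le_trans tT)// lerDl.
by rewrite ler_piMr ?divr_ge0// ?ltW// gerBl expR_ge0.
Qed.

End Multiplier.

(** * The integral equation on the Fourier side *)

Local Opaque multiplier selfconv.

Section Duhamel.
Context (R : realType).
Local Notation mu := (@lebesgue_measure R).
Local Notation kap := ((Num.sqrt (2 * pi))^-1 : R).
Variables (nu T : R) (phi : R -> R) (u : R -> R -> R).
Hypotheses (nu0 : 0 < nu) (T0 : 0 <= T) (cu : continuous_in_Zdot T 2 2 u).
Local Notation J := (selfconv T u).
Local Notation a := (uhat T u).
Local Notation F := (multiplier nu).

Definition duhamel (s t xi : R) : R[i] :=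
  cintegral `[s, t] (fun tau => F (t - tau) xi * J tau xi).

Lemma duhamel_integrand_continuous t xi :
  ccontinuous (fun tau => F (t - tau) xi * J tau xi).
Proof.
apply: ccontinuousM; first exact: ccontinuous_multiplier_time.
exact: selfconv_time_continuous.
Qed.

Lemma ccontinuous_integrable_itv (g : R -> R[i]) (s t : R) : ccontinuous g ->
  cintegrable mu `[s, t] g.
Proof. by move=> [g1 g2]; split; exact: continuous_integrable_itv. Qed.

Lemma duhamel_integrable s t t' xi :
  cintegrable mu `[s, t] (fun tau => F (t' - tau) xi * J tau xi).
Proof. exact/ccontinuous_integrable_itv/duhamel_integrand_continuous. Qed.

Lemma itv_time s t tau : 0 <= s -> t <= T -> tau \in `[s, t] -> 0 <= t - tau <= T.
Proof.
rewrite in_itv/= => s0 tT /andP[h1 h2].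
by rewrite subr_ge0 h2 lerBlDr (le_trans tT)// lerDl (le_trans s0).
Qed.

Lemma duhamel_continuous s t : 0 <= s -> t <= T -> ccontinuous (duhamel s t).
Proof.
move=> s0 tT; have [K K0 KP] := selfconv_bounded T0 cu.
apply: (@cintegral_continuous R `[s, t] _ (fun=> expR (nu * T) * K)) => //.
- by move=> xi; exact: cintegrable_measurable (duhamel_integrable _ _ _ _).
- move=> tau _; apply: ccontinuousM; first exact: ccontinuous_multiplier_space.
  exact: selfconv_continuous.
- exact: integrable_cst_itv.
- move=> xi tau tst; rewrite normcM ler_pM ?normc_ge0//.
  by apply: normc_multiplier_le => //; exact: itv_time tst.
Qed.

(** The integrand of the Duhamel term, extended by zero to all times so that
    Fubini's theorem can be applied on the plane. *)
Let Phi t (z : R * R) : R[i] :=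
  if z.1 \in `[0, t] then F (t - z.1) z.2 * ((0 +i* (z.2 / 2)) * J z.1 z.2) else 0.

Let cmeasurable_selfconv : cmeasurable setT (fun z : R * R => J z.1 z.2).
Proof.
split.
- apply: (caratheodory_measurable (F := fun x y => cRe (J x y))).
    by move=> y; case: (selfconv_time_continuous T0 cu y).
  by move=> x; case: (ccontinuous_measurable (selfconv_continuous T0 cu x)).
- apply: (caratheodory_measurable (F := fun x y => cIm (J x y))).
    by move=> y; case: (selfconv_time_continuous T0 cu y).
  by move=> x; case: (ccontinuous_measurable (selfconv_continuous T0 cu x)).
Qed.

Let cmeasurable_multiplier t : cmeasurable setT (fun z : R * R => F (t - z.1) z.2).
Proof.
split.
- apply: (caratheodory_measurable (F := fun x y => cRe (F (t - x) y))).
    by move=> y; case: (ccontinuous_multiplier_time nu t y).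
  by move=> x; case: (ccontinuous_measurable (ccontinuous_multiplier_space nu (t - x))).
- apply: (caratheodory_measurable (F := fun x y => cIm (F (t - x) y))).
    by move=> y; case: (ccontinuous_multiplier_time nu t y).
  by move=> x; case: (ccontinuous_measurable (ccontinuous_multiplier_space nu (t - x))).
Qed.

Let Phi_measurable t : cmeasurable setT (Phi t).
Proof.
have -> : Phi t = (fun z => (\1_(`[0, t]%classic) z.1)%:C *
    (F (t - z.1) z.2 * ((0 +i* (z.2 / 2)) * J z.1 z.2))).
  apply/funext => z; rewrite /Phi indicE mem_setE.
  by case: ifP => _; rewrite ?rmorph1 ?mul1r// rmorph0 mul0r.
apply: cmeasurableM.
  apply: cmeasurable_mk => //.
  by apply: (measurableT_comp _ measurable_fst); exact: measurable_indic.
apply: cmeasurableM; first exact: cmeasurable_multiplier.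
apply: cmeasurableM => //.
apply: cmeasurable_mk => //; apply: measurable_funM => //; exact: measurable_snd.
Qed.

Let Phi_le K t z : (forall s xi, normc (J s xi) <= K) ->
  normc (Phi t z) <= K / 2 * (`|z.2| * normc (F (t - z.1) z.2)) /\
  (z.1 \notin `[0, t] -> normc (Phi t z) = 0).
Proof.
move=> KP; rewrite /Phi; case: ifPn => zt; split => //.
- rewrite normcM normcM normc_imag normrM [`|2^-1|]ger0_norm//.
  have := KP z.1 z.2; have := normc_ge0 (J z.1 z.2); have := normc_ge0 (F (t - z.1) z.2).
  move: (normc (F _ _)) (normc (J _ _)) (normr_ge0 z.2) => f j; move: `|z.2| => x x0 f0 j0 jK.
  have -> : f * (x / 2 * j) = x * f / 2 * j by ring.
  have -> : K / 2 * (x * f) = x * f / 2 * K by ring.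
  by apply: ler_wpM2l => //; rewrite divr_ge0// mulr_ge0.
- rewrite ComplexField.Normc.normc0 mulr_ge0//; last by rewrite mulr_ge0// normc_ge0.
  by rewrite divr_ge0// (le_trans _ (KP 0 0))// normc_ge0.
- by move=> _; rewrite ComplexField.Normc.normc0.
Qed.

Let Phi_integral_le K t xi : 0 <= t <= T -> (forall s xi, normc (J s xi) <= K) ->
  (\int[mu]_tau (normc (Phi t (tau, xi)))%:E <=
   (K / 2 * (smoothing_constant nu T / (1 + xi ^+ 2)))%:E)%E.
Proof.
move=> /andP[t0 tT] KP.
have K20 : 0 <= K / 2 by rewrite divr_ge0// (le_trans _ (KP 0 0))// normc_ge0.
have mn : measurable_fun setT (fun tau : R => `|xi| * normc (F (t - tau) xi)).
  apply: measurable_funM => //; apply: measurable_normc.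
  by apply: ccontinuous_measurable; exact: ccontinuous_multiplier_time.
have mP : measurable_fun setT (fun tau => normc (Phi t (tau, xi))).
  exact: (measurableT_comp (measurable_normc (Phi_measurable t)) (measurable_pair2 xi)).
apply: (@le_trans _ _ (\int[mu]_(tau in `[0%R, t])
    (K / 2 * (`|xi| * normc (F (t - tau) xi)))%:E)%E).
  rewrite [leRHS]integral_mkcond; apply: ge0_le_integral => //.
  - by move=> x _; rewrite lee_fin normc_ge0.
  - exact/measurable_EFinP.
  - apply/(measurable_restrictT _ _).1 => //; apply/measurable_EFinP.
    by apply: measurable_funTS; exact: measurable_funM.
  - move=> x _; rewrite patchE mem_setE; have [h1 h2] := Phi_le t (x, xi) KP.
    by case: ifPn => [_|/h2 ->]; rewrite ?lee_fin.
under eq_integral do rewrite EFinM.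
rewrite ge0_integralZl//; last 2 first.
- by apply/measurable_EFinP; exact: measurable_funTS.
- by move=> x _; rewrite lee_fin mulr_ge0// normc_ge0.
rewrite [leRHS]EFinM lee_wpmul2l ?lee_fin//.
by apply: smoothing_bound => //; rewrite lexx.
Qed.

Let integrable_smoothing C :
  mu.-integrable setT (EFin \o (fun xi : R => C * (smoothing_constant nu T / (1 + xi ^+ 2)))).
Proof.
have := integrableRZ (C * smoothing_constant nu T) measurableT (@integrable_inv1sqr R).
by apply: eq_integrable => // x _ /=; rewrite mulrA.
Qed.

Let Phi_integrable t : 0 <= t <= T -> cintegrable (mu \x mu)%E setT (Phi t).
Proof.
move=> tT; have [K K0 KP] := selfconv_bounded T0 cu.
have In : (mu \x mu)%E.-integrable setT (EFin \o (fun z => normc (Phi t z))).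
  apply/integrable21ltyP.
    by apply/measurable_EFinP; exact: (measurable_normc (Phi_measurable t)).
  apply: (@le_lt_trans _ _ (\int[mu]_xi (K / 2 * (smoothing_constant nu T / (1 + xi ^+ 2)))%:E)%E).
    apply: ge0_le_integral => //.
    - by move=> xi _; exact: integral_ge0.
    - apply: (measurable_fun_fubini_tonelli_G (m1 := mu) (fun z => `|(normc (Phi t z))%:E|%E)) => //.
      apply: measurableT_comp => //; apply/measurable_EFinP.
      exact: (measurable_normc (Phi_measurable t)).
    - exact: measurable_int (integrable_smoothing _).
    - move=> xi _; under eq_integral do rewrite /= ger0_norm ?normc_ge0//.
      exact: Phi_integral_le.
  have := integrable_fin_num measurableT (integrable_smoothing (K / 2)).
  by move=> /fineK /= <-; rewrite ltry.
exact: (@cintegrable_le _ _ R (mu \x mu)%E setT (Phi t) (fun z => normc (Phi t z))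
  measurableT (Phi_measurable t) (fun z _ => lexx _) In).
Qed.

Let inner_Phi t xi :
  cintegral setT (fun tau => Phi t (tau, xi)) = (0 +i* (xi / 2)) * duhamel 0 t xi.
Proof.
rewrite /duhamel -cintegralZ//; last exact: duhamel_integrable.
rewrite [RHS]cintegral_mkcond; apply: eq_cintegral => tau _.
by rewrite /Phi mem_setE; case: ifP => // _; rewrite mulrCA.
Qed.

(** The derivative in the nonlinear term costs one power of the frequency and
    [smoothing_bound] regains it together with two more: the Duhamel term is
    both integrable and square integrable in [xi]. *)
Lemma duhamel_le K s t xi : (forall r, r \in `[s, t] -> normc (J r xi) <= K) ->
  0 <= s -> s <= t -> t <= T -> 0 <= K ->
  normc ((0 +i* (xi / 2)) * duhamel s t xi) <= K * (smoothing_constant nu T / (1 + xi ^+ 2)).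
Proof.
move=> KP s0 st tT K0; rewrite normcM normc_imag normrM [`|2^-1|]ger0_norm//.
have cF : continuous (fun tau : R => `|xi| * normc (F (t - tau) xi)).
  apply: continuousMR; first exact: continuous_cstR.
  have -> : (fun tau => normc (F (t - tau) xi)) =
      (fun tau => expR (- (damping nu xi * (t - tau)))).
    by apply/funext => tau; rewrite normc_multiplier.
  apply: (continuous_compR (f := fun tau => - (damping nu xi * (t - tau)))); last exact: continuous_expR.
  apply: continuousNR; apply: continuousMR; first exact: continuous_cstR.
  by apply: continuousBR; [exact: continuous_cstR|exact: continuous_idR].
have IF := continuous_integrable_itv s t cF.
have : normc (`|xi|%:C * duhamel s t xi) <=
    2 * \int[mu]_(tau in `[s, t]) (K * (`|xi| * normc (F (t - tau) xi))).
  rewrite /duhamel -cintegralZ//; last exact: duhamel_integrable.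
  apply: normc_cintegral_le => //.
  - apply: cmeasurableM; first exact: cmeasurable_cst.
    exact: cintegrable_measurable (duhamel_integrable _ _ _ _).
  - move=> tau tst; rewrite normcM normcM normc_real normr_id.
    rewrite mulrA mulrC ler_wpM2r ?mulr_ge0 ?normc_ge0//.
    exact: KP.
  - exact: integrableRZ.
rewrite normcM normc_real normr_id (RintegralZl _ _ IF)// => h.
have s1 : \int[mu]_(tau in `[s, t]) (`|xi| * normc (F (t - tau) xi)) <=
    smoothing_constant nu T / (1 + xi ^+ 2).
  rewrite -lee_fin EFin_Rintegral//.
  by apply: smoothing_bound => //; rewrite s0.
have -> : `|xi| / 2 * normc (duhamel s t xi) = 2^-1 * (`|xi| * normc (duhamel s t xi)) by ring.
by rewrite ler_pdivrMl//; apply: (le_trans h); rewrite ler_pM2l// ler_wpM2l.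
Qed.

Hypotheses (Zphi : Zdot 2 2 phi) (sol : is_solution nu T phi u).

Lemma initial_uhat : fourier (toC phi) = a 0.
Proof.
have t00 : 0 \in `[0, T] by rewrite in_itv/= lexx.
apply/funext => xi; rewrite /uhat !fourierE; congr (_ * _).
have Ip : mu.-integrable setT (EFin \o phi).
  by apply: weighted_integrable; apply: Z22_weighted; case: Zphi.
apply: ae_eq_cintegral => //.
- exact: cintegrable_measurable (fourier_integrand _ (toC_integrable Ip)).
- exact: cintegrable_measurable (fourier_integrand _ (toC_upath_integrable T0 cu 0)).
- by apply: ae_imp sol.1 => x ux _; rewrite /toC (upath_id u t00) ux.
Qed.

Let solution_hat t xi : R[i] := F t xi * a 0 xi - (0 +i* (xi / 2)) * duhamel 0 t xi.

Let linear_part_integrable t : 0 <= t <= T ->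
  cintegrable mu setT (fun xi => F t xi * a 0 xi).
Proof.
move=> tT; apply: (@cintegrableM_bounded _ _ _ _ _ _ _ (expR (nu * T))) => //.
- exact/ccontinuous_measurable/ccontinuous_multiplier_space.
- by move=> xi _; exact: normc_multiplier_le.
- exact: uhat_integrable.
Qed.

Let duhamel_part_continuous t : 0 <= t <= T ->
  ccontinuous (fun xi => (0 +i* (xi / 2)) * duhamel 0 t xi).
Proof.
move=> /andP[t0 tT]; apply: ccontinuousM; last exact: duhamel_continuous.
split => /=; first exact: continuous_cstR.
by apply: continuousMR; [exact: continuous_idR|exact: continuous_cstR].
Qed.

Let duhamel_part_integrable t : 0 <= t <= T ->
  cintegrable mu setT (fun xi => (0 +i* (xi / 2)) * duhamel 0 t xi).
Proof.
move=> tT; have [K K0 KP] := selfconv_bounded T0 cu.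
apply: (cintegrable_le measurableT _ _ (integrable_smoothing K)).
  exact/ccontinuous_measurable/duhamel_part_continuous.
by case/andP: tT => t0 tT xi _; exact: duhamel_le.
Qed.

Let solution_physical t : t \in `[0, T] ->
  {ae mu, forall x, toC (upath T u t) x = inv_fourier (solution_hat t) x}.
Proof.
move=> tin; have tT : 0 <= t <= T by move: tin; rewrite in_itv.
have := sol.2 t tin; apply: ae_imp => x; rewrite /toC (upath_id u tin) => ->.
have -> : inv_fourier (solution_hat t) x = inv_fourier (fun xi => F t xi * a 0 xi) x -
    inv_fourier (fun xi => (0 +i* (xi / 2)) * duhamel 0 t xi) x.
  rewrite !inv_fourierE -mulrBr -cintegralB//.
  - by congr (_ * _); apply: eq_cintegral => xi _; rewrite -mulrBr.
  - exact: inv_fourier_integrand (linear_part_integrable tT).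
  - exact: inv_fourier_integrand (duhamel_part_integrable tT).
rewrite -[fun y => (phi y)%:C]/(toC phi) {1}Sgroup_multiplier initial_uhat.
suff -> : cintegral `[0, t] (fun tau => Sgroup nu (t - tau)
    (fun y => toC (u tau) y * Dx (toC (u tau)) y) x) =
  inv_fourier (fun xi => (0 +i* (xi / 2)) * duhamel 0 t xi) x by [].
pose G (z : R * R) := expi (x * z.2) * Phi t z.
have IG : cintegrable (mu \x mu)%E setT G.
  apply: (@cintegrableM_bounded _ _ _ _ _ _ _ 1) => //.
  - by apply: cmeasurable_expi; apply: measurable_funM => //; exact: measurable_snd.
  - by move=> z _; rewrite normc_expi.
  - exact: Phi_integrable.
transitivity (kap%:C * cintegral setT (fun tau => cintegral setT (fun xi => G (tau, xi)))).
  rewrite -(cintegralZ kap%:C measurableT (cintegrable_inner1 IG)).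
  rewrite cintegral_mkcond; apply: eq_cintegral => tau _; rewrite mem_setE.
  case: ifPn => tt; last first.
    rewrite (eq_cintegral (g := fun=> 0)) ?cintegral0 ?mulr0// => xi _.
    by rewrite /G /Phi /= (negbTE tt) mulr0.
  rewrite Sgroup_multiplier inv_fourierE; congr (_ * _); apply: eq_cintegral => xi _.
  rewrite /G /Phi /= tt; congr (_ * (_ * _)).
  have tauT : tau \in `[0, T].
    move: tt; rewrite !in_itv/= => /andP[-> h]; rewrite (le_trans h)//.
    by case/andP: tT.
  by rewrite -(upath_id u tauT) fourier_upath_Dx.
rewrite cintegral_Fubini// inv_fourierE; congr (_ * _).
apply: eq_cintegral => xi _; rewrite -inner_Phi -cintegralZ//.
rewrite (_ : (fun tau => _) = (fun tau => if tau \in `[0, t]%classic then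
    F (t - tau) xi * ((0 +i* (xi / 2)) * J tau xi) else 0)); last first.
  by apply/funext => tau; rewrite /Phi mem_setE.
apply: (@cintegrable_mkcond R `[0, t]%classic _ _).1 => //.
apply: ccontinuous_integrable_itv.
apply: ccontinuousM; first exact: ccontinuous_multiplier_time.
by apply: ccontinuousM; [exact: ccontinuous_cst|exact: selfconv_time_continuous].
Qed.

Theorem uhat_duhamel0 t xi : t \in `[0, T] ->
  a t xi = F t xi * a 0 xi - (0 +i* (xi / 2)) * duhamel 0 t xi.
Proof.
move=> tin; have tT : 0 <= t <= T by move: tin; rewrite in_itv.
have cg : ccontinuous (solution_hat t).
  apply: ccontinuousB; last exact: duhamel_part_continuous.
  by apply: ccontinuousM; [exact: ccontinuous_multiplier_space|exact: uhat_continuous].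
have Ig : cintegrable mu setT (solution_hat t).
  by apply: cintegrableB => //; [exact: linear_part_integrable|exact: duhamel_part_integrable].
exact: (fourier_inversion (toC_upath_integrable T0 cu t) Ig cg (solution_physical tin) xi).
Qed.

Lemma upath_inv_fourier t : t \in `[0, T] ->
  {ae mu, forall x, toC (upath T u t) x = inv_fourier (a t) x}.
Proof.
move=> tin; have -> : a t = solution_hat t by apply/funext => xi; exact: uhat_duhamel0.
exact: solution_physical.
Qed.

(** Subtracting the equations at the times [t] and [s], the semigroup law
    [multiplierD] absorbs the history before [s]. *)
Theorem uhat_duhamel s t xi : 0 <= s -> s <= t -> t <= T ->
  a t xi = F (t - s) xi * a s xi - (0 +i* (xi / 2)) * duhamel s t xi.
Proof.
move=> s0 st tT.
have tin : t \in `[0, T] by rewrite in_itv/= (le_trans s0).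
have sin : s \in `[0, T] by rewrite in_itv/= s0 (le_trans st).
rewrite (uhat_duhamel0 xi tin) (uhat_duhamel0 xi sin) -{1}(subrK s t) multiplierD.
suff -> : duhamel 0 t xi = F (t - s) xi * duhamel 0 s xi + duhamel s t xi by ring.
have Is := duhamel_integrable 0 s s xi.
rewrite /duhamel -cintegralZ//.
have -> : cintegral `[0, s] (fun tau => F (t - s) xi * (F (s - tau) xi * J tau xi)) =
    cintegral `[0, s] (fun tau => F (t - tau) xi * J tau xi).
  apply: eq_cintegral => tau _; rewrite mulrA -multiplierD.
  by have -> : t - s + (s - tau) = t - tau by ring.
have [c1 c2] := duhamel_integrand_continuous t xi.
have split_itv (f : R -> R) : continuous f -> \int[mu]_(x in `[0, t]) f x =
    \int[mu]_(x in `[0, s]) f x + \int[mu]_(x in `[s, t]) f x.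
  move=> cf; have If := continuous_integrable_itv 0 t cf.
  have := @Rintegral_itvB R f (BLeft 0) (BRight t) s If.
  rewrite !bnd_simp => /(_ s0 st) E.
  rewrite -(Rintegral_itv_obnd_cbnd (r := s)); last first.
    have := continuous_integrable_itv s t cf; apply: integrableS => //.
    by apply: subset_itvr; rewrite bnd_simp.
  by rewrite -E addrC subrK.
by apply: complex_ext; rewrite ?cReD ?cImD /=; exact: split_itv.
Qed.

(** As the solution is the inverse transform of its transform, the product rule
    [fourier_mul_inv_fourier] applies to its square. *)
Lemma selfconv_fourier_sqr t xi : t \in `[0, T] ->
  J t xi = fourier (toC (fun x => upath T u t x ^+ 2)) xi.
Proof.
move=> tin; rewrite -selfconvE// !fourierE; congr (_ * _).
have Isq := weighted_sqr (upath_weighted T0 cu t).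
apply: ae_eq_cintegral => //.
- apply: cmeasurableM.
    by apply: cmeasurable_expi; apply: measurableT_comp => //; exact: measurable_phase.
  apply: cmeasurableM; first exact: cintegrable_measurable (toC_upath_integrable T0 cu t).
  by apply: ccontinuous_measurable; apply: inv_fourier_continuous; exact: uhat_integrable.
- exact: cintegrable_measurable (fourier_integrand _ (toC_integrable Isq)).
- apply: ae_imp (upath_inv_fourier tin) => x <- _; congr (_ * _).
  by rewrite /toC -rmorphM expr2.
Qed.

End Duhamel.

(** * Low frequencies *)

Section LowFrequency.
Context (R : realType).
Local Notation mu := (@lebesgue_measure R).
Implicit Types (f : R -> R) (x y : R).

Lemma norm_sin_le y : `|sin y| <= `|y|.
Proof.
have pos (z : R) : 0 < z -> `|sin z| <= z.
  move=> z0; have D x : x \in `]0, z[%R -> is_derive x (1 : R) sin (cos x).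
    by move=> _; exact: is_derive_sin.
  have [c _] := @MVT R sin cos 0 z z0 D (continuous_subspaceT (@continuous_sin R)).
  rewrite sin0 !subr0 => ->; rewrite normrM (gtr0_norm z0).
  by rewrite ler_piMl ?cos_max// ltW.
have [y0|y0|->] := ltgtP y 0; last by rewrite sin0.
- have ny : 0 < - y by rewrite oppr_gt0.
  by have := pos _ ny; rewrite sinN normrN (ltr0_norm y0).
- by rewrite (gtr0_norm y0) pos.
Qed.

Lemma one_sub_cos_ge0 y : 0 <= 1 - cos y.
Proof. by rewrite subr_ge0 cos_le1. Qed.

Lemma one_sub_cos_le_sqr y : 1 - cos y <= y ^+ 2 / 2.
Proof.
have -> : cos y = 1 - 2 * sin (y / 2) ^+ 2.
  have {1}-> : y = (y / 2) *+ 2 by rewrite -mulr_natr divfK.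
  by rewrite cos_mulr2n cos2sin2 -mulr_natl; ring.
have := norm_sin_le (y / 2); rewrite normrM => h.
have : `|sin (y / 2)| ^+ 2 <= (`|y| * `|2^-1|) ^+ 2 by rewrite lerXn2r ?nnegrE ?mulr_ge0.
rewrite exprMn !real_normK ?num_real//; lra.
Qed.

Lemma one_sub_cos_le y : 1 - cos y <= `|y|.
Proof.
have := one_sub_cos_le_sqr y; have := cos_geN1 y.
rewrite -(real_normK (num_real y)); have := normr_ge0 y; move: `|y| => z z0.
have [z2|z2] := leP z 2; nra.
Qed.

(** [sin 2y - 2 sin y = - 2 sin y (1 - cos y)]: the linear part of the sine
    cancels. *)
Lemma sin_diff_le y : `|sin (2 * y) - 2 * sin y| <= `|y| ^+ 3.
Proof.
have -> : sin (2 * y) - 2 * sin y = - (2 * sin y * (1 - cos y)).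
  by rewrite mulr_natl sin_mulr2n -mulr_natl; ring.
rewrite normrN !normrM ger0_norm// (ger0_norm (one_sub_cos_ge0 y)).
have := one_sub_cos_le_sqr y; have := one_sub_cos_ge0 y; have := norm_sin_le y.
rewrite -(real_normK (num_real y)); have := normr_ge0 (sin y); have := normr_ge0 y.
move: `|y| `|sin y| (1 - cos y) => z s c z0 s0 sz c0 cz.
have h1 : s * c <= z * c by rewrite ler_wpM2r.
have h2 : z * c <= z * (z ^+ 2 / 2) by rewrite ler_wpM2l.
by rewrite exprSr -mulrA; nra.
Qed.

Lemma sin_diff_le4 y : `|sin (2 * y) - 2 * sin y| <= 4.
Proof.
rewrite (le_trans (ler_normB _ _))// normrM ger0_norm//.
by have := sin_max (2 * y); have := sin_max y; lra.
Qed.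

Lemma cos_diff_le y : `|cos (2 * y) - cos y| <= 3 * y ^+ 2.
Proof.
have := one_sub_cos_le_sqr y; have := one_sub_cos_ge0 y.
have := one_sub_cos_le_sqr (2 * y); have := one_sub_cos_ge0 (2 * y).
rewrite exprMn => ? ? ? ?; have := sqr_ge0 y.
by rewrite ler_norml => ?; apply/andP; split; lra.
Qed.

Definition sin_transform f (xi : R) : R := \int[mu]_x (f x * sin (x * xi)).
Definition cos_transform f (xi : R) : R := \int[mu]_x (f x * cos (x * xi)).

Lemma integrable_sin f xi : mu.-integrable setT (EFin \o f) ->
  mu.-integrable setT (EFin \o (fun x => f x * sin (x * xi))).
Proof.
move=> If; have mf := integrableR_measurable If.
apply: (integrableR_le measurableT _ _ (integrableR_norm measurableT If)).
  apply: measurable_funM; first exact: mf.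
  by apply: continuous_line_measurable; exact: continuous_sinM.
by move=> x _; rewrite normrM ler_piMr// sin_max.
Qed.

Lemma integrable_cos f xi : mu.-integrable setT (EFin \o f) ->
  mu.-integrable setT (EFin \o (fun x => f x * cos (x * xi))).
Proof.
move=> If; have mf := integrableR_measurable If.
apply: (integrableR_le measurableT _ _ (integrableR_norm measurableT If)).
  apply: measurable_funM; first exact: mf.
  by apply: continuous_line_measurable; exact: continuous_cosM.
by move=> x _; rewrite normrM ler_piMr// cos_max.
Qed.

Lemma fourier_Re f xi : mu.-integrable setT (EFin \o f) ->
  cRe (fourier (toC f) xi) = (Num.sqrt (2 * pi))^-1 * cos_transform f xi.
Proof.
move=> If; rewrite fourierE cReM /= mul0r subr0; congr (_ * _).
apply: eq_Rintegral => x _; rewrite expR0 !mul1r mulr0 subr0 cosN.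
by rewrite mulrC.
Qed.

Lemma fourier_Im f xi : mu.-integrable setT (EFin \o f) ->
  cIm (fourier (toC f) xi) = - ((Num.sqrt (2 * pi))^-1 * sin_transform f xi).
Proof.
move=> If; rewrite fourierE cImM /= mul0r addr0 -mulrN -RintegralN//; last exact: integrable_sin.
congr (_ * _); apply: eq_Rintegral => x _; rewrite expR0 !mul1r mulr0 add0r sinN.
by rewrite mulNr mulrC.
Qed.

Variable e : nat -> R.
Hypotheses (e0 : forall n, 0 < e n) (ecv : e n @[n --> \oo] --> (0 : R)).

Lemma derive_seq (g : R -> R) (l : R) : is_derive (0 : R) (1 : R) g l ->
  (g (e n) - g 0) / e n @[n --> \oo] --> l.
Proof.
move=> dg; have /cvg_ex[l' gl'] : derivable g 0 1 by exact: ex_derive.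
have ll' : l = l'.
  have <- : 'D_1 g 0 = l by exact: derive_val.
  exact/cvg_lim.
have e0' : e n @[n --> \oo] --> 0^'.
  move=> A /= [r r0 rA]; move/cvgrPdist_lt : ecv => /(_ r r0); apply: filterS => n en.
  by apply: rA => //=; rewrite gt_eqF.
rewrite ll'; have := cvg_comp _ _ e0' gl'; apply: cvg_trans.
apply: near_eq_cvg; apply: nearW => n /=.
by rewrite addr0 /GRing.scale/= mulr1 mulrC.
Qed.

Lemma sin_transform_quotient f :
  mu.-integrable setT (EFin \o f) -> mu.-integrable setT (EFin \o (fun x => x * f x)) ->
  sin_transform f (e n) / e n @[n --> \oo] --> \int[mu]_x (x * f x).
Proof.
move=> If Ixf; have mf := integrableR_measurable If.
have -> : (fun n => sin_transform f (e n) / e n) =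
    (fun n => \int[mu]_x (f x * sin (x * e n) * (e n)^-1)).
  by apply/funext => n; rewrite RintegralZr//; exact: integrable_sin.
apply: (@Rintegral_dominated _ _ _ mu setT (fun n x => f x * sin (x * e n) * (e n)^-1)
  (fun x => x * f x) (fun x => `|x * f x|)) => //.
- by move=> n; have := integrableR_measurable (integrable_sin (e n) If); move=> h;
    apply: measurable_funM => //.
- move=> x _; under eq_fun do rewrite -mulrA; rewrite mulrC.
  apply: cvgM; first exact: cvg_cst.
  have dg : is_derive (0 : R) (1 : R) (fun xi => sin (x * xi)) x.
    by apply: is_derive_eq; rewrite /GRing.scale/= mulr0 cos0; ring.
  have -> : (fun n => sin (x * e n) / e n) =
      (fun n => (sin (x * e n) - sin (x * 0)) / e n).
    by apply/funext => n; rewrite mulr0 sin0 subr0.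
  exact: derive_seq dg.
- exact: integrableR_norm.
- move=> n x _; rewrite !normrM normfV (gtr0_norm (e0 n)) ler_pdivrMr//.
  rewrite [`|x| * _]mulrC -mulrA ler_wpM2l//.
  by rewrite (le_trans (norm_sin_le _))// normrM (gtr0_norm (e0 n)).
Qed.

Lemma cos_transform_quotient f :
  mu.-integrable setT (EFin \o f) -> mu.-integrable setT (EFin \o (fun x => x * f x)) ->
  (cos_transform f (e n) - cos_transform f 0) / e n @[n --> \oo] --> (0 : R).
Proof.
move=> If Ixf; have mf := integrableR_measurable If.
have -> : (fun n => (cos_transform f (e n) - cos_transform f 0) / e n) =
    (fun n => \int[mu]_x ((f x * cos (x * e n) - f x * cos (x * 0)) * (e n)^-1)).
  apply/funext => n; rewrite RintegralZr//; last first.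
    by apply: integrableRB => //; exact: integrable_cos.
  by rewrite RintegralB//; exact: integrable_cos.
suff : (fun n => \int[mu]_x ((f x * cos (x * e n) - f x * cos (x * 0)) * (e n)^-1))
    @ \oo --> \int[mu]_x (0 : R) by rewrite Rintegral_cst// mul0r.
apply: (@Rintegral_dominated _ _ _ mu setT
  (fun n x => (f x * cos (x * e n) - f x * cos (x * 0)) * (e n)^-1)
  (fun=> 0) (fun x => `|x * f x|)) => //.
- move=> n; have h1 := integrableR_measurable (integrable_cos (e n) If).
  have h2 := integrableR_measurable (integrable_cos 0 If).
  by apply: measurable_funM => //; exact: measurable_funB.
- move=> x _; have dg : is_derive (0 : R) (1 : R) (fun xi => f x * cos (x * xi)) 0.
    by apply: is_derive_eq; rewrite /GRing.scale/= mulr0 sin0; ring.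
  exact: derive_seq dg.
- exact: integrableR_norm.
- move=> n x _; rewrite -mulrBr mulr0 cos0 !normrM normfV (gtr0_norm (e0 n)) ler_pdivrMr//.
  rewrite [`|x| * _]mulrC -mulrA ler_wpM2l// distrC (ger0_norm (one_sub_cos_ge0 _)).
  by rewrite (le_trans (one_sub_cos_le _))// normrM (gtr0_norm (e0 n)).
Qed.

(** If [`|x|^(5/2) f] is square integrable then the sine transform of [f] has no
    [xi `|xi|] term at the origin. The exponent 5/2 is critical: [x^2 f] need
    not be integrable, and the bound below is the Cauchy-Schwarz inequality
    for the scale-invariant weight, with a factor [chi] that makes the first
    term vanish in the limit by dominated convergence. *)
Lemma sin_transform_second_difference f :
  mu.-integrable setT (EFin \o f) ->
  mu.-integrable setT (EFin \o (fun x => `|x| ^+ 5 * f x ^+ 2)) ->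
  (sin_transform f (2 * e n) - 2 * sin_transform f (e n)) / e n ^+ 2
    @[n --> \oo] --> (0 : R).
Proof.
move=> If I5; have mf := integrableR_measurable If.
(* a bounded factor that tends to 0 with its argument *)
pose chi z : R := z / (1 + z).
pose psi y : R := sin (2 * y) - 2 * sin y.
pose I n := \int[mu]_x (`|x| ^+ 5 * f x ^+ 2 * chi (`|x| * e n)).
have chi01 (z : R) : 0 <= z -> 0 <= chi z <= 1.
  move=> z0; have z1 : 0 < 1 + z by rewrite ltr_wpDr.
  by rewrite /chi divr_ge0 ?(ltW z1)//= ler_pdivrMr// mul1r lerDr.
have w0 x : 0 <= `|x| ^+ 5 * f x ^+ 2.
  exact: mulr_ge0 (exprn_ge0 5 (normr_ge0 x)) (sqr_ge0 _).
have ze n x : 0 <= `|x| * e n by rewrite mulr_ge0// ltW.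
have cchi n : continuous (fun x : R => chi (`|x| * e n)).
  move=> x; have c1 : `|y| * e n @[y --> x] --> `|x| * e n.
    by apply: cvgM; [exact: norm_continuous|exact: cvg_cst].
  apply: cvgM => //; apply: cvgV; first by rewrite gt_eqF// ltr_wpDr.
  by apply: cvgD => //; exact: cvg_cst.
have mI n : measurable_fun setT (fun x => `|x| ^+ 5 * f x ^+ 2 * chi (`|x| * e n)).
  apply: measurable_funM; first exact: integrableR_measurable I5.
  exact: continuous_line_measurable.
have wb n x : `| `|x| ^+ 5 * f x ^+ 2 * chi (`|x| * e n)| <= `|x| ^+ 5 * f x ^+ 2.
  have /andP[c0 c1] := chi01 _ (ze n x).
  by rewrite ger0_norm ?(mulr_ge0 (w0 x) c0)// ler_piMr.
have II n : mu.-integrable setT (EFin \o (fun x => `|x| ^+ 5 * f x ^+ 2 * chi (`|x| * e n))).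
  apply: (integrableR_le measurableT _ _ I5); first by have := mI n.
  by move=> x _; exact: wb.
have Icv : I n @[n --> \oo] --> (0 : R).
  suff : I n @[n --> \oo] --> \int[mu]_x (0 : R) by rewrite Rintegral_cst// mul0r.
  apply: (@Rintegral_dominated _ _ _ mu setT
    (fun n x => `|x| ^+ 5 * f x ^+ 2 * chi (`|x| * e n)) (fun=> 0)
    (fun x => `|x| ^+ 5 * f x ^+ 2)) => // x _.
  rewrite -[X in _ --> X](mulr0 (`|x| ^+ 5 * f x ^+ 2)); apply: cvgM; first exact: cvg_cst.
  have c0 : `|x| * e n @[n --> \oo] --> (0 : R).
    by rewrite -[X in _ --> X](mulr0 `|x|); apply: cvgM => //; exact: cvg_cst.
  rewrite -[X in _ --> X](mul0r (1 + 0)^-1); apply: cvgM => //.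
  apply: cvgV; first by rewrite addr0.
  by apply: cvgD => //; exact: cvg_cst.
have psi_le (y : R) : psi y ^+ 2 * (1 + `|y|) * (1 + y ^+ 2) <= 64 * `|y| ^+ 6.
  have h1 := sin_diff_le y; have h2 := sin_diff_le4 y; rewrite -/(psi y) in h1 h2.
  have h3 : psi y ^+ 2 <= `|y| ^+ 6.
    rewrite -(real_normK (num_real (psi y))) -[6%N]/(3 * 2)%N exprM.
    by rewrite lerXn2r ?nnegrE ?exprn_ge0.
  have h4 : psi y ^+ 2 <= 16.
    rewrite -(real_normK (num_real (psi y))) (_ : 16 = 4 ^+ 2); last by rewrite expr2 -natrM.
    by rewrite lerXn2r ?nnegrE.
  have p0 := sqr_ge0 (psi y).
  rewrite -(real_normK (num_real y)); have := normr_ge0 y.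
  move: (psi y ^+ 2) `|y| p0 h3 h4 => p z p0 h3 h4 z0 {h1 h2}.
  have [z1|z1] := leP z 1.
    have q : (1 + z) * (1 + z ^+ 2) <= 4.
      have : z ^+ 2 <= 1 by rewrite expr_le1.
      by have := sqr_ge0 z; nra.
    rewrite -mulrA (le_trans (ler_wpM2l p0 q))// mulrC ler_pM// ; lra.
  have z1' := ltW z1.
  have q : (1 + z) * (1 + z ^+ 2) <= 4 * z ^+ 6.
    have z2 : 1 <= z ^+ 2 by rewrite exprn_ege1.
    have z3 : 1 <= z ^+ 3 by rewrite exprn_ege1.
    apply: (@le_trans _ _ ((2 * z) * (2 * z ^+ 2))).
      by apply: ler_pM; rewrite ?addr_ge0 ?sqr_ge0//; lra.
    rewrite (_ : 2 * z * (2 * z ^+ 2) = 4 * z ^+ 3); last by ring.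
    rewrite ler_pM2l// -[6%N]/(3 + 3)%N exprD ler_peMr// exprn_ge0//.
  rewrite -mulrA (_ : 64 * z ^+ 6 = 16 * (4 * z ^+ 6)); last by ring.
  by apply: ler_pM => //; rewrite mulr_ge0 ?addr_ge0 ?sqr_ge0.
have Iq n : mu.-integrable setT (EFin \o (fun x => (1 + (x * e n) ^+ 2)^-1)).
  exact: integrable_inv1sqr_dilate.
(* Young's inequality, with dl |x|^5 (e n)^2 chi as the free parameter *)
have bound n (dl : R) : 0 < dl ->
    `|(sin_transform f (2 * e n) - 2 * sin_transform f (e n)) / e n ^+ 2| <=
    dl * I n + dl^-1 * (64 * pi).
  move=> dl0; have dli : 0 < dl^-1 by rewrite invr_gt0.
  have en0 := e0 n; have en2 : 0 < e n ^+ 2 by rewrite exprn_gt0.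
  have -> : (sin_transform f (2 * e n) - 2 * sin_transform f (e n)) / e n ^+ 2 =
      \int[mu]_x ((e n ^+ 2)^-1 * (f x * psi (x * e n))).
    rewrite /sin_transform -RintegralZl//; last exact: integrable_sin.
    rewrite -RintegralB//; last 2 first.
    - exact: integrable_sin.
    - by apply: integrableRZ => //; exact: integrable_sin.
    rewrite mulrC -RintegralZl//; last first.
      apply: integrableRB => //; first exact: integrable_sin.
      by apply: integrableRZ => //; exact: integrable_sin.
    apply: eq_Rintegral => x _; congr (_ * _).
    rewrite /psi (_ : x * (2 * e n) = 2 * (x * e n)); last by ring.
    by ring.
  have -> : dl * I n + dl^-1 * (64 * pi) =
      \int[mu]_x (dl * (`|x| ^+ 5 * f x ^+ 2 * chi (`|x| * e n)) +
        dl^-1 * (64 * e n) * (1 + (x * e n) ^+ 2)^-1).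
    rewrite RintegralD//; [|exact: integrableRZ (II n)|exact: integrableRZ (Iq n)].
    rewrite (RintegralZl _ measurableT (II n)) (RintegralZl _ measurableT (Iq n)).
    rewrite Rintegral_inv1sqr_dilate// -/(I n); congr (_ + _).
    by move: (pi : R) => p; field; rewrite gt_eqF//= gt_eqF.
  apply: norm_Rintegral_le => //.
  - apply: measurable_funM => //; apply: measurable_funM; first exact: mf.
    apply: continuous_line_measurable; apply: continuousBR; last first.
      by apply: continuousMR; [exact: continuous_cstR|exact: continuous_sinM].
    apply: (continuous_compR (f := fun x => 2 * (x * e n))); last exact: continuous_sin.
    apply: continuousMR; first exact: continuous_cstR.
    by apply: continuousMR; [exact: continuous_idR|exact: continuous_cstR].
  - move=> x _; rewrite !normrM normfV (gtr0_norm en2).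
    have [->|x0] := eqVneq x 0.
      rewrite mul0r /psi mulr0 sin0 mulr0 subrr normr0 !mulr0.
      rewrite !expr0n /= !mul0r mulr0 add0r addr0 divr1 mulr_ge0 ?(ltW dli)//.
      by rewrite mulr_ge0// ltW.
    have ax : 0 < `|x| by rewrite normr_gt0.
    have z0 : 0 < `|x| * e n by rewrite mulr_gt0.
    have pl := psi_le (x * e n); rewrite normrM (gtr0_norm en0) in pl.
    have q0 : 0 < 1 + (x * e n) ^+ 2 by rewrite ltr_wpDr ?sqr_ge0.
    have zz : 0 < 1 + `|x| * e n by rewrite ltr_wpDr// ltW.
    pose c : R := `|x| ^+ 5 * chi (`|x| * e n).
    have c0 : 0 < c by rewrite mulr_gt0 ?exprn_gt0// divr_gt0.
    have yg := @young R `|psi (x * e n)| `|f x| (dl * c * e n ^+ 2) (mulr_gt0 (mulr_gt0 dl0 c0) en2).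
    have P0 : 0 <= `|psi (x * e n)| * `|f x| by rewrite mulr_ge0.
    rewrite mulrC ler_pdivrMr// [leLHS]mulrC.
    apply: (@le_trans _ _ (2 * (`|psi (x * e n)| * `|f x|))); first by lra.
    apply: (le_trans yg).
    rewrite !real_normK ?num_real// addrC mulrDl; apply: lerD.
      rewrite /c le_eqVlt; apply/orP; left; apply/eqP; ring.
    have -> : (dl * c * e n ^+ 2)^-1 * psi (x * e n) ^+ 2 =
        dl^-1 * (e n * (e n ^+ 2) * (psi (x * e n) ^+ 2 * (1 + `|x| * e n) / (`|x| * e n) ^+ 6)).
      by rewrite /c /chi; field; rewrite !gt_eqF.
    rewrite (_ : dl^-1 * (64 * e n) / (1 + (x * e n) ^+ 2) * e n ^+ 2 =
        dl^-1 * (e n * (e n ^+ 2) * (64 / (1 + (x * e n) ^+ 2)))); last by ring.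
    rewrite ler_pM2l// ler_pM2l ?mulr_gt0// ler_pdivrMr ?exprn_gt0//.
    by rewrite [leRHS]mulrAC ler_pdivlMr.
  - apply: integrableRD => //; first exact: integrableRZ (II n).
    exact: integrableRZ (Iq n).
apply/cvgrPdist_le => eps eps0.
(* dl is chosen so that the second term of the bound is eps / 2 *)
pose dl : R := 128 * pi / eps.
have p0 := pi_gt0 R.
have dl0 : 0 < dl by rewrite divr_gt0// mulr_gt0.
have eta0 : 0 < eps / (2 * dl) by rewrite divr_gt0// mulr_gt0.
move/cvgrPdist_le : Icv => /(_ _ eta0); apply: filterS => n.
rewrite !sub0r !normrN => In; apply: le_trans (bound n dl dl0) _.
have h1 : dl * I n <= eps / 2.
  have := ler_wpM2l (ltW dl0) (le_trans (ler_norm _) In).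
  by rewrite (_ : dl * (eps / (2 * dl)) = eps / 2)//; field; rewrite gt_eqF.
have h2 : dl^-1 * (64 * pi) = eps / 2.
  rewrite /dl; move: (pi : R) p0 => p p0; field.
  by rewrite !gt_eqF.
lra.
Qed.

End LowFrequency.

(** * The first moment of the solution *)

Section Moments.
Context (R : realType).
Local Notation mu := (@lebesgue_measure R).
Local Notation kap := ((Num.sqrt (2 * pi))^-1 : R).
Variables (nu T : R) (phi : R -> R) (u : R -> R -> R).
Hypotheses (nu0 : 0 < nu) (T0 : 0 <= T) (cu : continuous_in_Zdot T 2 2 u).
Hypotheses (Zphi : Zdot 2 2 phi) (sol : is_solution nu T phi u).
Local Notation J := (selfconv T u).
Local Notation a := (uhat T u).
Local Notation F := (multiplier nu).

Definition moment (t : R) : R := \int[mu]_x (x * upath T u t x).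
Definition energy (t : R) : R := \int[mu]_x (upath T u t x ^+ 2).

Lemma energy_ge0 t : 0 <= energy t.
Proof. by apply: Rintegral_ge0 => x _; exact: sqr_ge0. Qed.

Lemma energy_clamp t : energy (clamp T t) = energy t.
Proof. by rewrite /energy upath_clamp. Qed.

Lemma sqr_integrable t : mu.-integrable setT (EFin \o (fun x => upath T u t x ^+ 2)).
Proof. exact: weighted_sqr (upath_weighted T0 cu t). Qed.

Lemma selfconv_Re t xi :
  cRe (J t xi) = kap * cos_transform (fun x => upath T u t x ^+ 2) xi.
Proof.
rewrite -(selfconv_clamp u T0) -(upath_clamp u T0 t).
rewrite (selfconv_fourier_sqr nu0 T0 cu Zphi sol)//; last exact: clamp_in.
by rewrite fourier_Re ?upath_clamp//; exact: sqr_integrable.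
Qed.

Lemma cos_transform0 (f : R -> R) : cos_transform f 0 = \int[mu]_x f x.
Proof. by apply: eq_Rintegral => x _; rewrite mulr0 cos0 mulr1. Qed.

Lemma selfconv_Re0 t : cRe (J t 0) = kap * energy t.
Proof. by rewrite selfconv_Re cos_transform0. Qed.

Lemma energy_continuous : continuous energy.
Proof.
have -> : energy = (fun t => kap^-1 * cRe (J t 0)).
  by apply/funext => t; rewrite selfconv_Re0 mulKf// gt_eqF// kap_gt0.
apply: continuousMR; first exact: continuous_cstR.
by case: (selfconv_time_continuous T0 cu 0).
Qed.

Section Sequence.
Variable e : nat -> R.
Hypotheses (e0 : forall n, 0 < e n) (e1 : forall n, e n <= 1).
Hypothesis ecv : e n @[n --> \oo] --> (0 : R).

Lemma continuous_seq (f : R -> R) : continuous f -> f (e n) @[n --> \oo] --> f 0.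
Proof. by move=> cf; apply: (cvg_comp e f ecv); exact: cf. Qed.

Lemma xupath_integrable t : mu.-integrable setT (EFin \o (fun x => x * upath T u t x)).
Proof. exact: weighted_xintegrable (upath_weighted T0 cu t). Qed.

Lemma uhat_Im_quotient t : cIm (a t (e n)) / e n @[n --> \oo] --> - (kap * moment t).
Proof.
have Iu := upath_integrable T0 cu t.
have -> : (fun n => cIm (a t (e n)) / e n) =
    (fun n => - (kap * (sin_transform (upath T u t) (e n) / e n))).
  by apply/funext => n; rewrite /uhat fourier_Im// mulNr mulrA.
apply: cvgN; apply: cvgM; first exact: cvg_cst.
exact: (@sin_transform_quotient R e e0 ecv _ Iu (xupath_integrable t)).
Qed.

Lemma uhat_Re_quotient t : cRe (a t (e n)) / e n @[n --> \oo] --> (0 : R).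
Proof.
have Iu := upath_integrable T0 cu t.
have C0 : cos_transform (upath T u t) 0 = 0.
  have := congr1 (@cRe R) (uhat0 T0 cu t); rewrite /uhat fourier_Re//= => /eqP.
  by rewrite mulf_eq0 gt_eqF ?kap_gt0//= => /eqP.
have -> : (fun n => cRe (a t (e n)) / e n) =
    (fun n => kap * ((cos_transform (upath T u t) (e n) - cos_transform (upath T u t) 0) / e n)).
  by apply/funext => n; rewrite /uhat fourier_Re// C0 subr0 mulrA.
rewrite -[X in _ --> X](mulr0 kap); apply: cvgM; first exact: cvg_cst.
exact: (@cos_transform_quotient R e e0 ecv _ Iu (xupath_integrable t)).
Qed.

Lemma multiplier_Re_quotient h : (cRe (F h (e n)) - 1) / e n @[n --> \oo] --> nu * h.
Proof.
pose g xi : R := expR (- (nu * (xi ^+ 3 - xi) * h)) * cos (xi * xi * h).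
have dg : is_derive (0 : R) (1 : R) g (nu * h).
  rewrite /g; apply: is_derive_eq; rewrite /GRing.scale/=.
  by rewrite !(expr0n, mulr0, mul0r, subr0, oppr0, expR0, cos0, sin0, mulr1, mul1r) /=; ring.
have -> : (fun n => (cRe (F h (e n)) - 1) / e n) = (fun n => (g (e n) - g 0) / e n).
  apply/funext => n; rewrite multiplierE /damping (gtr0_norm (e0 n)) /= /g.
  by rewrite expr0n /= !(mulr0, mul0r, subr0, oppr0, expR0, cos0, mulr1).
exact: (@derive_seq R e e0 ecv g _ dg).
Qed.

Lemma multiplier_Im_quotient h : cIm (F h (e n)) / e n @[n --> \oo] --> (0 : R).
Proof.
pose g xi : R := expR (- (nu * (xi ^+ 3 - xi) * h)) * sin (xi * xi * h).
have dg : is_derive (0 : R) (1 : R) g 0.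
  rewrite /g; apply: is_derive_eq; rewrite /GRing.scale/=.
  by rewrite !(expr0n, mulr0, mul0r, subr0, oppr0, expR0, cos0, sin0, mulr1, mul1r) /=; ring.
have -> : (fun n => cIm (F h (e n)) / e n) = (fun n => (g (e n) - g 0) / e n).
  apply/funext => n; rewrite multiplierE /damping (gtr0_norm (e0 n)) /= /g.
  by rewrite !(mulr0, mul0r, subr0, oppr0, expR0, sin0, mulr1).
exact: (@derive_seq R e e0 ecv g _ dg).
Qed.

Definition multiplier_lipschitz : R := expR (nu * T) * (2 * T + nu * T).

(** Both the growth exponent and the phase of the multiplier are [O(xi)] for low
    frequencies. *)
Lemma normc_multiplier_sub1 (h xi : R) : 0 <= h <= T -> 0 < xi -> xi <= 1 ->
  normc (F h xi - 1) <= multiplier_lipschitz * xi.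
Proof.
move=> /andP[h0 hT] xi0 xi1; apply: (le_trans (normc_le_ReIm _)).
rewrite cReB cImB /= subr0 multiplierE /damping (gtr0_norm xi0) /=.
set p := - _; set th := _ * h.
have p0 : 0 <= p.
  rewrite /p -mulNr mulr_ge0// -mulrN mulr_ge0 ?(ltW nu0)// opprB subr_ge0.
  by rewrite exprSr ler_piMl ?(ltW xi0)// expr_le1// ltW.
have pT : p <= nu * T * xi.
  have -> : p = nu * (xi - xi ^+ 3) * h by rewrite /p; ring.
  rewrite mulrAC; apply: ler_pM => //; rewrite ?mulr_ge0 ?(ltW nu0)//.
  - by rewrite subr_ge0 exprSr ler_piMl ?(ltW xi0)// expr_le1// ltW.
  - by rewrite ler_pM2l.
  - by rewrite gerBl exprn_ge0// ltW.
have th0 : 0 <= th by rewrite !mulr_ge0// ltW.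
have thT : th <= T * xi.
  by rewrite /th -mulrA [T * xi]mulrC ler_pM2l// -[leRHS]mul1r ler_pM// ltW.
have eM : expR p <= expR (nu * T).
  by rewrite ler_expR (le_trans pT)// ler_piMr// mulr_ge0// ltW.
have E0 := expR_gt0 p; have M0 := expR_gt0 (nu * T).
have e1' : expR p - 1 <= p * expR p.
  have := expR_ge1Dx (- p); rewrite expRN => h1.
  have := ler_wpM2r (ltW E0) h1; rewrite mulVf ?gt_eqF//; lra.
have e2 : 0 <= expR p - 1 by rewrite subr_ge0 -expR0 ler_expR.
have c1 : `|cos th - 1| <= th.
  by rewrite distrC ger0_norm ?one_sub_cos_ge0// (le_trans (one_sub_cos_le _))// ger0_norm.
have s1 : `|sin th| <= th by rewrite (le_trans (norm_sin_le _))// ger0_norm.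
have r1 : `|expR p * cos th - 1| <= expR p * th + p * expR p.
  have -> : expR p * cos th - 1 = expR p * (cos th - 1) + (expR p - 1) by ring.
  rewrite (le_trans (ler_normD _ _))// normrM (ger0_norm (ltW E0)) (ger0_norm e2).
  by rewrite lerD// ler_pM2l.
have r2 : `|expR p * sin th| <= expR p * th by rewrite normrM (ger0_norm (ltW E0)) ler_pM2l.
apply: (le_trans (lerD r1 r2)).
have -> : expR p * th + p * expR p + expR p * th = expR p * (2 * th + p) by ring.
rewrite /multiplier_lipschitz -mulrA; apply: ler_pM => //.
  by rewrite addr_ge0// mulr_ge0.
by lra.
Qed.

Definition duhamel_rest (s t xi : R) : R :=
  \int[mu]_(tau in `[s, t]) ((cRe (F (t - tau) xi) - 1) * cRe (J tau xi) -
    cIm (F (t - tau) xi) * cIm (J tau xi)).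

Let cF t xi : continuous (fun tau => cRe (F (t - tau) xi)) /\
  continuous (fun tau => cIm (F (t - tau) xi)).
Proof. exact: ccontinuous_multiplier_time. Qed.

Let cJ xi : continuous (fun tau => cRe (J tau xi)) /\ continuous (fun tau => cIm (J tau xi)).
Proof. exact: (selfconv_time_continuous T0 cu xi). Qed.

Let rest_continuous t xi : continuous (fun tau => (cRe (F (t - tau) xi) - 1) * cRe (J tau xi) -
    cIm (F (t - tau) xi) * cIm (J tau xi)).
Proof.
have [f1 f2] := cF t xi; have [j1 j2] := cJ xi.
apply: continuousBR; last exact: continuousMR.
apply: continuousMR => //; apply: continuousBR => //; exact: continuous_cstR.
Qed.

Lemma duhamel_rest_quotient s t : 0 <= s -> t <= T ->
  duhamel_rest s t (e n) / e n @[n --> \oo] -->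
  kap * nu * \int[mu]_(tau in `[s, t]) ((t - tau) * energy tau).
Proof.
move=> s0 tT; have [K K0 KP] := selfconv_bounded T0 cu.
have cw : continuous (fun tau => (t - tau) * energy tau).
  apply: continuousMR; last exact: energy_continuous.
  by apply: continuousBR; [exact: continuous_cstR|exact: continuous_idR].
rewrite -(RintegralZl _ _ (continuous_integrable_itv s t cw))//.
pose r n tau := (((cRe (F (t - tau) (e n)) - 1) * cRe (J tau (e n)) -
    cIm (F (t - tau) (e n)) * cIm (J tau (e n)))) * (e n)^-1.
have -> : (fun n => duhamel_rest s t (e n) / e n) =
    (fun n => \int[mu]_(tau in `[s, t]) r n tau).
  apply/funext => n; rewrite RintegralZr//.
  exact: continuous_integrable_itv (@rest_continuous t (e n)).
apply: (@Rintegral_dominated _ _ _ mu `[s, t] r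
  (fun tau => kap * nu * ((t - tau) * energy tau)) (fun=> multiplier_lipschitz * K)) => //.
- move=> n; apply: measurable_funM => //.
  exact: continuous_measurable_itv (@rest_continuous t (e n)).
- move=> tau _; have [j1 j2] := selfconv_continuous T0 cu tau.
  have -> : (r ^~ tau) = (fun n => (cRe (F (t - tau) (e n)) - 1) / e n * cRe (J tau (e n)) -
      cIm (F (t - tau) (e n)) / e n * cIm (J tau (e n))).
    by apply/funext => n; rewrite /r; ring.
  have -> : kap * nu * ((t - tau) * energy tau) =
      nu * (t - tau) * cRe (J tau 0) - 0 * cIm (J tau 0).
    by rewrite mul0r subr0 selfconv_Re0; ring.
  apply: cvgB; apply: cvgM.
  + exact: multiplier_Re_quotient.
  + exact: continuous_seq j1.
  + exact: multiplier_Im_quotient.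
  + exact: continuous_seq j2.
- exact: integrable_cst_itv.
- move=> n tau tst; have en0 := e0 n.
  have -> : r n tau = cRe ((F (t - tau) (e n) - 1) * J tau (e n)) / e n.
    by rewrite /r cReM cReB cImB /= subr0.
  rewrite normrM normfV (gtr0_norm en0) ler_pdivrMr//.
  apply: (le_trans (normc_geRe _)); rewrite normcM mulrAC.
  apply: ler_pM; rewrite ?normc_ge0//.
  by apply: normc_multiplier_sub1 => //; exact: itv_time tst.
Qed.

Lemma selfconv_integral_cvg s t :
  \int[mu]_(tau in `[s, t]) cRe (J tau (e n)) @[n --> \oo] -->
  kap * \int[mu]_(tau in `[s, t]) energy tau.
Proof.
have [K K0 KP] := selfconv_bounded T0 cu.
rewrite -(RintegralZl _ _ (continuous_integrable_itv s t energy_continuous))//.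
apply: (@Rintegral_dominated _ _ _ mu `[s, t] (fun n tau => cRe (J tau (e n)))
  (fun tau => kap * energy tau) (fun=> K)) => //.
- by move=> n; have [j1 _] := cJ (e n); exact: continuous_measurable_itv.
- move=> tau _; rewrite -selfconv_Re0; have [j1 _] := selfconv_continuous T0 cu tau.
  exact: continuous_seq j1.
- exact: integrable_cst_itv.
- by move=> n tau _; apply: le_trans (normc_geRe _) (KP _ _).
Qed.

(** What the linear evolution contributes to the imaginary part of the
    transform: its increment, corrected by the flux of [u^2 / 2]. Near the
    origin it is of second order in [xi]. *)
Definition linear_contribution (s t xi : R) : R :=
  cIm (a t xi) - cIm (a s xi) + xi / 2 * \int[mu]_(tau in `[s, t]) cRe (J tau xi).

Lemma linear_contributionE s t xi : 0 <= s -> s <= t -> t <= T ->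
  linear_contribution s t xi = (cRe (F (t - s) xi) - 1) * cIm (a s xi) +
    cIm (F (t - s) xi) * cRe (a s xi) - xi / 2 * duhamel_rest s t xi.
Proof.
move=> s0 st tT; rewrite /linear_contribution (uhat_duhamel nu0 T0 cu Zphi sol xi s0 st tT).
rewrite cImB cImM (_ : cIm ((0 +i* (xi / 2)) * _) = xi / 2 * cRe (duhamel nu T u s t xi)); last first.
  by rewrite cImM; case: duhamel => x y /=; ring.
have [f1 f2] := cF t xi; have [j1 j2] := cJ xi.
have -> : duhamel_rest s t xi = cRe (duhamel nu T u s t xi) -
    \int[mu]_(tau in `[s, t]) cRe (J tau xi).
  rewrite /duhamel_rest /duhamel /= -RintegralB//.
  - by apply: eq_Rintegral => tau _; rewrite cReM mulrBl mul1r addrAC.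
  - by case: (duhamel_integrable nu T0 cu s t t xi).
  - exact: continuous_integrable_itv.
by ring.
Qed.

Lemma linear_contribution_quotient s t : 0 <= s -> s <= t -> t <= T ->
  linear_contribution s t (e n) / e n ^+ 2 @[n --> \oo] -->
  - (kap * nu * ((t - s) * moment s + 2^-1 * \int[mu]_(tau in `[s, t]) ((t - tau) * energy tau))).
Proof.
move=> s0 st tT.
have -> : (fun n => linear_contribution s t (e n) / e n ^+ 2) =
   (fun n => (cRe (F (t - s) (e n)) - 1) / e n * (cIm (a s (e n)) / e n) +
     cIm (F (t - s) (e n)) / e n * (cRe (a s (e n)) / e n) -
     2^-1 * (duhamel_rest s t (e n) / e n)).
  apply/funext => n; rewrite linear_contributionE//.
  by field; rewrite gt_eqF.
set I := \int[mu]_(tau in _) _.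
have -> : - (kap * nu * ((t - s) * moment s + 2^-1 * I)) =
    nu * (t - s) * - (kap * moment s) + 0 * 0 - 2^-1 * (kap * nu * I) by ring.
apply: cvgB; last first.
  by apply: cvgM; [exact: cvg_cst|exact: duhamel_rest_quotient].
apply: cvgD; apply: cvgM.
- exact: multiplier_Re_quotient.
- exact: uhat_Im_quotient.
- exact: multiplier_Im_quotient.
- exact: uhat_Re_quotient.
Qed.

End Sequence.

Lemma seq_limit_unique (f : nat -> R) (l l' : R) :
  f n @[n --> \oo] --> l -> f n @[n --> \oo] --> l' -> l = l'.
Proof. by move=> /cvg_lim <- // /cvg_lim <-. Qed.

(** A sequence for which [e n] and [2 * e n] both stay in the range [xi <= 1] of
    [normc_multiplier_sub1]. *)
Lemma half_harmonic : [/\ forall n, 0 < (2 * n.+1%:R)^-1 :> R,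
  forall n, (2 * n.+1%:R)^-1 <= 2^-1 :> R &
  (2 * n.+1%:R)^-1 @[n --> \oo] --> (0 : R)].
Proof.
split.
- by move=> n; rewrite invr_gt0 mulr_gt0.
- by move=> n; rewrite invfM ler_piMr ?invr_ge0// invf_le1 ?ltr0n// ler1n.
- have -> : (fun n => (2 * n.+1%:R)^-1 : R) = (fun n => 2^-1 * n.+1%:R^-1).
    by apply/funext => n; rewrite invfM.
  rewrite -[X in _ --> X](mulr0 2^-1); apply: cvgM; first exact: cvg_cst.
  exact: cvg_harmonic.
Qed.

(** Comparison of the coefficients of [xi] at the origin: the linear
    contribution, being of second order, drops out. *)
Lemma moment_law s t : 0 <= s -> s <= t -> t <= T ->
  moment t = moment s + 2^-1 * \int[mu]_(tau in `[s, t]) energy tau.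
Proof.
move=> s0 st tT; have [e0 e2 ecv] := half_harmonic.
pose e n : R := (2 * n.+1%:R)^-1.
have e1 n : e n <= 1 by rewrite (le_trans (e2 n))// invf_le1// ler1n.
set I := \int[mu]_(tau in _) _.
have l1 : linear_contribution s t (e n) / e n @[n --> \oo] -->
    - (kap * moment t) - - (kap * moment s) + 2^-1 * (kap * I).
  have -> : (fun n => linear_contribution s t (e n) / e n) = (fun n =>
      cIm (a t (e n)) / e n - cIm (a s (e n)) / e n +
      2^-1 * \int[mu]_(tau in `[s, t]) cRe (J tau (e n))).
    by apply/funext => n; rewrite /linear_contribution; field; rewrite gt_eqF// e0.
  apply: cvgD; first by apply: cvgB; exact: uhat_Im_quotient.
  by apply: cvgM; [exact: cvg_cst|exact: selfconv_integral_cvg].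
have l2 : linear_contribution s t (e n) / e n @[n --> \oo] --> (0 : R).
  have -> : (fun n => linear_contribution s t (e n) / e n) =
      (fun n => e n * (linear_contribution s t (e n) / e n ^+ 2)).
    by apply/funext => n; field; rewrite gt_eqF// e0.
  set L : R := - (kap * nu * ((t - s) * moment s +
    2^-1 * \int[mu]_(tau in `[s, t]) ((t - tau) * energy tau))).
  rewrite -[X in _ --> X](mul0r L); apply: cvgM; first exact: ecv.
  exact: (@linear_contribution_quotient e e0 e1 ecv s t s0 st tT).
have E := seq_limit_unique l2 l1.
have /eqP : kap * (moment t - (moment s + 2^-1 * I)) = 0.
  by rewrite -[RHS]oppr0 [in RHS]E; ring.
by rewrite mulf_eq0 gt_eqF ?kap_gt0//= subr_eq0 => /eqP.
Qed.

(** [J tau] is the transform of a real function with a finite second moment, so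
    its real part has no first order term at the origin. *)
Lemma selfconv_second_difference : exists2 K, 0 <= K &
  forall tau xi, `|cRe (J tau (2 * xi)) - cRe (J tau xi)| <= K * xi ^+ 2.
Proof.
have [K K0 KP] := weight_bounded T0 cu.
exists (kap * (3 * K)); first by rewrite !mulr_ge0// ltW// kap_gt0.
move=> tau xi; have Isq := sqr_integrable tau.
have Ixx := weighted_xsqr (upath_weighted T0 cu tau).
have -> : cRe (J tau (2 * xi)) - cRe (J tau xi) = kap *
    (cos_transform (fun x => upath T u tau x ^+ 2) (2 * xi) -
     cos_transform (fun x => upath T u tau x ^+ 2) xi).
  rewrite mulrBr.
  congr (_ - _).
    exact: selfconv_Re.
  exact: selfconv_Re.
rewrite normrM [X in X * _](gtr0_norm (kap_gt0 R)) -[leRHS]mulrA.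
apply: ler_wpM2l; first exact: ltW (kap_gt0 R).
rewrite /cos_transform -RintegralB//; [|exact: integrable_cos..].
apply: (@le_trans _ _ (\int[mu]_x (3 * xi ^+ 2 * (x ^+ 2 * upath T u tau x ^+ 2)))).
  apply: norm_Rintegral_le => //.
  - apply: measurable_funB; apply: integrableR_measurable; exact: integrable_cos.
  - move=> x _; rewrite -mulrBr normrM ger0_norm ?sqr_ge0//.
    rewrite (_ : x * (2 * xi) = 2 * (x * xi)); last by ring.
    have := ler_wpM2l (sqr_ge0 (upath T u tau x)) (cos_diff_le (x * xi)).
    by move/le_trans; apply; rewrite exprMn le_eqVlt; apply/orP; left; apply/eqP; ring.
  - exact: integrableRZ.
rewrite (RintegralZl _ measurableT Ixx).
have h : \int[mu]_x (x ^+ 2 * upath T u tau x ^+ 2) <= K.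
  apply: le_trans (KP tau); apply: le_Rintegral => //; first by case: (upath_weighted T0 cu tau).
  move=> x _; rewrite exprMn ler_wpM2r ?sqr_ge0//.
  by have := sqr_ge0 x; move: (x ^+ 2) => y y0; rewrite sqrrD; nra.
have := ler_wpM2l (_ : 0 <= 3 * xi ^+ 2) h => /(_ (mulr_ge0 (ler0n _ 3) (sqr_ge0 _))).
by move/le_trans; apply; rewrite mulrAC.
Qed.

Let second_difference_algebra (k x2 x1 y2 y1 p2 p1 r : R) : 0 < r ->
  (- (k * x2) - - (k * y2) + 2 * r / 2 * p2 -
    2 * (- (k * x1) - - (k * y1) + r / 2 * p1)) / r ^+ 2 =
  - (k * ((x2 - 2 * x1) / r ^+ 2)) + k * ((y2 - 2 * y1) / r ^+ 2) + (p2 - p1) / r.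
Proof. by move=> r0; field; rewrite gt_eqF. Qed.

(** The damping rate contains [nu `|xi|], so the linear contribution behaves
    like [L xi `|xi|] at the origin. The second difference between [xi] and
    [2 xi] multiplies such a term by 2 instead of cancelling it, but by
    [sin_transform_second_difference] it is [o(xi^2)] for the solution at times
    of higher decay. Hence [L = 0]. *)
Lemma moment_identity s t : 0 <= s -> s <= t -> t <= T ->
  mu.-integrable setT (EFin \o (fun x => `|x| ^+ 5 * upath T u s x ^+ 2)) ->
  mu.-integrable setT (EFin \o (fun x => `|x| ^+ 5 * upath T u t x ^+ 2)) ->
  (t - s) * moment s + 2^-1 * \int[mu]_(tau in `[s, t]) ((t - tau) * energy tau) = 0.
Proof.
move=> s0 st tT I5s I5t; have [e0 e2 ecv] := half_harmonic.
pose e n : R := (2 * n.+1%:R)^-1.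
have e1 n : e n <= 1 by rewrite (le_trans (e2 n))// invf_le1// ler1n.
have d0 n : 0 < 2 * e n by rewrite mulr_gt0// e0.
have d1 n : 2 * e n <= 1 by rewrite mulrC -ler_pdivlMr// div1r e2.
have dcv : 2 * e n @[n --> \oo] --> (0 : R).
  by rewrite -[X in _ --> X](mulr0 2); apply: cvgM; [exact: cvg_cst|exact: ecv].
set I := \int[mu]_(tau in _) _.
set M := _ + _.
pose L : R := - (kap * nu * M).
pose D n : R := linear_contribution s t (2 * e n) - 2 * linear_contribution s t (e n).
(* homogeneity of degree 2 along positive frequencies *)
have l1 : D n / e n ^+ 2 @[n --> \oo] --> 4 * L - 2 * L.
  have -> : (fun n => D n / e n ^+ 2) = (fun n =>
      4 * (linear_contribution s t (2 * e n) / (2 * e n) ^+ 2) -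
      2 * (linear_contribution s t (e n) / e n ^+ 2)).
    apply/funext => n; rewrite /D; have := e0 n; rewrite -/(e n).
    move: (e n) (linear_contribution s t (2 * e n)) (linear_contribution s t (e n)) => r x y r0.
    by field; rewrite gt_eqF.
  apply: cvgB; apply: cvgM; try exact: cvg_cst.
  - exact: (@linear_contribution_quotient (fun n => 2 * e n) d0 d1 dcv s t s0 st tT).
  - exact: (@linear_contribution_quotient e e0 e1 ecv s t s0 st tT).
pose Q (f : R -> R) n : R := (sin_transform f (2 * e n) - 2 * sin_transform f (e n)) / e n ^+ 2.
pose B n : R := \int[mu]_(tau in `[s, t]) (cRe (J tau (2 * e n)) - cRe (J tau (e n))).
have cJ xi : continuous (fun tau => cRe (J tau xi)).
  by case: (selfconv_time_continuous T0 cu xi).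
have Bcv : B n / e n @[n --> \oo] --> (0 : R).
  have [K K0 KP] := selfconv_second_difference.
  have bound n : `|B n / e n| <= K * (t - s) * e n.
    have en0 : 0 < e n by exact: e0.
    rewrite normrM normfV (gtr0_norm en0) ler_pdivrMr//.
    rewrite (_ : K * (t - s) * e n * e n = K * e n ^+ 2 * (t - s)); last by ring.
    rewrite -(Rintegral_cst_itv (K * e n ^+ 2) st); apply: norm_Rintegral_le => //.
    - by apply: continuous_measurable_itv; apply: continuousBR; exact: cJ.
    - exact: integrable_cst_itv.
  apply/norm_cvg0P; apply: (@squeeze_cvgr _ _ _ _ (fun=> 0) (fun n => K * (t - s) * e n)).
  - by apply: nearW => n; rewrite normr_ge0 bound.
  - exact: cvg_cst.
  - by rewrite -[X in _ --> X](mulr0 (K * (t - s))); apply: cvgM; [exact: cvg_cst|exact: ecv].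
have l2 : D n / e n ^+ 2 @[n --> \oo] --> - (kap * 0) + kap * 0 + (0 : R).
  have -> : (fun n => D n / e n ^+ 2) = (fun n =>
      - (kap * Q (upath T u t) n) + kap * Q (upath T u s) n + B n / e n).
    apply/funext => n; rewrite /D /linear_contribution /Q /B RintegralB//; last 2 first.
    - exact: continuous_integrable_itv.
    - exact: continuous_integrable_itv.
    rewrite /uhat !fourier_Im; [|exact: upath_integrable..].
    exact: (second_difference_algebra _ _ _ _ _ _ _ (e0 n)).
  apply: cvgD; last exact: Bcv.
  apply: cvgD; first apply: cvgN; apply: cvgM; try exact: cvg_cst.
  - exact: (@sin_transform_second_difference R e e0 ecv _ (upath_integrable T0 cu t) I5t).
  - exact: (@sin_transform_second_difference R e e0 ecv _ (upath_integrable T0 cu s) I5s).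
have E := seq_limit_unique l2 l1.
have : L = 0 by move: E; rewrite mulr0 oppr0; lra.
move/eqP; rewrite /L oppr_eq0 !mulf_eq0 (gt_eqF (kap_gt0 R)) (gt_eqF nu0) => /eqP.
by [].
Qed.

End Moments.

(** * Propagation of the zero solution *)

Section ContinuousFunctions.
Context (R : realType).
Local Notation mu := (@lebesgue_measure R).

(** Continuous induction: where [E] is small, [m <= C m^2] leaves only [m = 0]
    for the maximum [m] of [E], so the zero set cannot stop before [T]. *)
Lemma quadratic_bound_vanishes (E : R -> R) (s T C : R) : continuous E ->
  (forall t, 0 <= E t) -> 0 <= C -> s <= T -> E s = 0 ->
  (forall t m, s <= t -> t <= T -> 0 <= m ->
    (forall r, r \in `[s, t] -> E r <= m) -> E t <= C * m ^+ 2) ->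
  forall t, t \in `[s, T] -> E t = 0.
Proof.
move=> cE E0 C0 sT Es quad.
pose S : set R := [set r | s <= r <= T /\ forall x, x \in `[s, r] -> E x = 0].
have Ss : S s.
  split; first by rewrite lexx.
  by move=> x; rewrite in_itv/= -eq_le => /eqP <-.
have ubS : has_ubound S by exists T => r [/andP[]].
have supS : has_sup S by split=> //; exists s.
set c := sup S.
have sc : s <= c by exact: ub_le_sup.
(* below this level [C * E t < 1] *)
pose eta : R := (2 * (C + 1))^-1.
have C1 : 0 < C + 1 by rewrite ltr_wpDl.
have eta0 : 0 < eta by rewrite invr_gt0 mulr_gt0.
have eta20 : 0 < eta / 2 by rewrite divr_gt0.
have /cvgrPdist_lt/(_ _ eta20)[d /= d0 dE] := cE c.
have [r Sr cr] := sup_adherent d0 supS; rewrite -/c in cr.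
have rc : r <= c by exact: ub_le_sup.
have [/andP[sr rT] Er] := Sr.
have cd x : `|c - x| < d -> E x < eta.
  move=> /dE /= h1; have /dE /= h2 : `|c - r| < d.
    by rewrite ger0_norm ?subr_ge0//; lra.
  rewrite (Er r) ?in_itv/= ?lexx ?sr// subr0 in h2.
  by move: h1 h2; rewrite !ltr_norml => /andP[? ?] /andP[? ?]; lra.
pose r' : R := Num.min T (c + d / 2).
have sr' : s <= r' by rewrite le_min sT; lra.
have r'T : r' <= T by rewrite ge_min lexx.
have r'c : r' <= c + d / 2 by rewrite ge_min lexx orbT.
have Sr' : S r'.
  split; first by rewrite sr'.
  (* the maximum of E up to r' is either in the zero set or below eta *)
  have [p pin pmax] := EVT_max sr' (continuous_subspaceT cE).
  have /andP[sp pr'] : s <= p <= r' by move: pin; rewrite in_itv.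
  suff Ep : E p = 0.
    by move=> x /pmax xp; apply/eqP; rewrite eq_le E0 andbT -Ep.
  have [pr|rp] := leP p r; first by apply: Er; rewrite in_itv/= sp.
  have Epe : E p < eta by apply: cd; rewrite ltr_norml; lra.
  have q : E p <= C * E p ^+ 2.
    apply: quad => //; first exact: le_trans r'T.
    move=> x; rewrite in_itv/= => /andP[sx xp]; apply: pmax.
    by rewrite in_itv/= sx (le_trans xp).
  have := E0 p; rewrite le_eqVlt => /predU1P[//|Ep0].
  have : E p * 1 <= E p * (C * E p) by rewrite mulr1 mulrCA -expr2.
  rewrite ler_pM2l// => h1.
  have h2 : C * E p <= C * eta by rewrite ler_wpM2l// ltW.
  have h3 : C * eta < 1.
    by rewrite /eta ltr_pdivrMr ?mul1r ?mulr_gt0//; lra.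
  lra.
have r'le : r' <= c by exact: ub_le_sup.
have r'E : r' = T.
  by move: r'le; rewrite /r' minEle; case: ifP => // _; lra.
by case: Sr' => _; rewrite r'E.
Qed.

Lemma continuous_integral_eq0 (f : R -> R) (s t : R) : continuous f -> s < t ->
  (forall x, x \in `[s, t] -> 0 <= f x) ->
  \int[mu]_(x in `[s, t]) f x = 0 -> f s = 0.
Proof.
move=> cf st f0 int0; apply/eqP/negP => /negP fs.
have fs0 : 0 < f s by rewrite lt_def fs f0// in_itv/= lexx ltW.
have fs2 : 0 < f s / 2 by rewrite divr_gt0.
have /cvgrPdist_lt/(_ _ fs2)[d /= d0 dE] := cf s.
pose r : R := Num.min t (s + d / 2).
have sr : s < r by rewrite lt_min st; lra.
have rt : r <= t by rewrite ge_min lexx.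
have rd : r <= s + d / 2 by rewrite ge_min lexx orbT.
have low x : x \in `[s, r] -> f s / 2 <= f x.
  rewrite in_itv/= => /andP[sx xr].
  have /dE /= : `|s - x| < d by rewrite ltr_norml; lra.
  by rewrite ltr_norml => /andP[_ ?]; lra.
have If := continuous_integrable_itv s t cf.
have Ifr := continuous_integrable_itv s r cf.
have h1 : \int[mu]_(x in `[s, r]) (f s / 2) <= \int[mu]_(x in `[s, r]) f x.
  by apply: le_Rintegral => //; exact: integrable_cst_itv.
have h2 : \int[mu]_(x in `[s, r]) f x <= \int[mu]_(x in `[s, t]) f x.
  rewrite -lee_fin !EFin_Rintegral//; apply: ge0_subset_integral => //.
  - by apply/measurable_EFinP; exact: continuous_measurable_itv.
  - by apply: subset_itvl; rewrite bnd_simp.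
move: h1; rewrite Rintegral_cst_itv ?(ltW sr)// => h1.
have pos : 0 < f s / 2 * (r - s) by rewrite mulr_gt0// subr_gt0.
by have := lt_le_trans pos (le_trans h1 h2); rewrite int0 ltxx.
Qed.

End ContinuousFunctions.

Section Vanishing.
Context (R : realType).
Local Notation mu := (@lebesgue_measure R).
Local Notation kap := ((Num.sqrt (2 * pi))^-1 : R).
Variables (nu T : R) (phi : R -> R) (u : R -> R -> R).
Hypotheses (nu0 : 0 < nu) (T0 : 0 <= T) (cu : continuous_in_Zdot T 2 2 u).
Hypotheses (Zphi : Zdot 2 2 phi) (sol : is_solution nu T phi u).
Local Notation J := (selfconv T u).
Local Notation a := (uhat T u).
Local Notation A := (energy T u).

Lemma energy_eq0 t : A t = 0 -> {ae mu, forall x, upath T u t x = 0}.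
Proof.
move=> At; have Isq := sqr_integrable T0 cu t.
have E : (\int[mu]_x `|(upath T u t x ^+ 2)%:E| = 0)%E.
  under eq_integral do rewrite gee0_abs ?lee_fin ?sqr_ge0//.
  by rewrite -EFin_Rintegral// -/(energy T u t) At.
have := (ae_eq_integral_abs mu measurableT (measurable_int _ Isq)).1 E.
apply: ae_imp => x /(_ I) /= [] /eqP.
by rewrite sqrf_eq0 => /eqP.
Qed.

Lemma uhat_eq0 t xi : A t = 0 -> a t xi = 0.
Proof.
move=> At; rewrite /uhat fourierE.
rewrite (@ae_eq_cintegral _ _ _ (fun=> 0)) ?cintegral0 ?mulr0//.
- exact: cintegrable_measurable (fourier_integrand _ (toC_upath_integrable T0 cu t)).
- by apply: ae_imp (energy_eq0 At) => x ux _; rewrite /toC ux rmorph0 mulr0.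
Qed.

Lemma normc_selfconv_energy t xi : normc (J t xi) <= kap * (2 * A t).
Proof.
rewrite -(selfconv_clamp u T0) -(energy_clamp u T0 t).
rewrite (selfconv_fourier_sqr nu0 T0 cu Zphi sol)//; last exact: clamp_in.
have Isq := sqr_integrable T0 cu (clamp T t).
apply: (le_trans (normc_fourier_le xi (toC_integrable Isq))).
rewrite le_eqVlt; apply/orP; left; apply/eqP; congr (_ * (2 * _)).
by apply: eq_Rintegral => x _; rewrite normc_real ger0_norm ?sqr_ge0.
Qed.

(** Half of Parseval's identity, with a constant 2 instead of 1: at frequency 0
    the transform of the square of the solution is its energy, and the
    self-convolution is at most the square of the norm of the transform. *)
Lemma energy_le_uhat t : A t <= 2 * \int[mu]_x (normc (a t x) ^+ 2).
Proof.
rewrite -(ler_pM2l (kap_gt0 R)) -(selfconv_Re0 nu0 T0 cu Zphi sol).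
apply: le_trans (normc_selfconv_le T0 cu t 0).
exact: le_trans (ler_norm _) (normc_geRe _).
Qed.

Definition growth_constant : R :=
  2 * (2 * kap * smoothing_constant nu T) ^+ 2 * \int[mu]_x ((1 + x ^+ 2)^-1).

Lemma growth_constant_ge0 : 0 <= growth_constant.
Proof.
rewrite mulr_ge0//; first by rewrite mulr_ge0// sqr_ge0.
by apply: Rintegral_ge0 => x _; rewrite invr_ge0 addr_ge0// sqr_ge0.
Qed.

(** Started from zero, the solution is its own Duhamel term, which is quadratic. *)
Lemma energy_quadratic s t m : 0 <= s -> s <= t -> t <= T -> A s = 0 -> 0 <= m ->
  (forall r, r \in `[s, t] -> A r <= m) -> A t <= growth_constant * m ^+ 2.
Proof.
move=> s0 st tT As m0 Am.
pose K : R := 2 * kap * smoothing_constant nu T * m.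
have K0 : 0 <= K.
  by rewrite !mulr_ge0// ?(ltW (kap_gt0 R))// smoothing_constant_ge0.
have bound xi : normc (a t xi) <= K / (1 + xi ^+ 2).
  rewrite (uhat_duhamel nu0 T0 cu Zphi sol xi s0 st tT) (uhat_eq0 xi As) mulr0 sub0r normcN.
  have km0 : 0 <= kap * (2 * m) by rewrite !mulr_ge0// ltW// kap_gt0.
  apply: le_trans (duhamel_le nu0 T0 cu (K := kap * (2 * m)) _ s0 st tT km0) _.
    move=> r rst; apply: le_trans (normc_selfconv_energy r xi) _.
    by rewrite ler_wpM2l ?(ltW (kap_gt0 R))// ler_wpM2l// Am.
  by rewrite le_eqVlt; apply/orP; left; apply/eqP; rewrite /K; ring.
have Ii := @integrable_inv1sqr R.
apply: le_trans (energy_le_uhat t) _.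
rewrite /growth_constant -!mulrA ler_pM2l//.
apply: (@le_trans _ _ (\int[mu]_x (K ^+ 2 * (1 + x ^+ 2)^-1))).
  apply: le_Rintegral => //.
  - exact: weighted_sqr (uhat_weighted T0 cu t).
  - exact: integrableRZ.
  - move=> x _; have x1 : 1 <= 1 + x ^+ 2 by rewrite lerDl sqr_ge0.
    have x0 : 0 < 1 + x ^+ 2 by rewrite (lt_le_trans _ x1).
    apply: (@le_trans _ _ ((K / (1 + x ^+ 2)) ^+ 2)).
      by rewrite lerXn2r ?nnegrE ?normc_ge0// divr_ge0// ltW.
    rewrite exprMn ler_wpM2l ?sqr_ge0// expr2 ler_piMl ?invr_ge0 ?(ltW x0)//.
    by rewrite invf_le1.
rewrite (RintegralZl _ measurableT Ii) le_eqVlt; apply/orP; left; apply/eqP.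
by rewrite /K; ring.
Qed.

Lemma energy_stays_zero s t : 0 <= s -> s <= t -> t <= T -> A s = 0 -> A t = 0.
Proof.
move=> s0 st tT As.
apply: (@quadratic_bound_vanishes R A s T growth_constant) => //.
- exact: energy_continuous nu0 T0 cu Zphi sol.
- by move=> r; exact: energy_ge0.
- exact: growth_constant_ge0.
- exact: le_trans tT.
- by move=> r m sr rT m0 mr; exact: energy_quadratic As m0 mr.
- by rewrite in_itv/= st.
Qed.

Local Notation decays t :=
  (mu.-integrable setT (EFin \o (fun x => `|x| ^+ 5 * upath T u t x ^+ 2))).

Let moment_algebra (d x y j e : R) :
  d * x + 2^-1 * j = 0 -> j <= d * e -> y = x + 2^-1 * e -> 0 <= d * y.
Proof. by move=> h1 h2 ->; rewrite mulrDr mulrCA; lra. Qed.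

(** The first moment is nondecreasing by [moment_law]. The identity between the
    two later times makes it nonpositive at [tb], the one between the two
    earlier times makes it nonnegative there. So it vanishes at [tb], and with
    it the integral of [A] weighted by [tc - tau]. *)
Lemma energy_middle_time ta tb tc : 0 <= ta -> ta < tb -> tb < tc -> tc <= T ->
  decays ta -> decays tb -> decays tc -> A tb = 0.
Proof.
move=> a0 ab bc cT Da Db Dc.
have b0 : 0 <= tb by apply: le_trans a0 (ltW ab).
have bT : tb <= T by apply: le_trans (ltW bc) cT.
have cA := energy_continuous nu0 T0 cu Zphi sol.
have cl (x : R) : continuous (fun tau => (x - tau) * A tau).
  by apply: continuousMR => //; apply: continuousBR; [exact: continuous_cstR|exact: continuous_idR].
have I1 := moment_identity nu0 T0 cu Zphi sol a0 (ltW ab) bT Da Db.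
have I2 := moment_identity nu0 T0 cu Zphi sol b0 (ltW bc) cT Db Dc.
have I3 := moment_law nu0 T0 cu Zphi sol a0 (ltW ab) bT.
have p2 : 0 <= \int[mu]_(tau in `[tb, tc]) ((tc - tau) * A tau).
  apply: Rintegral_ge0 => x; rewrite /= in_itv/= => /andP[_ xc].
  by rewrite mulr_ge0 ?subr_ge0// energy_ge0.
have p1 : \int[mu]_(tau in `[ta, tb]) ((tb - tau) * A tau) <=
    (tb - ta) * \int[mu]_(tau in `[ta, tb]) A tau.
  rewrite -(RintegralZl _ _ (continuous_integrable_itv ta tb cA))//.
  apply: le_Rintegral => //.
  - exact: continuous_integrable_itv.
  - exact: integrableRZ (continuous_integrable_itv ta tb cA).
  - move=> x; rewrite /= in_itv/= => /andP[ax _].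
    by rewrite ler_wpM2r ?energy_ge0// lerB.
have ba : 0 < tb - ta by rewrite subr_gt0.
have cb : 0 < tc - tb by rewrite subr_gt0.
have Mge : 0 <= moment T u tb.
  rewrite -(pmulr_rge0 _ ba); move: I1 p1 I3; exact: moment_algebra.
have M2 : 0 <= (tc - tb) * moment T u tb by rewrite mulr_ge0// ltW.
have Z2 : \int[mu]_(tau in `[tb, tc]) ((tc - tau) * A tau) = 0.
  by move: I2 p2 M2; set x := _ * _; set y := \int[mu]_(tau in _) _ => ? ? ?; lra.
have := continuous_integral_eq0 (cl tc) bc _ Z2.
move=> /(_ _)/eqP; rewrite mulf_eq0 gt_eqF//= => H; apply/eqP/H.
by move=> x; rewrite in_itv/= => /andP[_ xc]; rewrite mulr_ge0 ?subr_ge0// energy_ge0.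
Qed.

End Vanishing.

(** * Three times of higher decay *)

Lemma Z52_decay (R : realType) (f : R -> R) : Z (5 / 2) (5 / 2) f ->
  (@lebesgue_measure R).-integrable setT (EFin \o (fun x => `|x| ^+ 5 * f x ^+ 2)).
Proof.
move=> [_ [mf foo]]; apply: integrableR_ltoo => //.
- by apply: measurable_funM; [apply: measurable_funX => //; exact: measurable_normr|exact: measurable_funX].
- by move=> x _; exact: mulr_ge0 (exprn_ge0 5 (normr_ge0 x)) (sqr_ge0 _).
- suff <- : (fun x : R => ((`|x| `^ (2 * (5 / 2))) * f x ^+ 2)%:E) =
      (fun x => (`|x| ^+ 5 * f x ^+ 2)%:E) by [].
  apply/funext => x; rewrite (_ : 2 * (5 / 2) = 5%:R :> R) ?powR_mulrn//.
  by field.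
Qed.

Lemma middle_time (R : realType) (P Q : R -> Prop) (t1 t2 t3 : R) :
  (forall ta tb tc, ta < tb -> tb < tc -> P ta -> P tb -> P tc -> Q tb) ->
  t1 <> t2 -> t1 <> t3 -> t2 <> t3 -> P t1 -> P t2 -> P t3 -> exists t, Q t.
Proof.
move=> H /eqP n12 /eqP n13 /eqP n23 p1 p2 p3.
have [h12|h12|e] := ltgtP t1 t2; last by rewrite e eqxx in n12.
- have [h23|h23|e] := ltgtP t2 t3; last by rewrite e eqxx in n23.
    by exists t2; exact: (H t1 _ t3).
  have [h13|h13|e] := ltgtP t1 t3; last by rewrite e eqxx in n13.
    by exists t3; exact: (H t1 _ t2).
  by exists t1; exact: (H t3 _ t2).
- have [h13|h13|e] := ltgtP t1 t3; last by rewrite e eqxx in n13.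
    by exists t1; exact: (H t2 _ t3).
  have [h23|h23|e] := ltgtP t2 t3; last by rewrite e eqxx in n23.
    by exists t3; exact: (H t2 _ t1).
  by exists t2; exact: (H t3 _ t1).
Qed.

(* The labels t1, t2, t3 are not assumed to be ordered.  The time tstar has to
   lie in the existence interval as soon as t1 is not the final time T. *)
Theorem theorem1p8 (R : realType) (mu T : R) (phi : R -> R) (u : R -> R -> R)
    (t1 t2 t3 : R) :
  0 < mu -> 0 < T ->
  Zdot 2 2 phi ->
  continuous_in_Zdot T 2 2 u ->
  is_solution mu T phi u ->
  t1 \in `[0, T] -> t2 \in `[0, T] -> t3 \in `[0, T] ->
  t1 <> t2 -> t1 <> t3 -> t2 <> t3 ->
  Z (5 / 2) (5 / 2) (u t1) ->
  Z (5 / 2) (5 / 2) (u t2) ->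
  Z (5 / 2) (5 / 2) (u t3) ->
  exists tstar : R, t1 < tstar /\ (t1 < T -> tstar < T) /\
    forall t : R, t \in `[0, T] -> tstar <= t ->
      {ae @lebesgue_measure R, forall x, u t x = 0}.
Proof.
move=> mu0 T0 Zphi cu sol t1T t2T t3T n12 n13 n23 Z1 Z2 Z3.
have T0' := ltW T0.
have [tb [b0 bT Ab]] : exists t, [/\ 0 <= t, t < T & energy T u t = 0].
  apply: (@middle_time R (fun t => t \in `[0, T] /\ Z (5 / 2) (5 / 2) (u t)) _ t1 t2 t3) => //.
  move=> ta tb tc ab bc [aT Za] [bT Zb] [cT Zc].
  have /andP[a0 _] : 0 <= ta <= T by move: aT; rewrite in_itv.
  have /andP[b0 _] : 0 <= tb <= T by move: bT; rewrite in_itv.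
  have /andP[_ cT'] : 0 <= tc <= T by move: cT; rewrite in_itv.
  split => //; first exact: lt_le_trans cT'.
  by apply: (energy_middle_time mu0 T0' cu Zphi sol a0 ab bc cT');
    rewrite upath_id//; exact: Z52_decay.
have vanish t : t \in `[0, T] -> tb <= t ->
    {ae @lebesgue_measure R, forall x, u t x = 0}.
  move=> tT bt; rewrite -(upath_id u tT); apply: (energy_eq0 T0' cu).
  have tT' : t <= T by move: tT; rewrite in_itv => /andP[].
  exact: (energy_stays_zero mu0 T0' cu Zphi sol b0 bt tT').
have [t1lt|Tle] := ltP t1 T.
- (* the mean of t1 and T makes tstar larger than t1 even if the middle time is
     not; both are less than T *)
  exists (Num.max ((t1 + T) / 2) tb); split; first by rewrite lt_max; apply/orP; left; lra.
  split; first by move=> _; rewrite gt_max bT andbT; lra.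
  by move=> t tT; rewrite ge_max => /andP[_]; exact: vanish.
- (* for t1 = T no time of the interval comes after tstar *)
  exists (T + 1); split.
    by move: t1T; rewrite in_itv/= => /andP[_ ?]; lra.
  split; first by [].
  by move=> t; rewrite in_itv/= => /andP[_ tT] h; exfalso; lra.
Qed.
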